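(* Assume that $Z$ is a densely defined linear operator in a complete (Hausdorff) locally convex space $\mathbf{X}$ and $t>0$. Then the operator $Z$ possesses a closure and its closure is the generator of an $lC_0$-semigroup if and only if there exists a function $F\in\mathcal{F}_{\mathbf{X}}$ such that: (i) $\mathcal{D}(F'_{ef}(0))\supset\mathcal{D}(Z)$ and $F'_{ef}(0)g=Zg$ for $g\in\mathcal{D}(Z)$; (ii) $\mathcal{D}({F^*}'(0))$ is *-dense in $\mathbf{X}^*$; (iii) there exists a dense linear subspace $\mathbf{A}\subseteq\mathcal{D}(Z)$ of $\mathbf{X}$ such that for any $f\in\mathbf{A}$ and $s\ge0$ there exists a sequence $\{f_n^s\}_{n=1}^\infty$, $f_n^s\in\mathcal{D}(\overline{Z})$, satisfying: (a) $w\text{-}\lim_{n\to\infty}\left(F(\tfrac tn)^{[ns/t]}f-f_n^s\right)=0$; (b) every subsequence of $\{\overline{Z}f_n^s\}_{n\in\mathbb{N}}$ has a weakly convergent subsequence; (c) every subsequence of $\{f_n^s\}_{n\in\mathbb{N}}$ has a weakly convergent subsequence. Furthermore, if conditions (i)–(iii) are satisfied, then $\exp(t\overline{Z})f=\lim_{n\to\infty}F(t/n)^nf$ for each $f\in\mathbf{X}$.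
   Context: $\mathbf{X}$ is over $\mathbb{T}\in\{\mathbb{R},\mathbb{C}\}$ with topology generated by semi-norms $\|\cdot\|_\alpha$, $\alpha\in\Omega$. $\mathcal{L}(\mathbf{X})$ is the space of bounded linear operators in $\mathbf{X}$ with the topology of pointwise convergence; $I$ is the identity; $\mathcal{D}(C)$ is the domain of $C$; $[\cdot]$ is the integer part; $w\text{-}\lim$ is the limit in the weak topology $\sigma(\mathbf{X},\mathbf{X}^* )$. A family $G_\beta\in\mathcal{L}(\mathbf{X})$, $\beta\in\Gamma$, is equicontinuous if for any $\alpha\in\Omega$ there are finitely many $\alpha_1,\dots,\alpha_n\in\Omega$ and $b_1,\dots,b_n>0$ with $\sup_\beta\|G_\beta x\|_\alpha\le\sum_i b_i\|x\|_{\alpha_i}$ for all $x\in\mathbf{X}$. For $F:[0,\infty)\to\mathcal{L}(\mathbf{X})$ and $s\ge0$ put $\mathbf{B}^F_s=\{F(\tfrac dn)^m : md/n\le s,\ n,m\in\mathbb{N},\ d\ge0\}$. $\mathcal{E}_{\mathbf{X}}$ is the set of $F:[0,\infty)\to\mathcal{L}(\mathbf{X})$ with $F(0)=I$ and $\mathbf{B}^F_s$ equicontinuous for every $s\ge0$. Many-valued effective derivative: $\mathcal{D}(F'_{mef}(0))$ is the set of $f\in\mathbf{X}$ for which there is a family $\{f_s\}_{s\ge0}$ in $\mathbf{X}$ such that $\lim_{h\to0}f_h=f$ and $\lim_{h\to0}h^{-1}(F(h)-F(0))f_h$ exists (limits as $h\to 0$, $h>0$); $F'_{mef}(0)f$ is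 the set of all $g\in\mathbf{X}$ arising as the second limit for some such family. $\mathcal{F}_{\mathbf{X}}$ is the set of $F\in\mathcal{E}_{\mathbf{X}}$ with $\mathcal{D}(F'_{mef}(0))$ dense in $\mathbf{X}$. For $F\in\mathcal{F}_{\mathbf{X}}$ each $F'_{mef}(0)f$ consists of one element, and the effective derivative $F'_{ef}(0):\mathcal{D}(F'_{mef}(0))\to\mathbf{X}$ is the linear map with $F'_{ef}(0)f\in F'_{mef}(0)f$. A linear operator is closable (possesses a closure) if the closure of its graph in $\mathbf{X}\times\mathbf{X}$ is the graph of a linear operator, its closure $\overline{Z}$; condition (i) with $F\in\mathcal{F}_{\mathbf{X}}$ implies that $Z$ is closable, so that $\overline{Z}$ in (iii) makes sense. $\mathbf{X}^*$ is the space of continuous linear functionals with the strong topology (semi-norms $f\mapsto\sup_{x\in A}|f(x)|$, $A\subset\mathbf{X}$ bounded). $F^*(s)=(F(s))^*$. The strong derivative at $0$ of $S:[0,\infty)\to\mathcal{L}(\mathbf{E})$ is $S'(0)\psi=\lim_{h\to0}h^{-1}(S(h)\psi-S(0)\psi)$ with domain $\mathcal{D}(S'(0))$ the set of $\psi\in\mathbf{E}$ for which the limit exists; for $S=F^*$ one takes $\mathbf{E}=\mathbf{X}^*$. A set $A\subset\mathbf{X}^*$ is *-dense in $\mathbf{X}^*$ if for each $\phi\in\mathbf{X}^*$ there is a sequence $\phi_k\in A$ with $\lim_k\phi_k(x)=\phi(x)$ for each $x$ in the completion of $\mathbf{X}$. An $lC_0$-semigroup is a continuous function $T:[0,\infty)\to\mathcal{L}(\mathbf{X})$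 with $T(0)=I$, $T(l+m)=T(l)T(m)$ for $l,m\ge0$, and $T\in\mathcal{E}_{\mathbf{X}}$. Its generator is its strong derivative $T'(0)$; if $Z$ is the generator of $T$, one writes $T(t)=\exp(tZ)$. *)

(* Defs.v *)
From HB Require Import structures.
From mathcomp Require Import all_boot all_order all_algebra.
From mathcomp Require Import complex.
From mathcomp Require Import all_classical all_reals all_analysis.

Set Implicit Arguments.
Unset Strict Implicit.
Unset Printing Implicit Defensive.

Import Order.TTheory GRing.Theory Num.Theory.
Import numFieldTopology.Exports numFieldNormedType.Exports.

Local Open Scope classical_set_scope.
Local Open Scope ring_scope.

Variant scalar_kind := RealScalars | ComplexScalars.

Definition scalar_field (R : realType) (k : scalar_kind) : numFieldType :=
  match k with
  | RealScalars => R
  | ComplexScalars => complex R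
  end.

Definition of_real (R : realType) (k : scalar_kind) : R -> scalar_field R k :=
  match k return R -> scalar_field R k with
  | RealScalars => id
  | ComplexScalars => real_complex R
  end.

Section ContinuousLinearMaps.
Context (K : numFieldType) (X Y : tvsType K).

Definition lc_pred : {pred X -> Y} :=
  fun f => `[< linear f /\ continuous f >].

Record lcfun := LCFun { lc_fun :> X -> Y; lc_funP : lc_fun \in lc_pred }.

HB.instance Definition _ := [isSub for lc_fun].
HB.instance Definition _ := [Choice of lcfun by <:].

Lemma lc_linear (f : lcfun) : linear f.
Proof. by have /asboolP[] := lc_funP f. Qed.

Lemma lc_continuous (f : lcfun) : continuous f.
Proof. by have /asboolP[] := lc_funP f. Qed.

Lemma lc_pred_submod : GRing.submod_closed lc_pred.
Proof.
split=> [|a f g].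
  apply/asboolP; split; last by move=> x; exact: cvg_cst.
  by move=> b x y; rewrite /GRing.zero /= scaler0 addr0.
move=> /asboolP[lf cf] /asboolP[lg cg]; apply/asboolP; split.
  move=> b x y; change (a *: f (b *: x + y) + g (b *: x + y) =
    b *: (a *: f x + g x) + (a *: f y + g y)).
  by rewrite lf lg !scalerDr !scalerA (mulrC a b) addrACA.
move=> x; change ((fun y : X => a *: f y + g y) @ x --> a *: f x + g x).
apply: (@continuous2_cvg _ _ _ _ _ _ _ _ (fun u v : Y => u + v)).
- exact: (@add_continuous Y (a *: f x, g x)).
- apply: (@continuous2_cvg _ _ _ _ _ _ (fun=> a : K^o) f (fun u v => u *: v)).
  + exact: (@scale_continuous K Y (a, f x)).
  + exact: cvg_cst.
  + exact: cf.
- exact: cg.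
Qed.

HB.instance Definition _ := GRing.isSubmodClosed.Build K (X -> Y) lc_pred
  lc_pred_submod.
HB.instance Definition _ := [SubChoice_isSubLmodule of lcfun by <:].

End ContinuousLinearMaps.

(* Boundedness of operators is continuity, i.e. each seminorm of G x is dominated
   by a linear combination of seminorms of x. *)
Notation "''L' ( X )" := (lcfun X X) (at level 8, format "''L' ( X )").

Section Composition.
Context (K : numFieldType) (X Y W : tvsType K).

Lemma lc_id_subproof : (id : X -> X) \in @lc_pred K X X.
Proof. by apply/asboolP; split=> // x; exact: cvg_id. Qed.

Definition lc_id : 'L(X) := LCFun lc_id_subproof.

Lemma lc_comp_subproof (g : lcfun Y W) (f : lcfun X Y) :
  (g \o f) \in @lc_pred K X W.
Proof.
apply/asboolP; split=> [a x y /=|x]; first by rewrite !lc_linear.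
by apply: continuous_comp; exact: lc_continuous.
Qed.

Definition lc_comp (g : lcfun Y W) (f : lcfun X Y) : lcfun X W :=
  LCFun (lc_comp_subproof g f).
End Composition.

Definition lc_pow (K : numFieldType) (X : tvsType K) (G : 'L(X)) (m : nat) :
  'L(X) := iter m (lc_comp G) (lc_id X).

Section LocallyConvex.
Context (K : numFieldType) (X : tvsType K).

(* Seminorms are K-valued, as norms are in this library: 0 <= q x forces q x to
   be a nonnegative real number also when K is the field of complex numbers. *)
Definition is_seminorm (q : X -> K) : Prop :=
  [/\ forall x, 0 <= q x,
      forall x y, q (x + y) <= q x + q y
    & forall a x, q (a *: x) = `|a| * q x].

Definition generate_topology (Omega : Type) (p : Omega -> X -> K) : Prop :=
  forall A : set X, nbhs 0 A <->
    exists (n : nat) (a : 'I_n -> Omega) (e : K),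
      0 < e /\ forall x, (forall i, p (a i) x < e) -> A x.

(* A tvsType carries a uniform structure which induces its topology but need not
   be translation invariant. Completeness of a locally convex space refers to
   the uniformity of the additive group, hence no use of cauchy here. *)
Definition cauchy_filter (F : set_system X) : Prop :=
  forall U, nbhs 0 U ->
    exists2 A, F A & forall x y, A x -> A y -> U (x - y).

Definition complete_tvs : Prop :=
  forall F : set_system X, ProperFilter F -> cauchy_filter F ->
    exists x : X, F --> x.

Definition bounded_subset (A : set X) : Prop :=
  forall U, nbhs 0 U ->
    exists2 r : K, 0 < r &
      forall c, r <= `|c| -> A `<=` [set c *: x | x in U].

Definition is_subspace (V : lmodType K) (A : set V) : Prop :=
  A 0 /\ forall (a : K) x y, A x -> A y -> A (a *: x + y).

(* Partially defined (and many-valued) operators are represented by their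
   graphs: Z (x, y) means that y is a value of Z at x. *)
Definition domain (E : Type) (Z : set (E * E)) : set E := Z.`1.

Definition linear_operator (Z : set (X * X)) : Prop :=
  is_subspace Z /\ forall x y y', Z (x, y) -> Z (x, y') -> y = y'.

Definition dual : Type := lcfun X K^o.
HB.instance Definition _ := GRing.Lmodule.on dual.

Definition dual_fun (phi : dual) : {family bounded_subset, X -> K^o} := phi.

(* The strong topology, generated by phi |-> sup_(x in A) `|phi x| for bounded
   A, is that of uniform convergence on bounded sets. *)
HB.instance Definition _ := Topological.copy dual (initial_topology dual_fun).

Definition adjoint (G : 'L(X)) (phi : dual) : dual := lc_comp phi G.

Definition weak_cvg (u : nat -> X) (x : X) : Prop :=
  forall phi : dual, phi (u n) @[n --> \oo] --> phi x.

Definition subseq_weak_cvg (u : nat -> X) : Prop :=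
  forall k : nat -> nat, {homo k : m n / (m < n)%N} ->
    exists (l : nat -> nat) (x : X),
      {homo l : m n / (m < n)%N} /\ weak_cvg (u \o k \o l) x.

(* Pointwise convergence is required on X only, since star_dense is used for a
   complete X, which is its own completion. *)
Definition star_dense (A : set dual) : Prop :=
  forall phi : dual, exists2 psi : nat -> dual,
    (forall k, A (psi k)) &
    forall x : X, psi k x @[k --> \oo] --> phi x.

End LocallyConvex.

(* Functions on [0, +oo[ are represented by functions on R; every condition
   below only involves their values at nonnegative arguments. *)
Section Semigroups.
Context (R : realType) (k : scalar_kind).
Local Notation K := (scalar_field R k).
Local Notation "h %:K" := (of_real k h) (at level 2, format "h %:K").

Definition strong_derivative (E : preTopologicalLmodType K) (S : R -> E -> E) :
  set (E * E) :=
  [set xy | (h%:K)^-1 *: (S h xy.1 - S 0 xy.1) @[h --> 0^'+] --> xy.2].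

Context (X : tvsType K) (Omega : Type) (p : Omega -> X -> K).

Definition equicontinuous_set (B : set 'L(X)) : Prop :=
  forall al, exists (n : nat) (a : 'I_n -> Omega) (b : 'I_n -> K),
    (forall i, 0 < b i) /\
    forall G, B G -> forall x,
      p al (G x) <= \sum_(i < n) b i * p (a i) x.

Definition power_set (F : R -> 'L(X)) (s : R) : set 'L(X) :=
  [set G | exists (d : R) (n m : nat),
    [/\ 0 <= d, (0 < n)%N, (0 < m)%N, m%:R * d / n%:R <= s
      & G = lc_pow (F (d / n%:R)) m]].

Definition E_class (F : R -> 'L(X)) : Prop :=
  F 0 = lc_id X /\ forall s, 0 <= s -> equicontinuous_set (power_set F s).

Definition mef_derivative (F : R -> 'L(X)) : set (X * X) :=
  [set fg | exists u : R -> X,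
    u h @[h --> 0^'+] --> fg.1 /\
    (h%:K)^-1 *: (F h - F 0) (u h) @[h --> 0^'+] --> fg.2].

Definition F_class (F : R -> 'L(X)) : Prop :=
  E_class F /\ dense (domain (mef_derivative F)).

(* For F in F_class the many-valued effective derivative is single-valued, so
   that its graph is the graph of the effective derivative. *)
Definition ef_derivative (F : R -> 'L(X)) : set (X * X) := mef_derivative F.

Definition adjoint_family (F : R -> 'L(X)) : R -> dual X -> dual X :=
  fun s => adjoint (F s).

Definition lC0_semigroup (T : R -> 'L(X)) : Prop :=
  [/\ {within `[0, +oo[, continuous (T : R -> {ptws X -> X})},
      T 0 = lc_id X,
      forall l m, 0 <= l -> 0 <= m -> T (l + m) = lc_comp (T l) (T m)
    & E_class T].

Definition generator (T : R -> 'L(X)) : set (X * X) :=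
  strong_derivative (E := X) T.

Definition extends_to_ef (Z : set (X * X)) (F : R -> 'L(X)) : Prop :=
  domain Z `<=` domain (ef_derivative F) /\
  forall g z w, Z (g, z) -> ef_derivative F (g, w) -> w = z.

Definition dual_condition (F : R -> 'L(X)) : Prop :=
  star_dense
    (domain (strong_derivative (E := dual X : preTopologicalLmodType K)
               (adjoint_family F))).

(* In weak_approximation the values at n = 0 are irrelevant, and v n stands for
   the value of the closure of Z at u n. *)
Definition weak_approximation (Z : set (X * X)) (t : R) (F : R -> 'L(X))
    (f : X) (s : R) : Prop :=
  exists u v : nat -> X,
    [/\ forall n, (0 < n)%N -> closure Z (u n, v n),
        weak_cvg (fun n =>
          lc_pow (F (t / n%:R)) (Num.truncn (n%:R * s / t)) f - u n) 0,
        subseq_weak_cvg v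
      & subseq_weak_cvg u].

Definition approximation_condition (Z : set (X * X)) (t : R)
    (F : R -> 'L(X)) : Prop :=
  exists A : set X,
    [/\ is_subspace A, A `<=` domain Z, dense A
      & forall f s, A f -> 0 <= s -> weak_approximation Z t F f s].

End Semigroups.

(* Main.v *)
(* All real continuous seminorms are used at once, with [V] the real vector space
   underlying [X]; [F_h] denotes [F h].

   Sufficiency.  Let [f] be in [A] and [f_n(s) = F(t/n)^[ns/t] f].  As [f] is in
   the domain of [Z], the [f_n] are asymptotically equi-Lipschitz, and by (a) and
   (c) a diagonal subsequence converges weakly at each [s] to a Lipschitz
   trajectory [u].  Put [v a = int_0^a u].  If [psi] is in the domain of the
   derivative of the adjoint family at 0, with value [eta], then
   [psi (u a - f) = eta (v a)].  The claim is that [v a] is in the domain of the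
   closure of [Z], with value [u a - f].  Otherwise Hahn-Banach gives functionals
   [rho1], [rho2] with [rho1 x + rho2 y = 0] on [Z] and
   [rho1 (v a) + rho2 (u a - f) != 0].  Take [psi_k] converging pointwise to
   [rho2].  By (a)-(c) each [u s] is in the domain of the closure, with value
   [w s] say, so that [eta_k (u s) = psi_k (w s)] tends to
   [rho2 (w s) = - rho1 (u s)]; the functions [eta_k o u] are derivatives of
   [psi_k o u] and are uniformly bounded, by Banach-Steinhaus on the bounded set
   of difference quotients of [u].  Dominated convergence then gives
   [rho2 (u a - f) = - rho1 (v a)], a contradiction.

   Once [u = f + Z v] is known, the argument of Chernoff (consistency and
   stability imply convergence) applies to [v (. + s) - v], a classical solution
   of the Cauchy problem, and shows that [F_h^[a/h] f] converges strongly to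
   [u a] as [h] tends to 0.  The limits form the semigroup.

   Necessity.  Take [F = T]. *)
Require Import Defs.
From HB Require Import structures.
From mathcomp Require Import all_boot all_order all_algebra.
From mathcomp Require Import complex lra ring.
From mathcomp Require Import all_classical all_reals all_analysis.
Set Implicit Arguments.
Unset Strict Implicit.
Unset Printing Implicit Defensive.
Import Order.TTheory GRing.Theory Num.Theory.
Import numFieldTopology.Exports numFieldNormedType.Exports.
Local Open Scope classical_set_scope.
Local Open Scope ring_scope.

(** * Identities between linear combinations *)

(** Semigroups of this kind are controlled on bounded time intervals only, and their generators need
    not have a resolvent: for translations of continuous functions on the line every scalar is an
    eigenvalue. So the resolvent proof of Chernoff's theorem and the range condition that identifies
    a generator give way to direct estimates of powers over a bounded total time. Equicontinuity
    replaces one seminorm by a larger one, hence it may be used once per estimate but not iterated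
    over the steps. The weak trajectory [u] satisfies no differential equation that can be used
    directly. Its values lie in the domain of the closure of [Z], but nothing makes the values of
    that operator along [u] continuous or even measurable in time, so they cannot be integrated in
    [X]. Only scalar functions such as [eta_k (u s)] are continuous, which is why the equation is
    tested by functionals and reached for the integral [v] of [u], whose differences
    [v (a + s) - v a] have a continuous derivative. The weak limit exists along a subsequence that
    depends on [f]; the strong convergence obtained afterwards, along all small steps, removes this
    dependence. *)

Section LinearExpressions.
Context {R : pzRingType} {V : lmodType R}.

Inductive lexpr := LVar of nat | LAdd of lexpr & lexpr | LOpp of lexpr
  | LZero | LScale of R & lexpr.

Fixpoint leval (env : seq V) (e : lexpr) : V :=
  match e with
  | LVar n => nth 0 env n
  | LAdd e1 e2 => leval env e1 + leval env e2
  | LOpp e1 => - leval env e1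
  | LZero => 0
  | LScale c e1 => c *: leval env e1
  end.

Fixpoint lcoef (e : lexpr) (i : nat) : R :=
  match e with
  | LVar n => if n == i then 1 else 0
  | LAdd e1 e2 => lcoef e1 i + lcoef e2 i
  | LOpp e1 => - lcoef e1 i
  | LZero => 0
  | LScale c e1 => c * lcoef e1 i
  end.

Lemma levalE env e : leval env e = \sum_(i < size env) lcoef e i *: env`_i.
Proof.
elim: e => [n|e1 IH1 e2 IH2|e1 IH1||c e1 IH1] /=.
- have [nlt|nge] := ltnP n (size env).
    rewrite (bigD1 (Ordinal nlt)) //= eqxx scale1r big1 ?addr0 // => i.
    by rewrite -val_eqE /= eq_sym => /negPf->; rewrite scale0r.
  rewrite nth_default // big1 // => i _; case: eqP => [ni|]; last by rewrite scale0r.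
  by move: nge; rewrite ni leqNgt ltn_ord.
- by rewrite IH1 IH2 -big_split; apply: eq_bigr => i _; rewrite scalerDl.
- by rewrite IH1 -sumrN; apply: eq_bigr => i _; rewrite scaleNr.
- by rewrite big1 // => i _; rewrite scale0r.
- by rewrite IH1 scaler_sumr; apply: eq_bigr => i _; rewrite scalerA.
Qed.

(** A conjunction computed by recursion, rather than a bounded quantifier, so that it unfolds to
    finitely many scalar equations. *)
Fixpoint lall (n : nat) (P : nat -> Prop) : Prop :=
  if n is n'.+1 then P n' /\ lall n' P else True.

Lemma leval_eq env e1 e2 : lall (size env) (fun i => lcoef e1 i = lcoef e2 i) ->
  leval env e1 = leval env e2.
Proof.
rewrite !levalE => h; apply: eq_bigr => -[i /= ilt] _; congr (_ *: _).
elim: (size env) h ilt => //= n IH [hn h]; rewrite ltnS leq_eqVlt.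
by move=> /orP[/eqP->//|]; exact: IH.
Qed.

End LinearExpressions.

(* Atoms are compared up to conversion, as different paths in the hierarchy of
   structures lead to distinct but convertible sums. *)
Ltac linear_lookup x env :=
  match env with
  | cons x _ => constr:(O)
  | cons ?y _ => let _ := match goal with _ => unify x y end in constr:(O)
  | cons _ ?env' => let n := linear_lookup x env' in constr:(S n)
  end.

Ltac linear_insert x env :=
  match tt with
  | _ => let _ := linear_lookup x env in env
  | _ => constr:(cons x env)
  end.

Ltac linear_atoms e env :=
  lazymatch e with
  | (?a + ?b)%R => let env1 := linear_atoms a env in linear_atoms b env1
  | (- ?a)%R => linear_atoms a env
  | 0%R => env
  | (_ *: ?a)%R => linear_atoms a env
  | _ => linear_insert e env
  end.

Ltac linear_reify e env :=
  lazymatch e with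
  | (?a + ?b)%R =>
    let a' := linear_reify a env in
    let b' := linear_reify b env in uconstr:(LAdd a' b')
  | (- ?a)%R => let a' := linear_reify a env in uconstr:(LOpp a')
  | 0%R => uconstr:(LZero)
  | (?c *: ?a)%R => let a' := linear_reify a env in uconstr:(LScale c a')
  | _ => let n := linear_lookup e env in uconstr:(LVar n)
  end.

(* Leaves the equalities of the coefficients of each vector which [ring] cannot
   prove. *)
Ltac module_eq V :=
  lazymatch goal with
  | |- @eq ?T ?a ?b =>
    let env0 := constr:(@nil T) in
    let env1 := linear_atoms a env0 in
    let env := linear_atoms b env1 in
    let a' := linear_reify a env in
    let b' := linear_reify b env in
    change (@leval _ V env a' = @leval _ V env b');
    apply: leval_eq; cbn [size lall lcoef eqn eq_op]; rewrite /=; repeat split; try ring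
  end.

Lemma ler_of_eq (R : numDomainType) (x y : R) : x = y -> x <= y.
Proof. by move=> ->. Qed.

(** * Seminorms and primitives *)

Section Seminorms.
Context {R : realType} {V : lmodType R}.
Implicit Types (q : V -> R) (x y z : V).

Definition seminorm q : Prop :=
  (forall x y, q (x + y) <= q x + q y) /\
  (forall a x, q (a *: x) = `|a| * q x).

Lemma seminormZ q : seminorm q -> forall a x, q (a *: x) = `|a| * q x.
Proof. by case. Qed.

Lemma seminormD q : seminorm q -> forall x y, q (x + y) <= q x + q y.
Proof. by case. Qed.

Lemma seminorm0 q : seminorm q -> q 0 = 0.
Proof. by move=> sq; rewrite -(scale0r 0) (seminormZ sq) normr0 mul0r. Qed.

Lemma seminormN q : seminorm q -> forall x, q (- x) = q x.
Proof. by move=> sq x; rewrite -scaleN1r (seminormZ sq) normrN1 mul1r. Qed.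

Lemma seminorm_ge0 q : seminorm q -> forall x, 0 <= q x.
Proof.
move=> sq x; have := seminormD sq x (- x).
by rewrite subrr (seminorm0 sq) (seminormN sq); lra.
Qed.

Lemma seminormB q : seminorm q -> forall x y, q (x - y) <= q x + q y.
Proof. by move=> sq x y; rewrite -(seminormN sq y); exact: seminormD. Qed.

Lemma seminormC q : seminorm q -> forall x y, q (x - y) = q (y - x).
Proof. by move=> sq x y; rewrite -(seminormN sq) opprB. Qed.

Lemma seminorm_dist q : seminorm q ->
  forall y x z, q (x - z) <= q (x - y) + q (y - z).
Proof.
by move=> sq y x z; apply: le_trans (seminormD sq _ _); rewrite addrA subrK.
Qed.

Lemma seminorm_sub q : seminorm q -> forall y x, q x <= q y + q (x - y).
Proof.
by move=> sq y x; apply: le_trans (seminormD sq _ _); rewrite addrC subrK.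
Qed.

Lemma seminorm_sum q (I : Type) (s : seq I) (P : pred I) (f : I -> V) :
  seminorm q -> q (\sum_(i <- s | P i) f i) <= \sum_(i <- s | P i) q (f i).
Proof.
move=> sq; elim/big_rec2: _ => [|i y x _ h]; first by rewrite seminorm0.
by apply: le_trans (sq.1 _ _) _; rewrite lerD2l.
Qed.

Lemma seminorm_add q1 q2 : seminorm q1 -> seminorm q2 ->
  seminorm (fun x => q1 x + q2 x).
Proof.
move=> s1 s2; split=> [x y|a x].
  by have := s1.1 x y; have := s2.1 x y; lra.
by rewrite (seminormZ s1) (seminormZ s2) mulrDr.
Qed.

Definition cauchy_for (Q : (V -> R) -> Prop) (u : nat -> V) :=
  forall q, Q q -> forall e, 0 < e ->
    exists N, forall m n, (N <= m)%N -> (N <= n)%N -> q (u m - u n) <= e.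

Definition limit_for (Q : (V -> R) -> Prop) (u : nat -> V) (x : V) :=
  forall q, Q q -> forall e, 0 < e -> \forall n \near \oo, q (u n - x) <= e.

(* The continuous seminorms of a sequentially complete Hausdorff locally convex
   space, as a substitute for its topology. *)
Record gauges := Gauges {
  gauge :> (V -> R) -> Prop;
  gauge_seminorm : forall q, gauge q -> seminorm q;
  gaugeD : forall q1 q2, gauge q1 -> gauge q2 -> gauge (fun x => q1 x + q2 x);
  gauge_le : forall q c q', seminorm q -> gauge q' ->
    (forall x, q x <= c * q' x) -> gauge q;
  gauge_sep : forall x, (forall q, gauge q -> q x = 0) -> x = 0;
  gauge_complete : forall u, cauchy_for gauge u -> exists x, limit_for gauge u x
}.

End Seminorms.
Arguments gauges {R} V.

Section Gauges.
Context {R : realType} {V : lmodType R} (Q : gauges V).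
Implicit Types (q : V -> R) (x y z : V).

Lemma gauge_ge0 q x : Q q -> 0 <= q x.
Proof. by move=> /gauge_seminorm/seminorm_ge0; apply. Qed.

Lemma gauge_eq0 x : (forall q e, Q q -> 0 < e -> q x <= e) -> x = 0.
Proof.
move=> h; apply: (@gauge_sep _ _ Q) => q Qq.
apply/le_anti; rewrite gauge_ge0 // andbT.
by apply/ler_addgt0Pl => e e0; rewrite addr0; exact: h.
Qed.

Lemma gaugeZ q c : Q q -> 0 <= c -> Q (fun x => c * q x).
Proof.
move=> Qq c0; have sq := gauge_seminorm Qq.
apply: (gauge_le (c := c) _ Qq) => //; split=> [x y|a x].
  by rewrite -mulrDr; apply: ler_wpM2l => //; exact: sq.1.
by rewrite (seminormZ sq) mulrCA.
Qed.

Lemma limit_for_uniq u x y : limit_for Q u x -> limit_for Q u y -> x = y.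
Proof.
move=> ux uy; apply/eqP; rewrite -subr_eq0; apply/eqP/gauge_eq0 => q e Qq e0.
have e2 : 0 < e / 2 by lra.
have [n [/= xn yn]] := filter_ex (filterI (ux q Qq _ e2) (uy q Qq _ e2)).
have sq := gauge_seminorm Qq.
have := seminorm_dist sq (u n) x y; rewrite (seminormC sq x (u n)); lra.
Qed.

End Gauges.

(** Takes the place of the mean value inequality. On a subdivision into [N] equal steps of length at
    most [d] the local bounds add up by the triangle inequality for [D], and the lengths
    telescope. *)
Lemma le_of_local (R : realType) (D : R -> R -> R) (a b e d : R) :
  (forall x y z, D x z <= D x y + D y z) -> 0 < d ->
  (forall x y, a <= x -> x <= y -> y <= b -> y - x <= d -> D x y <= e * (y - x)) ->
  a <= b -> D a b <= e * (b - a).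
Proof.
move=> tri d0 loc ab.
pose N := (Num.truncn ((b - a) / d)).+1.
have N0 : 0 < N%:R :> R by rewrite ltr0n.
have baN : (b - a) / N%:R <= d.
  rewrite ler_pdivrMr // mulrC -ler_pdivrMr //; apply/ltW.
  by rewrite /N; apply: real_truncnS_gt; exact: num_real.
pose c i : R := a + i%:R * ((b - a) / N%:R).
have step0 : 0 <= (b - a) / N%:R by apply: divr_ge0; rewrite ?subr_ge0 // ltW.
have cS i : c i.+1 = c i + (b - a) / N%:R by rewrite /c -natr1 mulrDl mul1r addrA.
have cN : c N = b by rewrite /c mulrCA divff ?lt0r_neq0 // mulr1 addrC subrK.
have ac i : a <= c i by rewrite /c lerDl mulr_ge0.
have cb i : (i <= N)%N -> c i <= b.
  move=> iN; rewrite -cN /c lerD2l ler_wpM2r // ler_nat //.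
have : forall i, (i <= N)%N -> D a (c i) <= e * (c i - a).
  elim=> [_|i IH iN].
    by apply: loc; rewrite ?ac ?cb // /c mul0r addr0 subrr ltW.
  have xy : c i.+1 - c i = (b - a) / N%:R by rewrite cS addrC addKr.
  have := loc (c i) (c i.+1) (ac i); rewrite cb // xy -subr_ge0 xy => /(_ step0 isT baN).
  rewrite -xy => h; apply: le_trans (tri a (c i) (c i.+1)) _.
  apply: le_trans (lerD (IH (ltnW iN)) h) _.
  by rewrite -mulrDr addrC addrA subrK.
by move=> /(_ N (leqnn N)); rewrite cN.
Qed.

Lemma truncn_divP (R : realType) (h a : R) : 0 < h -> 0 <= a ->
  (Num.truncn (a / h))%:R * h <= a /\ a <= (Num.truncn (a / h))%:R * h + h.
Proof.
move=> h0 a0; have /andP[l r] := truncn_itv (divr_ge0 a0 (ltW h0)).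
split; first by rewrite -ler_pdivlMr.
by move: r; rewrite -natr1 -(ltr_pM2r h0) divfK ?lt0r_neq0 // mulrDl mul1r => /ltW.
Qed.

Lemma truncn_div_le (R : realType) (h a b : R) : 0 < h -> a <= b ->
  (Num.truncn (a / h) <= Num.truncn (b / h))%N.
Proof. by move=> h0 ab; apply: le_truncn; rewrite ler_pM2r // invr_gt0. Qed.

Lemma seminorm_sum_nat (R : realType) (V : lmodType R) (q : V -> R) (m n : nat)
    (f : nat -> V) (c : R) : seminorm q -> (m <= n)%N ->
  (forall j, (m <= j < n)%N -> q (f j) <= c) ->
  q (\sum_(m <= j < n) f j) <= (n%:R - m%:R) * c.
Proof.
move=> sq mn h; apply: le_trans (seminorm_sum _ _ _ sq) _.
rewrite big_nat_cond; apply: (@le_trans _ _ (\sum_(m <= j < n | (m <= j < n)%N && true) c)).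
  by apply: ler_sum => j /andP[jmn _]; exact: h.
by rewrite -big_nat_cond sumr_const_nat -natrB // mulr_natl.
Qed.

(** * Primitives of vector-valued functions by Riemann sums *)

Section Primitives.
Context {R : realType} {V : lmodType R} (Q : gauges V).
Implicit Types (q : V -> R) (u v : R -> V).

Definition uniformly_continuous u := forall q, Q q -> forall S e, 0 < e ->
  exists2 d, 0 < d & forall r s, 0 <= r -> r <= S -> 0 <= s -> s <= S ->
    `|r - s| <= d -> q (u r - u s) <= e.

(** Encodes that [v] has derivative [u] by an expansion at the left endpoint, uniform on bounded
    intervals. This form passes to differences, shifts and continuous linear images, and it
    determines the increments of [v], so that Riemann sums serve for existence only. *)
Definition primitive v u := forall q, Q q -> forall S e, 0 < e ->
  exists2 d, 0 < d & forall a b, 0 <= a -> a <= b -> b <= S -> b - a <= d ->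
    q (v b - v a - (b - a) *: u a) <= e * (b - a).

(** The remainder [q (v z - v x - (z - x) *: y)] satisfies the triangle inequality in [x] and [z],
    so the local expansion of [v] and the bound on [u r - y] add up by [le_of_local]. *)
Lemma primitive_bound v u q a b y c : primitive v u -> Q q -> 0 <= a -> a <= b ->
  (forall r, a <= r -> r <= b -> q (u r - y) <= c) ->
  q (v b - v a - (b - a) *: y) <= c * (b - a).
Proof.
move=> vu Qq a0 ab uy; have sq := gauge_seminorm Qq.
suff h e : 0 < e -> q (v b - v a - (b - a) *: y) <= (e + c) * (b - a).
  apply/ler_addgt0Pl => e e0.
  (* The [+ 1] covers [a = b]; the same device recurs wherever a denominator might vanish. *)
  have ba : 0 < b - a + 1 by lra.
  apply: le_trans (h (e / (b - a + 1)) (divr_gt0 e0 ba)) _.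
  rewrite mulrDl lerD2r mulrAC ler_pdivrMr //; nra.
move=> e0; have [d d0 dP] := vu q Qq b e e0.
pose D x z := q (v z - v x - (z - x) *: y).
have tri x z w : D x w <= D x z + D z w.
  apply: le_trans (sq.1 _ _); apply: ler_of_eq; congr q.
  by module_eq V.
apply: (le_of_local tri d0 _ ab) => r s ar rs sb sr; rewrite /D.
have := dP r s (le_trans a0 ar) rs sb sr.
have -> : v s - v r - (s - r) *: y = (v s - v r - (s - r) *: u r) + (s - r) *: (u r - y).
  by rewrite scalerBr addrA subrK.
move=> h; apply: le_trans (sq.1 _ _) _; rewrite mulrDl lerD // (seminormZ sq) mulrC.
rewrite ger0_norm ?subr_ge0 // ler_wpM2r ?subr_ge0 //.
by apply: uy => //; apply: le_trans rs sb.
Qed.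

Lemma primitiveB v v' u u' : primitive v u -> primitive v' u' ->
  primitive (fun a => v a - v' a) (fun a => u a - u' a).
Proof.
move=> vu vu' q Qq S e e0; have e2 : 0 < e / 2 by lra.
have [d d0 dP] := vu q Qq S _ e2; have [d' d'0 dP'] := vu' q Qq S _ e2.
exists (Num.min d d'); first by rewrite lt_min d0 d'0.
move=> a b a0 ab bS; rewrite le_min => /andP[bd bd'].
have hA := dP a b a0 ab bS bd; have hB := dP' a b a0 ab bS bd'.
have sq := gauge_seminorm Qq.
have -> : v b - v' b - (v a - v' a) - (b - a) *: (u a - u' a) =
  (v b - v a - (b - a) *: u a) - (v' b - v' a - (b - a) *: u' a) by module_eq V.
by apply: le_trans (seminormB sq _ _) _; lra.
Qed.

Lemma primitive_uniq v v' u a b : primitive v u -> primitive v' u ->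
  0 <= a -> a <= b -> v b - v a = v' b - v' a.
Proof.
move=> vu v'u a0 ab; apply/eqP; rewrite -subr_eq0; apply/eqP.
apply: (@gauge_sep _ _ Q) => q Qq.
have := primitive_bound (y := 0) (c := 0) (primitiveB vu v'u) Qq a0 ab.
have sq := gauge_seminorm Qq.
rewrite scaler0 subr0 mul0r => h0; have h : q (v b - v' b - (v a - v' a)) <= 0.
  by apply: h0 => r _ _; rewrite subrr subr0 seminorm0.
 apply/le_anti; rewrite seminorm_ge0 // andbT; apply: le_trans h.
by apply: ler_of_eq; congr q; module_eq V.
Qed.

Lemma primitive_shift v u h : 0 <= h -> primitive v u ->
  primitive (fun a => v (a + h)) (fun a => u (a + h)).
Proof.
move=> h0 vu q Qq S e e0; have [d d0 dP] := vu q Qq (S + h) e e0.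
exists d => // a b a0 ab bS bad.
have ba : b + h - (a + h) = b - a by ring.
by have := dP (a + h) (b + h); rewrite ba; apply => //; lra.
Qed.

Lemma primitive_comp (f : {linear V -> V}) v u :
  (forall q, Q q -> exists2 q', Q q' & forall x, q (f x) <= q' x) ->
  primitive v u -> primitive (f \o v) (f \o u).
Proof.
move=> cf vu q Qq S e e0; have [q' Qq' le] := cf q Qq.
have [d d0 dP] := vu q' Qq' S e e0.
exists d => // a b a0 ab bS bad; apply: le_trans (dP a b a0 ab bS bad).
apply: le_trans (le _); apply: ler_of_eq; congr q => /=.
by rewrite -linearZZ -!linearB.
Qed.

Definition riemann_sum u (h a : R) : V :=
  h *: \sum_(0 <= j < Num.truncn (a / h)) u (j%:R * h).

(** The number of nodes in the interval, times [h], equals [b - a] up to [h]. This rounding error is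
    the summand [h * (e + q (u a))], kept apart because it vanishes with the mesh. *)
Lemma riemann_sum_step u q S e d h a b : Q q ->
  (forall r s, 0 <= r -> r <= S -> 0 <= s -> s <= S ->
    `|r - s| <= d -> q (u r - u s) <= e) ->
  0 < h -> h <= d -> 0 <= a -> a <= b -> b <= S -> b - a <= d -> 0 <= e ->
  q (riemann_sum u h b - riemann_sum u h a - (b - a) *: u a)
    <= e * (b - a) + h * (e + q (u a)).
Proof.
move=> Qq ue h0 hd a0 ab bS bad e0; have sq := gauge_seminorm Qq.
have b0 : 0 <= b by exact: le_trans ab.
have mab := truncn_div_le h0 ab.
have [ma1 ma2] := truncn_divP h0 a0; have [mb1 mb2] := truncn_divP h0 b0.
rewrite /riemann_sum; set ma := Num.truncn (a / h) in mab ma1 ma2 *.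
set mb := Num.truncn (b / h) in mab mb1 mb2 *.
rewrite -scalerBr (big_cat_nat (leq0n ma) mab) //= (addrC (\sum_(_ <= _ < ma) _)) addrK.
set c := mb%:R - ma%:R : R.
have -> : \sum_(ma <= j < mb) u (j%:R * h) =
    \sum_(ma <= j < mb) (u (j%:R * h) - u a) + c *: u a.
  rewrite sumrB sumr_const_nat /c -natrB // scaler_nat subrK //.
rewrite scalerDr scalerA -addrA -scalerBl.
apply: le_trans (sq.1 _ _) _.
have c0 : 0 <= c by rewrite /c subr_ge0 ler_nat.
have hs : q (\sum_(ma <= j < mb) (u (j%:R * h) - u a)) <= c * e.
  apply: seminorm_sum_nat => // j /andP[maj jmb].
  have j1 : ma%:R <= j%:R :> R by rewrite ler_nat.
  have j2 : j%:R + 1 <= mb%:R :> R by rewrite natr1 ler_nat.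
  have ? : ma%:R * h <= j%:R * h by rewrite ler_pM2r.
  have ? : (j%:R + 1) * h <= mb%:R * h by rewrite ler_pM2r.
  apply: ue => //; rewrite ?mulr_ge0 ?ler0n ?(ltW h0) //; try nra.
  by rewrite ler_norml; apply/andP; split; nra.
rewrite !(seminormZ sq) (gtr0_norm h0).
have k1 : h * c <= b - a + h by rewrite /c; nra.
have k2 : `|h * c - (b - a)| <= h by rewrite /c ler_norml; apply/andP; split; nra.
have := ler_wpM2r (seminorm_ge0 sq (u a)) k2.
have := ler_wpM2l (ltW h0) hs; have := ler_wpM2r e0 k1.
by lra.
Qed.

Lemma riemann_sum_le0 u h a : 0 < h -> a <= 0 -> riemann_sum u h a = 0.
Proof.
move=> h0 a0; have ah : a / h <= 0 by rewrite ler_pdivrMr // mul0r.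
have -> : riemann_sum u h a = h *: \sum_(0 <= j < 0) u (j%:R * h).
  by congr (_ *: \sum_(0 <= j < _) _); apply/truncn0Pn; rewrite -ltNge; lra.
by rewrite big_geq // scaler0.
Qed.

Lemma riemann_sum_cauchy u a : uniformly_continuous u ->
  cauchy_for Q (fun n => riemann_sum u n.+1%:R^-1 a).
Proof.
move=> uc q Qq e e0; have sq := gauge_seminorm Qq.
have [a0|a0] := leP a 0.
  exists 0%N => m n _ _; rewrite !riemann_sum_le0 ?invr_gt0 ?ltr0n // subrr.
  by rewrite seminorm0 // ltW.
have a0' := ltW a0.
pose e1 := e / (4 * a).
have e10 : 0 < e1 by rewrite divr_gt0 // mulr_gt0.
have e10' := ltW e10.
have [d d0 dP] := uc q Qq a e1 e10.
pose M := (Num.truncn (a / d)).+1.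
have M0 : 0 < M%:R :> R by rewrite ltr0n.
have aMd : a / M%:R <= d.
  rewrite ler_pdivrMr // mulrC -ler_pdivrMr //; apply/ltW.
  by apply: real_truncnS_gt; exact: num_real.
pose c i : R := i%:R * (a / M%:R).
have cS i : c i.+1 = c i + a / M%:R by rewrite /c -natr1 mulrDl mul1r.
have step0 : 0 <= a / M%:R by rewrite divr_ge0.
have c0 i : 0 <= c i by rewrite /c mulr_ge0.
have cM : c M = a by rewrite /c mulrCA divff ?mulr1 // lt0r_neq0.
have ca i : (i <= M)%N -> c i <= a.
  by move=> iM; rewrite -cM /c ler_wpM2r ?ler_nat.
(* [B] accumulates the rounding errors at the nodes [c j]. The nodes are fixed before the meshes [h]
   and [h'], so [(h + h') * B M] can be made at most [e / 2]; the oscillation of [u] contributes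
   [2 * e1 * a], the other half. *)
pose B i := \sum_(j < i) (e1 + q (u (c j))).
have B0 i : 0 <= B i by apply: sumr_ge0 => j _; rewrite addr_ge0 ?(seminorm_ge0 sq).
have key h h' : 0 < h -> h <= d -> 0 < h' -> h' <= d -> forall i, (i <= M)%N ->
    q (riemann_sum u h (c i) - riemann_sum u h' (c i))
      <= 2 * e1 * c i + (h + h') * B i.
  move=> h0 hd h'0 h'd; elim=> [_|i IH iM].
    rewrite /c mul0r mulr0 !riemann_sum_le0 // subrr seminorm0 //.
    by rewrite add0r mulr_ge0 // addr_ge0 ?ltW.
  have s0 : c i <= c i.+1 by rewrite cS lerDl.
  have s1 : c i.+1 - c i <= d by rewrite cS addrC addKr.
  have step g (g0 : 0 < g) (gd : g <= d) :=
    riemann_sum_step Qq dP g0 gd (c0 i) s0 (ca _ iM) s1 e10'.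
  have := step h h0 hd; have := step h' h'0 h'd; have := IH (ltnW iM).
  rewrite /B big_ord_recr /= -/(B i) => k1 k2 k3.
  set r := riemann_sum u in k1 k2 k3 *.
  have -> : r h (c i.+1) - r h' (c i.+1) = (r h (c i) - r h' (c i)) +
    ((r h (c i.+1) - r h (c i) - (c i.+1 - c i) *: u (c i)) -
     (r h' (c i.+1) - r h' (c i) - (c i.+1 - c i) *: u (c i))) by module_eq V.
  apply: le_trans (seminormD sq _ _) _.
  apply: le_trans (lerD k1 (seminormB sq _ _)) _.
  by apply: le_trans (lerD (lexx _) (lerD k3 k2)) _; lra.
pose g := Num.min d (e / (4 * (B M + 1))).
have BM1 : 0 < B M + 1 by have := B0 M; lra.
have g0 : 0 < g by rewrite lt_min d0 divr_gt0 // mulr_gt0.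
have [N _ NP] := near_infty_natSinv_lt (PosNum g0).
exists N => m n mN nN.
have := key _ _ _ _ _ _ M (leqnn M) => /(_ m.+1%:R^-1 n.+1%:R^-1).
have := NP m mN; have := NP n nN; rewrite /= /g !lt_min => /andP[/ltW n1 /ltW n2] /andP[/ltW m1 /ltW m2].
rewrite !invr_gt0 !ltr0n => /(_ isT m1 isT n1); rewrite cM => /le_trans; apply.
have -> : 2 * e1 * a = e / 2 by rewrite /e1; field; rewrite lt0r_neq0.
have B4 : 0 < 4 * (B M + 1) by lra.
rewrite ler_pdivlMr // in n2; rewrite ler_pdivlMr // in m2.
have := B0 M; have : 0 <= m.+1%:R^-1 :> R by []; have : 0 <= n.+1%:R^-1 :> R by [].
move: n2 m2; move: (n.+1%:R^-1) (m.+1%:R^-1) (B M) => x y z. lra.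
Qed.

(** The estimate of [riemann_sum_step] is uniform in the mesh up to a term that vanishes with it, so
    it survives in the pointwise limit of the sums. *)
Lemma primitive_exists u : uniformly_continuous u ->
  exists2 v, v 0 = 0 & primitive v u.
Proof.
move=> uc.
have /choice[v vP] : forall a, exists x,
    limit_for Q (fun n => riemann_sum u n.+1%:R^-1 a) x.
  by move=> a; apply: gauge_complete; exact: riemann_sum_cauchy.
exists v.
  apply: (limit_for_uniq (vP 0)) => q Qq e e0; near=> n.
  by rewrite riemann_sum_le0 // subrr (seminorm0 (gauge_seminorm Qq)) ltW.
move=> q Qq S e e0; have sq := gauge_seminorm Qq.
have [d d0 dP] := uc q Qq S e e0; exists d => // a b a0 ab bS bad.
apply/ler_addgt0Pl => f f0.
have f4 : 0 < f / 4 by lra.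
have c0 : 0 < f / 2 / (e + q (u a) + 1).
  by have := seminorm_ge0 sq (u a) => ?; apply: divr_gt0; lra.
have [n [/= [va vb] [nd nc]]] := filter_ex (filterI
  (filterI (vP a q Qq _ f4) (vP b q Qq _ f4))
  (filterI (near_infty_natSinv_lt (PosNum d0)) (near_infty_natSinv_lt (PosNum c0)))).
rewrite /= in nd nc.
have h0 : 0 < n.+1%:R^-1 :> R by rewrite invr_gt0 ltr0n.
have := riemann_sum_step Qq dP h0 (ltW nd) a0 ab bS bad (ltW e0).
rewrite ltr_pdivlMr in nc; last by have := seminorm_ge0 sq (u a); lra.
set r := riemann_sum u n.+1%:R^-1 in va vb *.
have -> : v b - v a - (b - a) *: u a = (r b - r a - (b - a) *: u a) +
  ((r a - v a) - (r b - v b)) by module_eq V.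
move=> k; apply: le_trans (seminormD sq _ _) _.
apply: le_trans (lerD k (seminormB sq _ _)) _.
by move: nc va vb h0; move: (n.+1%:R^-1) (q (u a)) => h c; lra.
Unshelve. all: by end_near. Qed.

End Primitives.

(** * Powers of a linear map *)

Section Powers.
Context {R : realType} {V : lmodType R}.

Definition power (f : {linear V -> V}) (j : nat) : V -> V := iter j f.

Lemma power_is_linear f j : linear (power f j).
Proof.
move=> a x y; rewrite /power; elim: j => //= j ->.
by rewrite linearP.
Qed.

HB.instance Definition _ f j :=
  GRing.isLinear.Build R V V *:%R (power f j) (power_is_linear f j).

Lemma power0 f x : power f 0 x = x.
Proof. by []. Qed.

Lemma powerD f i j x : power f (i + j) x = power f i (power f j x).
Proof. exact: iterD. Qed.

Lemma powerSr f j x : power f j.+1 x = power f j (f x).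
Proof. exact: iterSr. Qed.

Lemma power_sub f j x : power f j x - x =
  \sum_(0 <= i < j) power f i (f x - x).
Proof.
transitivity (power f j x - power f 0 x) => //.
rewrite -(telescope_sumr (fun i => power f i x) (leq0n j)).
by apply: eq_bigr => i _; rewrite linearB /= -powerSr.
Qed.

Lemma power_subZ f j x (h : R) : h != 0 -> power f j x - x =
  h *: \sum_(0 <= i < j) power f i (h^-1 *: (f x - x)).
Proof.
move=> h0; rewrite power_sub scaler_sumr; apply: eq_bigr => i _.
by rewrite linearZZ scalerA divff // scale1r.
Qed.

Lemma power_sumB f m n x y : \sum_(m <= i < n) power f i (x - y) =
  \sum_(m <= i < n) power f i x - \sum_(m <= i < n) power f i y.
Proof. by rewrite -sumrB; apply: eq_bigr => i _; rewrite linearB. Qed.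

End Powers.

(** * Powers of an approximating function *)

Section Approximation.
Context {R : realType} {V : lmodType R} (Q : gauges V) (F : R -> {linear V -> V}).
Implicit Types (q : V -> R) (x y : V).

Definition locally_equicontinuous := forall q S, Q q -> exists2 q', Q q' &
  forall h j x, 0 <= h -> j%:R * h <= S -> q (power (F h) j x) <= q' x.

(* [y] is a value at [x] of the closure of the many-valued derivative of [F]
   at 0: the approximants of [x] may depend on the seminorm. *)
Definition approx_derivative x y := forall q, Q q -> forall e, 0 < e ->
  \forall h \near 0^'+, exists x',
    q (x' - x) <= e /\ q (h^-1 *: (F h x' - x') - y) <= e.

Definition densely_differentiable := forall x q e, Q q -> 0 < e ->
  exists x' y', approx_derivative x' y' /\ q (x - x') <= e.

Lemma approx_derivativeB x y x' y' : approx_derivative x y ->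
  approx_derivative x' y' -> approx_derivative (x - x') (y - y').
Proof.
move=> xy xy' q Qq e e0; have e2 : 0 < e / 2 by lra.
have sq := gauge_seminorm Qq.
near=> h.
have [z [z1 z2]] : exists z, q (z - x) <= e / 2 /\
  q (h^-1 *: (F h z - z) - y) <= e / 2 by near: h; exact: xy.
have [z' [z1' z2']] : exists z, q (z - x') <= e / 2 /\
  q (h^-1 *: (F h z - z) - y') <= e / 2 by near: h; exact: xy'.
exists (z - z'); split.
  have -> : z - z' - (x - x') = (z - x) - (z' - x') by module_eq V.
  by apply: le_trans (seminormB sq _ _) _; lra.
rewrite (linearB (F h)).
have -> : h^-1 *: (F h z - F h z' - (z - z')) - (y - y') =
  (h^-1 *: (F h z - z) - y) - (h^-1 *: (F h z' - z') - y') by module_eq V.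
by apply: le_trans (seminormB sq _ _) _; lra.
Unshelve. all: by end_near. Qed.

Context (F_eq : locally_equicontinuous).

(** For an approximant [x'] with its own difference quotient [y'] the telescoping identity is exact.
    By equicontinuity the passage from [x'] to [x] costs [2 * e1], and that from [y'] to [y] costs
    at most [e1] times the total time. *)
Lemma power_approx x y q S e : approx_derivative x y -> Q q -> 0 < e ->
  \forall h \near 0^'+, forall m, m%:R * h <= S ->
    q (power (F h) m x - x - h *: \sum_(0 <= j < m) power (F h) j y) <= e.
Proof.
move=> xy Qq e0; have sq := gauge_seminorm Qq.
have [q' Qq' qq'] := F_eq `|S| Qq; have sq' := gauge_seminorm Qq'.
have S0 := normr_ge0 S.
pose e1 := e / (2 + `|S|).
have e10 : 0 < e1 by rewrite divr_gt0 //; lra.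
near=> h => m mS.
have h0 : 0 < h by near: h; exact: nbhs_right_gt.
have [x' [x1 x2]] : exists x', q' (x' - x) <= e1 /\
  q' (h^-1 *: (F h x' - x') - y) <= e1 by near: h; exact: xy.
set y' := h^-1 *: _ in x2.
have mS' : m%:R * h <= `|S| by apply: le_trans (ler_norm _).
have -> : power (F h) m x - x - h *: \sum_(0 <= j < m) power (F h) j y =
    power (F h) 0 (x' - x) - power (F h) m (x' - x)
    + h *: \sum_(0 <= j < m) power (F h) j (y' - y).
  have := power_subZ (F h) m x' (lt0r_neq0 h0).
  rewrite -/y' power0.
  rewrite power_sumB linearB /= => E.
  have -> : power (F h) m x' = x' + h *: \sum_(0 <= i < m) power (F h) i y'.
    by rewrite -E addrC subrK.
  by module_eq V.
apply: le_trans (seminormD sq _ _) _.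
have k1 : q (power (F h) 0 (x' - x) - power (F h) m (x' - x)) <= 2 * e1.
  apply: le_trans (seminormB sq _ _) _.
  have := qq' h 0%N (x' - x) (ltW h0); rewrite mul0r => /(_ S0).
  have := qq' h m (x' - x) (ltW h0) mS'; lra.
have k2 : q (\sum_(0 <= j < m) power (F h) j (y' - y)) <= (m%:R - 0%:R) * e1.
  apply: seminorm_sum_nat => // j /andP[_ jm].
  apply: (le_trans _ x2); apply: qq'; first exact: ltW.
  apply: (le_trans _ mS'); rewrite ler_pM2r // ler_nat; exact: ltnW.
rewrite (seminormZ sq) (gtr0_norm h0).
have k3 : e1 * (2 + `|S|) = e by rewrite /e1 divfK // lt0r_neq0 //; lra.
have := ler_wpM2l (ltW h0) k2; have := ler_wpM2r (ltW e10) mS'.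
by rewrite subr0; lra.
Unshelve. all: by end_near. Qed.

Context (F_dense : densely_differentiable).

(** Strong continuity at time 0, uniform in the step. By density and equicontinuity [x] may be
    replaced by a point [x'] with a derivative [y'], whose displacement is about [d * q' y'] by
    [power_approx]. The threshold for [h] depends on [d]. *)
Lemma power_small_time x q e : Q q -> 0 < e ->
  \forall d \near 0^'+, \forall h \near 0^'+, forall j, j%:R * h <= d ->
    q (power (F h) j x - x) <= e.
Proof.
move=> Qq e0; have sq := gauge_seminorm Qq.
have [q' Qq' qq'] := F_eq 1 Qq; have sq' := gauge_seminorm Qq'.
have e4 : 0 < e / 4 by lra.
have [x' [y' [xy' xx']]] := F_dense x Qq' e4.
have Y0 := seminorm_ge0 sq' y'.
near=> d.
have d0 : 0 < d by near: d; exact: nbhs_right_gt.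
have d1 : d < 1 by near: d; exact: nbhs_right_lt.
have dy : d < e / 4 / (q' y' + 1).
  by near: d; apply: nbhs_right_lt; rewrite divr_gt0 //; lra.
near=> h => j jd.
have h0 : 0 < h by near: h; exact: nbhs_right_gt.
have k1 : q (power (F h) j x' - x' - h *: \sum_(0 <= i < j) power (F h) i y') <= e / 4.
  by move: (j) jd; near: h; exact: power_approx.
have j1 : j%:R * h <= 1 by lra.
have k2 : q (\sum_(0 <= i < j) power (F h) i y') <= (j%:R - 0%:R) * q' y'.
  apply: seminorm_sum_nat => // i /andP[_ ij]; apply: qq'; first exact: ltW.
  by apply: (le_trans _ j1); rewrite ler_pM2r // ler_nat ltnW.
have k3 : q (power (F h) j (x - x')) <= e / 4.
  by apply: (le_trans _ xx'); apply: qq' => //; exact: ltW.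
have k4 : q (power (F h) 0 (x - x')) <= e / 4.
  by apply: (le_trans _ xx'); apply: qq'; rewrite ?mul0r // ltW.
have -> : power (F h) j x - x =
  (power (F h) j (x - x') - power (F h) 0 (x - x')) +
  ((power (F h) j x' - x' - h *: \sum_(0 <= i < j) power (F h) i y')
   + h *: \sum_(0 <= i < j) power (F h) i y').
  by rewrite power0 linearB /=; module_eq V.
apply: le_trans (seminormD sq _ _) _.
apply: le_trans (lerD (seminormB sq _ _) (seminormD sq _ _)) _.
rewrite (seminormZ sq) (gtr0_norm h0).
have k5 : h * q (\sum_(0 <= i < j) power (F h) i y') <= e / 4.
  apply: le_trans (ler_wpM2l (ltW h0) k2) _.
  rewrite subr0 mulrA (mulrC h).
  apply: le_trans (ler_wpM2r Y0 jd) _.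
  by move: dy; rewrite ltr_pdivlMr; [nra|lra].
lra.
Unshelve. all: by end_near. Qed.

(** For the vector 0, [power_approx] makes [h] times the sum of the powers at [y] small, while for
    total time near [d] this sum is close to [d *: y], since the powers hardly move [y]. The
    tolerance is proportional to [d] because one divides by a total time of at least [d / 2]. *)
Lemma approx_derivative0 y : approx_derivative 0 y -> y = 0.
Proof.
move=> y0; apply: (@gauge_eq0 _ _ Q) => q e Qq e0; have sq := gauge_seminorm Qq.
have e4 : 0 < e / 4 by lra.
near (0 : R)^'+ => d.
have d0 : 0 < d by near: d; exact: nbhs_right_gt.
have dP : \forall h \near 0^'+, forall j, j%:R * h <= d -> q (power (F h) j y - y) <= e / 4.
  by near: d; exact: power_small_time.
have d2 : 0 < d / 2 by lra.
have de : 0 < d * e / 8 by rewrite divr_gt0 // mulr_gt0.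
near (0 : R)^'+ => h.
have h0 : 0 < h by near: h; exact: nbhs_right_gt.
have hd : h < d / 2 by near: h; exact: nbhs_right_lt.
have hP : forall j, j%:R * h <= d -> q (power (F h) j y - y) <= e / 4 by near: h.
have h1 : forall m, m%:R * h <= d ->
    q (power (F h) m 0 - 0 - h *: \sum_(0 <= j < m) power (F h) j y) <= d * e / 8.
  by near: h; exact: power_approx.
have [m1 m2] := truncn_divP h0 (ltW d0).
move: (Num.truncn _) m1 m2 => m m1 m2.
have := h1 m m1; rewrite raddf0 subr0 sub0r (seminormN sq) => k1.
have k2 : q (\sum_(0 <= i < m) (power (F h) i y - y)) <= (m%:R - 0%:R) * (e / 4).
  apply: seminorm_sum_nat => // i /andP[_ im]; apply: hP.
  by apply: (le_trans _ m1); rewrite ler_pM2r // ler_nat ltnW.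
have E : (m%:R * h) *: y = h *: (\sum_(0 <= i < m) power (F h) i y) -
    h *: \sum_(0 <= i < m) (power (F h) i y - y).
  rewrite sumrB sumr_const_nat subn0 -[y *+ m]scaler_nat.
  by module_eq V.
have : m%:R * h * q y <= d * e / 8 + h * (m%:R * (e / 4)).
  have mh : 0 <= m%:R * h by rewrite mulr_ge0 // ltW.
  rewrite -[m%:R * h in leLHS]ger0_norm // -(seminormZ sq) E.
  apply: le_trans (seminormB sq _ _) _; apply: lerD => //.
  by rewrite (seminormZ sq) gtr0_norm // ler_pM2l // -[X in X * _]subr0.
have -> : h * (m%:R * (e / 4)) = (m%:R * h) * (e / 4) by ring.
move: (q y) (m%:R * h) m2 m1 => z M m2 m1.
nra.
Unshelve. all: by end_near. Qed.

End Approximation.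

(** * Convergence of powers to classical solutions *)

Section Chernoff.
Context {R : realType} {V : lmodType R} (Q : gauges V) (F : R -> {linear V -> V}).
Implicit Types (q : V -> R) (x y : V).

Context (F_eq : locally_equicontinuous Q F).
Context (F_dense : densely_differentiable Q F).

Lemma approx_derivative_uniq x y y' :
  approx_derivative Q F x y -> approx_derivative Q F x y' -> y = y'.
Proof.
move=> xy xy'; apply/eqP; rewrite -subr_eq0; apply/eqP.
apply: (approx_derivative0 F_eq F_dense).
by rewrite -(subrr x); exact: approx_derivativeB.
Qed.

(** Uniform continuity of [u] reduces [[0, S]] to the finitely many nodes [i * r], where
    [power_small_time] applies; equicontinuity carries the estimate from the node to [u a]. *)
Lemma power_small_time_uniform (u : R -> V) q S e :
  uniformly_continuous Q u -> Q q -> 0 < e ->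
  \forall d \near 0^'+, \forall h \near 0^'+,
    forall a j, 0 <= a -> a <= S -> j%:R * h <= d ->
      q (power (F h) j (u a) - u a) <= e.
Proof.
move=> uc Qq e0; have sq := gauge_seminorm Qq.
have [q' Qq' qq'] := F_eq 1 Qq; have sq' := gauge_seminorm Qq'.
have e4 : 0 < e / 4 by lra.
have [r r0 rP] := uc q' Qq' S _ e4.
pose M := (Num.truncn (S / r)).+1.
have small (i : 'I_M) : \forall d \near 0^'+, \forall h \near 0^'+,
    forall j, j%:R * h <= d ->
      q (power (F h) j (u (i%:R * r)) - u (i%:R * r)) <= e / 4.
  exact: (power_small_time F_eq F_dense _ Qq e4).
near=> d.
have d1 : d < 1 by near: d; exact: nbhs_right_lt.
have smalld : forall i : 'I_M, \forall h \near 0^'+,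
    forall j, j%:R * h <= d ->
      q (power (F h) j (u (i%:R * r)) - u (i%:R * r)) <= e / 4.
  by near: d; exact: filter_forall small.
near=> h => a j a0 aS jd.
have h0 : 0 < h by near: h; exact: nbhs_right_gt.
have smallh : forall i : 'I_M, forall j, j%:R * h <= d ->
      q (power (F h) j (u (i%:R * r)) - u (i%:R * r)) <= e / 4.
  by near: h; exact: filter_forall smalld.
have [i1 i2] := truncn_divP r0 a0.
have iM : (Num.truncn (a / r) < M)%N by rewrite /M ltnS; exact: truncn_div_le.
move: (smallh (Ordinal iM) j jd) => /=.
move: (Num.truncn _) iM i1 i2 => i iM i1 i2 k1.
have k2 : q' (u a - u (i%:R * r)) <= e / 4.
  apply: rP => //; [by rewrite mulr_ge0 // ltW|exact: le_trans aS|].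
  by rewrite ger0_norm; lra.
have j1 : j%:R * h <= 1 by lra.
have k3 := qq' h j (u a - u (i%:R * r)) (ltW h0) j1.
have k4 : q (power (F h) 0 (u a - u (i%:R * r))) <= q' (u a - u (i%:R * r)).
  by apply: qq'; rewrite ?mul0r // ltW.
have -> : power (F h) j (u a) - u a =
   (power (F h) j (u a - u (i%:R * r)) - power (F h) 0 (u a - u (i%:R * r)))
   + (power (F h) j (u (i%:R * r)) - u (i%:R * r)).
  by rewrite power0 linearB /=; module_eq V.
apply: le_trans (seminormD sq _ _) _.
by have := seminormB sq (power (F h) j (u a - u (i%:R * r))) (power (F h) 0 (u a - u (i%:R * r))); lra.
Unshelve. all: by end_near. Qed.

(** Two scales are used: [N] coarse steps of length [s], fixed by the regularity of [w], and the
    step [h], sent to 0 afterwards. On each coarse step consistency compares [w] with powers of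
    [F h]; stability lets the [N] defects add up. *)
Theorem chernoff_solution (w y : R -> V) q S e :
  (forall r, 0 <= r -> approx_derivative Q F (w r) (y r)) ->
  primitive Q w y -> uniformly_continuous Q y ->
  Q q -> 0 <= S -> 0 < e ->
  \forall h \near 0^'+, q (power (F h) (Num.truncn (S / h)) (w 0) - w S) <= e.
Proof.
move=> wy wp yc Qq S0 e0.
have [q1 Qq1 qq1] := F_eq S Qq; have sq1 := gauge_seminorm Qq1.
have sq := gauge_seminorm Qq.
(* The total error is [2 * e1 * S] from the coarse expansions, [e1] from the [N] defects [e2], and
   at most [e1] from the terms of order [h]. *)
pose e1 := e / (2 * (S + 1)).
have e1E : e1 * (2 * (S + 1)) = e by rewrite /e1 divfK // lt0r_neq0 //; lra.
have e10 : 0 < e1 by rewrite divr_gt0 //; lra.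
have [d1 d10 d1P] := wp q1 Qq1 S e1 e10.
near (0 : R)^'+ => D.
have D0 : 0 < D by near: D; exact: nbhs_right_gt.
have DP : \forall h \near 0^'+, forall a j, 0 <= a -> a <= S -> j%:R * h <= D ->
      q1 (power (F h) j (y a) - y a) <= e1.
  by near: D; exact: (power_small_time_uniform S yc Qq1 e10).
(* Half of [D], because after rounding a coarse step holds powers of total time up to [s + h]. *)
pose d := Num.min d1 (D / 2).
have d0 : 0 < d by rewrite lt_min d10 divr_gt0.
pose N := (Num.truncn (S / d)).+1.
have N0 : 0 < N%:R :> R by rewrite ltr0n.
pose s := S / N%:R.
have sd : s <= d.
  rewrite ler_pdivrMr // mulrC -ler_pdivrMr //; apply/ltW.
  by apply: real_truncnS_gt; exact: num_real.
have [sd1 sD] : s <= d1 /\ s <= D / 2.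
  by move: sd; rewrite /d le_min => /andP.
have s0 : 0 <= s by rewrite divr_ge0.
have sN : N%:R * s = S by rewrite /s mulrCA divff ?mulr1 // lt0r_neq0.
pose c i : R := i%:R * s.
have c0 i : 0 <= c i by rewrite mulr_ge0.
have cS i : c i.+1 - c i = s by rewrite /c -natr1; ring.
have cle i : (i <= N)%N -> c i <= S by move=> iN; rewrite -sN ler_wpM2r ?ler_nat.
pose e2 := e1 / N%:R.
have e20 : 0 < e2 by rewrite divr_gt0.
have appr (i : 'I_N) : \forall h \near 0^'+, forall m, m%:R * h <= D ->
    q1 (power (F h) m (w (c i)) - w (c i)
        - h *: \sum_(0 <= j < m) power (F h) j (y (c i))) <= e2.
  exact: (power_approx F_eq D (wy _ (c0 i)) Qq1 e20).
pose B i := \sum_(j < i) (q1 (y (c j)) + e1).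
have B0 i : 0 <= B i.
  by apply: sumr_ge0 => j _; rewrite addr_ge0 ?(seminorm_ge0 sq1) ?(ltW e10).
near=> h.
have h0 : 0 < h by near: h; exact: nbhs_right_gt.
have hD : h < D / 2 by near: h; apply: nbhs_right_lt; rewrite divr_gt0.
have hB : h < e1 / (B N + 1).
  by near: h; apply: nbhs_right_lt; rewrite divr_gt0 //; have := B0 N; lra.
have yP : forall a j, 0 <= a -> a <= S -> j%:R * h <= D ->
      q1 (power (F h) j (y a) - y a) <= e1 by near: h.
have apprh : forall (i : 'I_N) m, m%:R * h <= D ->
    q1 (power (F h) m (w (c i)) - w (c i)
        - h *: \sum_(0 <= j < m) power (F h) j (y (c i))) <= e2.
  by near: h; exact: filter_forall.
pose m i := Num.truncn (c i / h).
have mm i k : (i <= k)%N -> (m i <= m k)%N.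
  by move=> ik; apply: truncn_div_le => //; rewrite /c ler_wpM2r ?ler_nat.
pose E i := w (c i) - power (F h) (m i) (w 0).
pose rho i := w (c i.+1) - power (F h) (m i.+1 - m i) (w (c i)).
have rhoP (i : nat) : (i < N)%N ->
    q1 (rho i) <= 2 * e1 * s + e2 + h * (q1 (y (c i)) + e1).
  move=> iN.
  have [ma1 ma2] := truncn_divP h0 (c0 i).
  have [mb1 mb2] := truncn_divP h0 (c0 i.+1).
  rewrite -/(m i) in ma1 ma2; rewrite -/(m i.+1) in mb1 mb2.
  have lE : (m i.+1 - m i)%:R = (m i.+1)%:R - (m i)%:R :> R by rewrite natrB // mm.
  have cSi := cS i.
  have l1 : (m i.+1 - m i)%:R * h <= s + h.
    by rewrite lE; clear -ma1 mb2 cSi mb1 ma2; lra.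
  have l2 : `|s - (m i.+1 - m i)%:R * h| <= h.
    by rewrite lE ler_norml; clear -ma1 ma2 mb1 mb2 cSi; apply/andP; split; lra.
  rewrite /rho; move: (m i.+1 - m i)%N l1 l2 => l l1 l2.
  have lD : l%:R * h <= D by clear -l1 sD hD; lra.
  have k1 := d1P (c i) (c i.+1) (c0 i); rewrite cS in k1.
  have k2 := apprh (Ordinal iN) l lD; rewrite /= in k2.
  have {}k1 := k1 _ (cle _ iN) sd1.
  have k3 : q1 (\sum_(0 <= j < l) (power (F h) j (y (c i)) - y (c i)))
      <= (l%:R - 0%:R) * e1.
    apply: seminorm_sum_nat => // j /andP[_ jl].
    apply: yP => //; first exact/cle/ltnW.
    by apply: (le_trans _ lD); rewrite ler_pM2r // ler_nat ltnW.
  have -> : w (c i.+1) - power (F h) l (w (c i)) =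
    (w (c i.+1) - w (c i) - s *: y (c i)) -
    (power (F h) l (w (c i)) - w (c i) - h *: \sum_(0 <= j < l) power (F h) j (y (c i)))
    + ((s - l%:R * h) *: y (c i) -
       h *: \sum_(0 <= j < l) (power (F h) j (y (c i)) - y (c i))).
    rewrite sumrB sumr_const_nat subn0 -[y _ *+ l]scaler_nat; module_eq V.
  apply: le_trans (seminormD sq1 _ _) _.
  apply: le_trans (lerD (seminormB sq1 _ _) (seminormB sq1 _ _)) _.
  rewrite !(seminormZ sq1) (gtr0_norm h0).
  have k4 := ler_wpM2r (seminorm_ge0 sq1 (y (c i))) l2.
  have k5 : h * q1 (\sum_(0 <= j < l) (power (F h) j (y (c i)) - y (c i))) <= (s + h) * e1.
    apply: le_trans (ler_wpM2l (ltW h0) k3) _.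
    by rewrite subr0 mulrA (mulrC h) ler_wpM2r // ltW.
  have {}k1 := k1 _; rewrite -subr_ge0 cS in k1; have {}k1 := k1 s0.
  by clear -k1 k2 k4 k5; lra.
(* The remaining powers are applied before estimating: [E i.+1] is the image of [E i] under the next
   powers plus [rho i]. Thus each defect passes once from [q] to [q1], instead of the seminorm
   growing with every coarse step. *)
have main : forall i, (i <= N)%N -> q (power (F h) (m N - m i) (E i)) <=
    2 * e1 * c i + i%:R * e2 + h * B i.
  elim=> [_|i IH iN].
    have -> : E 0%N = 0.
      by rewrite /E /m /c mul0r mul0r truncn0 power0 subrr.
    by rewrite linear0 seminorm0 // /c !mul0r /B big_ord0; clear; lra.
  have -> : power (F h) (m N - m i.+1) (E i.+1) =
     power (F h) (m N - m i) (E i) + power (F h) (m N - m i.+1) (rho i).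
    have -> : (m N - m i = (m N - m i.+1) + (m i.+1 - m i))%N.
      by rewrite addnBA ?mm // subnK // mm.
    rewrite powerD -linearD; congr power.
    rewrite /E /rho linearB /= -powerD subnK ?mm //; module_eq V.
  apply: le_trans (seminormD sq _ _) _.
  have := IH (ltnW iN); have := rhoP i iN.
  have : q (power (F h) (m N - m i.+1) (rho i)) <= q1 (rho i).
    apply: qq1; first exact: ltW.
    have [k1 _] := truncn_divP h0 (c0 N).
    apply: le_trans (le_trans k1 (cle N (leqnn N))).
    by rewrite ler_pM2r // ler_nat leq_subr.
  rewrite /B big_ord_recr /= -/(B i).
  have -> : c i.+1 = c i + s by rewrite -(cS i); ring.
  by rewrite -natr1 => a1 a2 a3; clear -a1 a2 a3; lra.
have := main N (leqnn N); rewrite subnn power0 /E /m.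
have -> : c N = S by exact: sN.
rewrite (seminormC sq) => /le_trans; apply.
have -> : N%:R * e2 = e1 by rewrite /e2 mulrC divfK // lt0r_neq0.
move: hB; rewrite ltr_pdivlMr; last by have := B0 N; clear; lra.
move: (B N) (B0 N) => b b0 hb; clear -b0 hb h0 e10 e1E; nra.
Unshelve. all: by end_near. Qed.

End Chernoff.

(** * Functionals and weak limits *)

Section HahnBanach.
Context {R : realType} {V : lmodType R}.
Implicit Types (p m : V -> R) (x y e : V).

Definition sublinear p : Prop := (forall x y, p (x + y) <= p x + p y) /\
  (forall a x, 0 <= a -> p (a *: x) = a * p x).

Lemma sublinear_gt0 p : (forall x y, p (x + y) <= p x + p y) ->
  (forall a x, 0 < a -> p (a *: x) <= a * p x) -> sublinear p.
Proof.
move=> pD pZ; split=> // a x; rewrite le_eqVlt => /orP[/eqP<-|a0].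
  rewrite scale0r mul0r; have := pD 0 0; rewrite addr0.
  have := pZ 2^-1 0; rewrite scaler0 invr_gt0 ltr0n => /(_ isT); lra.
apply/le_anti; rewrite pZ //=; have := pZ a^-1 (a *: x).
by rewrite invr_gt0 scalerA mulVf ?lt0r_neq0 // scale1r ler_pdivlMl //; apply.
Qed.

Lemma sublinear0 p : sublinear p -> p 0 = 0.
Proof. by move=> [_ pZ]; rewrite -(scale0r 0) pZ // mul0r. Qed.

Lemma sublinear_opp p x : sublinear p -> - p (- x) <= p x.
Proof.
by move=> sp; have := sp.1 x (- x); rewrite subrr sublinear0 //; lra.
Qed.

(** Serves for chains in Zorn's lemma, for the shift by a vector and for the distance to a linear
    relation. *)
Lemma sublinear_inf p (I : Type) (A : set I) (f : I -> V -> R) : A !=set0 ->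
  (forall i x, A i -> - p (- x) <= f i x) ->
  (forall i j x y, A i -> A j -> exists2 k, A k & f k (x + y) <= f i x + f j y) ->
  (forall i x a, 0 < a -> A i -> exists2 k, A k & f k (a *: x) <= a * f i x) ->
  sublinear (fun x => inf [set f i x | i in A]) /\
  (forall i x, A i -> inf [set f j x | j in A] <= f i x).
Proof.
move=> [i0 Ai0] lb fD fZ; pose m x := inf [set f i x | i in A].
have mle i x : A i -> m x <= f i x.
  move=> Ai; apply: ge_inf; last by exists i.
  by exists (- p (- x)) => _ [j Aj <-]; exact: lb.
have lem x c : (forall i, A i -> c <= f i x) -> c <= m x.
  by move=> h; apply: lb_le_inf; [exists (f i0 x), i0|move=> _ [i Ai <-]; exact: h].
split=> //; apply: sublinear_gt0 => [x y|a x a0].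
  change (m (x + y) <= m x + m y).
  suff: m (x + y) - m y <= m x by lra.
  apply: (lem x) => i Ai; suff: m (x + y) - f i x <= m y by lra.
  apply: (lem y) => j Aj; have [k Ak kle] := fD i j x y Ai Aj.
  by have := mle k (x + y) Ak; lra.
change (m (a *: x) <= a * m x); rewrite -ler_pdivrMl //; apply: (lem x) => i Ai.
rewrite ler_pdivrMl //; have [k Ak kle] := fZ i x a a0 Ai.
exact: le_trans (mle k _ Ak) kle.
Qed.

Lemma sublinear_minimal p : sublinear p -> exists m, [/\ sublinear m,
  forall x, m x <= p x &
  forall m', sublinear m' -> (forall x, m' x <= m x) -> m' = m].
Proof.
move=> sp; pose T := {m | sublinear m /\ forall x, m x <= p x}.
(* The order is reversed, so that a maximal element in Zorn's lemma is a minimal sublinear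
   functional. *)
pose below (s t : T) := `[< forall x, sval t x <= sval s x >].
have [||||t tmin] := @Zorn T below.
- by move=> t; apply/asboolP.
- move=> r s t /asboolP rs /asboolP st; apply/asboolP => x.
  exact: le_trans (st x) (rs x).
- move=> [s sP] [t tP] /asboolP /= st /asboolP /= ts.
  have E : s = t by apply/funext => x; apply/le_anti; rewrite st ts.
  by subst t; congr exist; exact: Prop_irrelevance.
- move=> A tot; have [[t0 At0]|A0] := pselect (A !=set0); last first.
    exists (exist _ p (conj sp (fun x => lexx (p x)))) => s As.
    by exfalso; apply: A0; exists s.
  have [||||m_sub m_le] := @sublinear_inf p T A (fun t => sval t).
  + by exists t0.
  + move=> t x _; have [st tp] := svalP t.
    by apply: le_trans (sublinear_opp _ st); rewrite lerN2.
  + move=> s t x y As At; have [/asboolP st|/asboolP ts] := tot s t As At.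
    * exists t => //; apply: le_trans ((svalP t).1.1 x y) _.
      by rewrite lerD2r.
    * exists s => //; apply: le_trans ((svalP s).1.1 x y) _.
      by rewrite lerD2l.
  + by move=> t x a a0 At; exists t => //; rewrite (svalP t).1.2 // ltW.
  have mp x : inf [set sval t x | t in A] <= p x.
    by apply: le_trans (m_le t0 x At0) ((svalP t0).2 x).
  exists (exist (fun m => sublinear m /\ forall x, m x <= p x) _ (conj m_sub mp)) => s As; apply/asboolP => x /=.
  exact: m_le.
- exists (sval t); split; [exact: (svalP t).1|exact: (svalP t).2|].
  move=> m' sm' m't.
  have m'p x : m' x <= p x by apply: le_trans (m't x) ((svalP t).2 x).
  have /(congr1 sval) := tmin (exist (fun m => sublinear m /\ forall x, m x <= p x) m' (conj sm' m'p)) (asboolT m't).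
  by [].
Qed.

(** The infimum of [p (x + t *: e) - t * p e] over [t >= 0]. The second bound yields additivity when
    [p] is minimal, and at [x = - e] it forces a linear minorant to take the value [p e] at [e]. *)
Lemma sublinear_shift p e : sublinear p -> exists m, [/\ sublinear m,
  forall x, m x <= p x & forall x, m x <= p (x + e) - p e].
Proof.
move=> sp; pose f (t : R) x := p (x + t *: e) - t * p e.
have [||||m_sub m_le] := @sublinear_inf p R [set t | 0 <= t] f.
- by exists 0 => /=.
- move=> t x /= t0; rewrite /f -sp.2 //.
  have := sp.1 (x + t *: e) (- x); rewrite addrC addKr; lra.
- move=> s t x y /= s0 t0; exists (s + t); first exact: addr_ge0.
  have := sp.1 (x + s *: e) (y + t *: e).
  by rewrite /f addrACA -scalerDl; lra.
- move=> t x a a0 /= t0; exists (a * t); first by rewrite mulr_ge0 // ltW.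
  by rewrite /f -scalerA -scalerDr (sp.2 _ _ (ltW a0)) mulrBr mulrA.
exists (fun x => inf [set f t x | t in [set t | 0 <= t]]); split=> // x.
  by have := m_le 0 x (lexx 0); rewrite {2}/f scale0r addr0 mul0r subr0.
by have := m_le 1 x ler01; rewrite {2}/f scale1r mul1r.
Qed.

Lemma linear_scalar (f : V -> R^o) : linear f ->
  exists rho : {scalar V}, forall x, rho x = f x.
Proof.
by move=> fl; exists (HB.pack_for {scalar V} f (GRing.isLinear.Build R V R^o *%R f fl)).
Qed.

Lemma minimal_sublinear_linear m : sublinear m ->
  (forall m', sublinear m' -> (forall x, m' x <= m x) -> m' = m) ->
  exists rho : {scalar V}, forall x, rho x = m x.
Proof.
move=> sm min.
have mD x y : m (x + y) = m x + m y.
  apply/le_anti; rewrite sm.1 /=.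
  have [m' [sm' m'm m'y]] := sublinear_shift y sm.
  by have := m'y x; rewrite (min m' sm' m'm); lra.
have mN x : m (- x) = - m x.
  by apply/eqP; rewrite -addr_eq0 -mD addNr sublinear0.
have ml : linear (m : V -> R^o).
  move=> a x y; rewrite mD; congr (_ + _).
  have [a0|a0] := leP 0 a; first by rewrite sm.2.
  have := sm.2 (- a) x; rewrite scaleNr mN mulNr => h.
  by apply: oppr_inj; apply: h; rewrite oppr_ge0 ltW.
exact: linear_scalar ml.
Qed.

(** Nothing is extended from a subspace: a minimal sublinear functional is linear, and the
    preliminary shift makes it touch [p] at [e]. *)
Theorem hahn_banach p e : sublinear p ->
  exists2 rho : {scalar V}, rho e = p e & forall x, rho x <= p x.
Proof.
move=> sp; have [p1 [sp1 p1p p1e]] := sublinear_shift e sp.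
have [m [sm mp min]] := sublinear_minimal sp1.
have [rho rhom] := minimal_sublinear_linear sm min.
have rhop x : rho x <= p x by rewrite rhom; exact: le_trans (mp x) (p1p x).
exists rho => //; apply/le_anti; rewrite rhop /=.
have := le_trans (mp (- e)) (p1e (- e)).
by rewrite -rhom raddfN addNr sublinear0 //; lra.
Qed.

End HahnBanach.

(** * Separation, weak closedness and uniform boundedness *)

Section WeakTopology.
Context {R : realType} {V : lmodType R} (Q : gauges V).
Implicit Types (q : V -> R) (x y : V) (rho : {scalar V}).

Definition bounded_functional rho := Q (fun x => `|rho x : R|).

Lemma seminorm_functional (rho : {scalar V}) : seminorm (fun x => `|rho x : R|).
Proof.
by split=> [x y|a x]; [rewrite linearD; exact: ler_normD|rewrite linearZ /= normrM].
Qed.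

Lemma bounded_functional_le rho q : Q q -> (forall x, rho x <= q x) ->
  bounded_functional rho.
Proof.
move=> Qq le; apply: (gauge_le (c := 1) (seminorm_functional rho) Qq) => x.
have sq := gauge_seminorm Qq.
rewrite mul1r ler_norml le andbT.
by have := le (- x); rewrite raddfN (seminormN sq); lra.
Qed.

Definition weak_limit (u : nat -> V) x := forall rho, bounded_functional rho ->
  forall e, 0 < e -> \forall n \near \oo, `|rho (u n - x) : R| <= e.

Definition closed_relation (M : V -> V -> Prop) := forall x y,
  (forall q e, Q q -> 0 < e -> exists x' y',
     [/\ M x' y', q (x - x') <= e & q (y - y') <= e]) -> M x y.

Definition linear_relation (M : V -> V -> Prop) := M 0 0 /\
  forall (a : R) x y x' y', M x y -> M x' y' -> M (a *: x + x') (a *: y + y').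

(** Closedness gives a seminorm on the product for which [(x0, y0)] has positive distance to [M].
    That distance is sublinear, and a linear functional below it is nonpositive on the subspace [M],
    hence zero there; its two components are [rho1] and [rho2]. *)
Lemma separate_relation M x0 y0 : linear_relation M -> closed_relation M ->
  ~ M x0 y0 -> exists rho1 rho2, [/\ bounded_functional rho1,
    bounded_functional rho2, forall x y, M x y -> rho1 x + rho2 y = 0 :> R &
    rho1 x0 + rho2 y0 != 0 :> R].
Proof.
move=> [M0 ML] clM nM.
have [q [e [Qq e0 qe]]] : exists q e, [/\ Q q, 0 < e &
    forall x y, M x y -> e <= q (x0 - x) + q (y0 - y)].
  apply: contrapT => h; apply/nM/clM => q e Qq e0; apply: contrapT => h'.
  apply: h; exists q, e; split=> // x y Mxy; have sq := gauge_seminorm Qq.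
  rewrite leNgt; apply/negP => lt; apply: h'; exists x, y; split=> //.
    by have := seminorm_ge0 sq (y0 - y); lra.
  by have := seminorm_ge0 sq (x0 - x); lra.
have sq := gauge_seminorm Qq.
pose q2 (z : V * V) := q z.1 + q z.2.
pose A := [set m : V * V | M m.1 m.2].
pose f (m z : V * V) := q2 (z - m).
have q20 z : 0 <= q2 z by rewrite addr_ge0 ?(seminorm_ge0 sq).
have q2D z z' : q2 (z + z') <= q2 z + q2 z'.
  by have := seminormD sq z.1 z'.1; have := seminormD sq z.2 z'.2; rewrite /q2 /=; lra.
have [||||ps ple] := @sublinear_inf R (V * V)%type q2 _ A f.
- by exists 0.
- by move=> i x _; rewrite (le_trans _ (q20 _)) // oppr_le0.
- move=> i j x y Ai Aj; exists (i + j).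
    by have := ML 1 _ _ _ _ Ai Aj; rewrite !scale1r.
  by rewrite /f opprD addrACA.
- move=> i x a a0 Ai; exists (a *: i).
    by have := ML a _ _ _ _ Ai M0; rewrite !addr0.
  by rewrite /f -scalerBr /q2 /= !(seminormZ sq) gtr0_norm // mulrDr.
have [rho rhoe rhole] := hahn_banach (x0, y0) ps.
have pe : e <= rho (x0, y0).
  rewrite rhoe; apply: lb_le_inf; first by exists (f 0 (x0, y0)), 0.
  by move=> _ [m Am <-]; exact: qe.
have rq z : rho z <= q2 z.
  by apply: le_trans (rhole z) _; apply: le_trans (ple 0 z M0) _; rewrite /f subr0.
have r1l : linear (fun x => rho (x, 0) : R^o).
  move=> a x y; rewrite -linearP; congr (rho _).
  by apply: injective_projections; rewrite /= ?scaler0 ?addr0.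
have r2l : linear (fun y => rho (0, y) : R^o).
  move=> a x y; rewrite -linearP; congr (rho _).
  by apply: injective_projections; rewrite /= ?scaler0 ?addr0.
have [r1 r1E] := linear_scalar r1l; have [r2 r2E] := linear_scalar r2l.
have r12 x y : r1 x + r2 y = rho (x, y).
  rewrite r1E r2E -raddfD; congr (rho _).
  by apply: injective_projections; rewrite /= ?addr0 ?add0r.
exists r1, r2; split.
- apply: (bounded_functional_le Qq) => x; rewrite r1E; apply: le_trans (rq (x, 0)) _.
  by rewrite /q2 /= (seminorm0 sq) addr0.
- apply: (bounded_functional_le Qq) => y; rewrite r2E; apply: le_trans (rq (0, y)) _.
  by rewrite /q2 /= (seminorm0 sq) add0r.
- have neg x y : M x y -> rho (x, y) <= 0.
    move=> Mxy; apply: le_trans (rhole _) _; apply: le_trans (ple (x, y) (x, y) Mxy) _.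
    by rewrite /f subrr /q2 /= (seminorm0 sq) addr0.
  move=> x y Mxy; rewrite r12; apply/le_anti; rewrite neg //=.
  have := neg _ _ (ML (-1) _ _ _ _ Mxy M0); rewrite !addr0 !scaleN1r.
  by rewrite -[(- x, - y)]/(- (x, y)) raddfN oppr_le0.
- by rewrite r12; apply: lt0r_neq0; exact: lt_le_trans pe.
Qed.

(** Mazur's theorem for a graph: a closed subspace is weakly closed, since a separating pair of
    functionals would vanish along the sequence but not at the limit. *)
Lemma weak_limit_relation M u v x y : linear_relation M -> closed_relation M ->
  (\forall n \near \oo, M (u n) (v n)) -> weak_limit u x -> weak_limit v y -> M x y.
Proof.
move=> lM cM Muv ux vy; apply: contrapT => nM.
have [r1 [r2 [b1 b2 rM]]] := separate_relation lM cM nM; apply/negP; rewrite negbK.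
rewrite -normr_eq0; apply/eqP/le_anti; rewrite normr_ge0 andbT.
apply/ler_addgt0Pl => e e0; rewrite addr0; have e2 : 0 < e / 2 by lra.
near \oo => n.
have Mn : M (u n) (v n) by near: n.
have k1 : `|r1 (u n - x) : R| <= e / 2 by near: n; exact: ux.
have k2 : `|r2 (v n - y) : R| <= e / 2 by near: n; exact: vy.
have -> : r1 x + r2 y = - (r1 (u n - x) + r2 (v n - y)) :> R.
  by rewrite !raddfB /= addrACA -opprD (rM _ _ Mn) add0r opprK.
by rewrite normrN; apply: le_trans (ler_normD _ _) _; lra.
Unshelve. all: by end_near. Qed.

Lemma norming_functional q x : Q q -> exists rho, [/\ bounded_functional rho,
  rho x = q x :> R & forall y, `|rho y : R| <= q y].
Proof.
move=> Qq; have sq := gauge_seminorm Qq.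
have [|rho rx rle] := @hahn_banach R V q x.
  by split=> [|a y a0]; [exact: seminormD|rewrite (seminormZ sq) ger0_norm].
exists rho; split=> //; first exact: bounded_functional_le rle.
move=> y; rewrite ler_norml rle andbT.
by have := rle (- y); rewrite raddfN (seminormN sq); lra.
Qed.

(** Seminorms are weakly lower semicontinuous: it suffices to test with a functional that norms the
    limit. *)
Lemma weak_limit_le q c u x : Q q -> weak_limit u x ->
  (\forall n \near \oo, q (u n) <= c) -> q x <= c.
Proof.
move=> Qq ux uc; have [rho [rb rx rq]] := norming_functional x Qq.
apply/ler_addgt0Pl => e e0; near \oo => n.
have k1 : q (u n) <= c by near: n.
have : `|rho (u n - x) : R| <= e by near: n; exact: ux.
rewrite ler_norml raddfB /= rx => /andP[k2 _].
by have := rq (u n); rewrite ler_norml => /andP[_]; lra.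
Unshelve. all: by end_near. Qed.

Definition gauge_bounded (A : set V) :=
  forall q, Q q -> exists c, forall x, A x -> q x <= c.

(* Gliding hump in the form of A. Sokal: as [max |psi(x + r y)|, |psi(x - r y)|]
   is at least [r |psi y|], one can add [+- 3^-j y_j] at each step so that the
   sum of the series is a point of unboundedness. *)
Lemma uniformly_bounded_functionals (psi : nat -> {scalar V}) (A : set V) :
  (forall k, bounded_functional (psi k)) ->
  (forall x, exists c, forall k, `|psi k x : R| <= c) -> gauge_bounded A ->
  exists c, forall k x, A x -> `|psi k x : R| <= c.
Proof.
move=> pb pw bA; apply: contrapT => unb.
have big c : exists k, exists2 x, A x & c < `|psi k x : R|.
  apply: contrapT => h; apply: unb; exists c => k x Ax; rewrite leNgt.
  by apply/negP => lt; apply: h; exists k, x.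
(* The factor 4/3 says that [y_j] almost attains the supremum on [A]; it bounds all corrections
   after step [j] by 2/3 of the gain [3 ^- j * N j], so a third of it survives in the limit. As
   [N j] exceeds [12 ^+ j], this third is at least [4 ^+ j / 3], which is unbounded. *)
have /choice[k kP] : forall j : nat, exists ky : nat * V, A ky.2 /\
    12 ^+ j < `|psi ky.1 ky.2 : R| /\
    forall x, A x -> `|psi ky.1 x : R| <= 4 / 3 * `|psi ky.1 ky.2 : R|.
  move=> j; have [k [x Ax kx]] := big (4 / 3 * 12 ^+ j).
  pose B := [set `|psi k x : R| | x in A].
  have [c cP] := bA _ (pb k).
  have supB : has_sup B.
    by split; [exists `|psi k x : R|, x|exists c => _ [y Ay <-]; exact: cP].
  have Bsup y : A y -> `|psi k y : R| <= sup B by move=> Ay; apply: sup_upper_bound => //; exists y.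
  have p0 : 0 < 12 ^+ j :> R by rewrite exprn_gt0.
  have s0 : 0 < sup B by have := Bsup x Ax; lra.
  have s4 : 0 < sup B / 4 by lra.
  have [_ [y Ay <-] yB] := sup_adherent s4 supB.
  exists (k, y) => /=; split=> //; split; first by have := Bsup x Ax; lra.
  by move=> z Az; apply: le_trans (Bsup z Az) _; lra.
pose K j := (k j).1; pose y j := (k j).2.
pose N j : R := `|psi (K j) (y j) : R|.
have r0 j : 0 < 3 ^- j :> R by rewrite invr_gt0 exprn_gt0.
have rS j : 3 ^- j.+1 = 3 ^- j / 3 :> R by rewrite exprS invfM mulrC.
have [x [x0 xS]] : exists x : nat -> V, x 0%N = 0 /\ forall j,
    (x j.+1 = x j + 3 ^- j *: y j \/ x j.+1 = x j - 3 ^- j *: y j) /\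
    3 ^- j * N j <= `|psi (K j) (x j.+1) : R|.
  pose next j z := if 3 ^- j * N j <= `|psi (K j) (z + 3 ^- j *: y j) : R|
    then z + 3 ^- j *: y j else z - 3 ^- j *: y j.
  pose x := fix x j := if j is j'.+1 then next j' (x j') else 0.
  exists x; split=> // j; rewrite [x j.+1]/(next j (x j)) /next.
  case: ifPn => [le|]; first by split=> //; left.
  rewrite -ltNge => lt; split; first by right.
  have E : 3 ^- j * N j = `|psi (K j) (3 ^- j *: y j) : R|.
    by rewrite linearZ /= normrM gtr0_norm.
  have := ler_normD (psi (K j) (x j + 3 ^- j *: y j) : R) (- psi (K j) (x j - 3 ^- j *: y j)).
  rewrite normrN -raddfB /=.
  have -> : x j + 3 ^- j *: y j - (x j - 3 ^- j *: y j) = 2 *: (3 ^- j *: y j) by module_eq V.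
  rewrite linearZ /= normrM -E ger0_norm //; lra.
have tail q c : seminorm q -> (forall j, q (y j) <= c) -> forall m n, (m <= n)%N ->
    q (x n - x m) <= c * (3 / 2 * (3 ^- m - 3 ^- n)).
  move=> sq yc m; elim=> [|n IH].
    by rewrite leqn0 => /eqP->; rewrite !subrr seminorm0 // mulr0 mulr0.
  rewrite leq_eqVlt => /orP[/eqP->|]; first by rewrite !subrr seminorm0 // !mulr0.
  rewrite ltnS => /IH h; apply: le_trans (seminorm_dist sq (x n) _ _) _.
  have : q (x n.+1 - x n) <= 3 ^- n * c.
    have [[->|->] _] := xS n.
      by rewrite addrC addKr (seminormZ sq) gtr0_norm // ler_pM2l.
    by rewrite addrC addKr (seminormN sq) (seminormZ sq) gtr0_norm // ler_pM2l.
  by rewrite rS; lra.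
have Ay j : A (y j) by case: (kP j).
have [z zP] : exists z, limit_for Q x z.
  apply: gauge_complete => q Qq e e0; have sq := gauge_seminorm Qq.
  have [c cP] := bA q Qq.
  have qy j : q (y j) <= `|c| by apply: le_trans (ler_norm c); exact: cP.
  have ce : 0 < e / (3 * `|c| + 1) by rewrite divr_gt0 //; have := normr_ge0 c; lra.
  have : (3 : R) ^- n @[n --> \oo] --> 0.
    under eq_fun do rewrite -exprVn.
    by apply: cvg_expr; rewrite ger0_norm // invf_lt1 // ltr1n.
  move=> /cvgr0Pnorm_lt/(_ _ ce)[M _ MP].
  have key m n : (M <= m)%N -> (m <= n)%N -> q (x n - x m) <= e.
    move=> Mm mn; apply: le_trans (tail q _ sq qy m n mn) _.
    have := MP m Mm; rewrite gtr0_norm // ltr_pdivlMr; last by have := normr_ge0 c; lra.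
    have := r0 n; have := r0 m; have := normr_ge0 c; nra.
  exists M => m n Mm Mn; have [mn|/ltnW nm] := leqP m n; last exact: key.
  by rewrite (seminormC sq); exact: key.
have [c cP] := pw z.
have low j : 3 ^- j * N j / 3 <= `|psi (K j) z : R|.
  pose q v := `|psi (K j) v : R|.
  have sq : seminorm q by exact: seminorm_functional.
  apply/ler_addgt0Pl => e e0; near \oo => n.
  have k1 : q (x n - z) <= e by near: n; exact: (zP q (pb (K j))).
  have jn : (j.+1 <= n)%N by near: n; exact: nbhs_infty_ge.
  have yq i : q (y i) <= 4 / 3 * N j by have [_ [_]] := kP j; apply.
  have := tail q _ sq yq _ _ jn; have [_ k3] := xS j.
  have := seminorm_sub sq (x n) (x j.+1); have := seminorm_sub sq z (x n).
  rewrite (seminormC sq (x j.+1)) rS -/(q z) => k4 k5 k6.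
  rewrite -/(q (x j.+1)) in k3.
  have : 4 / 3 * N j * (3 / 2 * (3 ^- j / 3 - 3 ^- n)) <= 2 / 3 * (3 ^- j * N j).
    have : 0 <= N j * 3 ^- n by rewrite mulr_ge0 ?normr_ge0 // ltW.
    by lra.
  lra.
have grow j : 4 ^+ j <= 3 * c.
  have [_ [k1 _]] := kP j; have k2 := low j; have k3 := cP (K j).
  have : 4 ^+ j = 3 ^- j * 12 ^+ j :> R.
    by rewrite -exprVn -exprMn; congr (_ ^+ _); field.
  have := ltr_pM2l (r0 j) (12 ^+ j) (N j); rewrite k1 => /esym k4 ->; lra.
have : (Num.truncn (3 * c)).+1%:R <= (4 : R) ^+ (Num.truncn (3 * c)).+1.
  by rewrite -natrX ler_nat ltnW // ltn_expl.
have := grow (Num.truncn (3 * c)).+1; have := real_truncnS_gt (num_real (3 * c)).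
lra.
Unshelve. all: by end_near. Qed.

End WeakTopology.

(** * Dominated convergence for scalar derivatives *)

Section BoundedConvergence.
Context {R : realType}.

Definition derivative_on (a : R) (H f : R -> R) := forall x e,
  0 <= x -> x <= a -> 0 < e -> exists2 d, 0 < d & forall y, 0 <= y -> y <= a ->
    `|y - x| <= d -> `|H y - H x - (y - x) * f x| <= e * `|y - x|.

Lemma derivative_on_lipschitz a H f x : derivative_on a H f -> 0 <= x -> x <= a ->
  exists2 d, 0 < d & forall y, 0 <= y -> y <= a -> `|y - x| <= d ->
    `|H y - H x| <= (1 + `|f x|) * `|y - x|.
Proof.
move=> Hf x0 xa; have [d d0 dP] := Hf x 1 x0 xa ltr01; exists d => // y y0 ya yx.
have := dP y y0 ya yx; rewrite mul1r => h.
have -> : H y - H x = (H y - H x - (y - x) * f x) + (y - x) * f x by rewrite subrK.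
by rewrite [leRHS]mulrDl mul1r; apply: le_trans (ler_normD _ _) (lerD h _); rewrite normrM mulrC.
Qed.

Lemma integral_derivative a H f : 0 < a -> derivative_on a H f ->
  {within `[0, a], continuous f} ->
  (\int[lebesgue_measure]_(x in `[0%R, a]) (f x)%:E = (H a)%:E - (H 0)%:E)%E.
Proof.
move=> a0 Hf cf.
have dH x : x \in `]0, a[ -> h^-1 *: ((H (h + x) : R^o) - H x) @[h --> 0^'] --> (f x : R^o).
  rewrite in_itv /= => /andP[x0 xa]; apply/cvgrPdist_le => e e0.
  have [d d0 dP] := Hf x e (ltW x0) (ltW xa) e0.
  have m0 : 0 < Num.min d (Num.min x (a - x)) by rewrite !lt_min d0 x0 subr_gt0.
  near=> h; have h0 : h != 0 by near: h; exact: nbhs_dnbhs_neq.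
  have hd : `|h| <= Num.min d (Num.min x (a - x)).
    near: h; exact: dnbhs0_le.
  move: hd; rewrite !le_min => /and3P[hd hx hax].
  have := ler_norm h; have := ler_norm (- h); rewrite normrN => h1 h2.
  have := dP (h + x); rewrite addrK => /(_ _ _ hd) k.
  have {}k : `|H (h + x) - H x - h * f x| <= e * `|h| by apply: k; lra.
  have -> : f x - h^-1 *: (H (h + x) - H x) = - (h^-1 * (H (h + x) - H x - h * f x)).
    by rewrite /GRing.scale /=; field.
  by rewrite normrN normrM normfV ler_pdivrMl ?normr_gt0 // [`|h| * e]mulrC.
apply: continuous_FTC2 => //.
- split.
  + move=> x /dH cx; apply/cvg_ex; exists (f x : R^o).
    by under eq_fun do rewrite [_ *: 1]mulr1.
  + apply/cvgrPdist_le => e e0.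
    have [d d0 dP] := derivative_on_lipschitz Hf (lexx 0) (ltW a0).
    near=> y; have y0 : 0 < y by near: y; exact: nbhs_right_gt.
    have ya : y < a by near: y; exact: nbhs_right_lt.
    have yd : y < d by near: y; exact: nbhs_right_lt.
    have ye : y < e / (1 + `|f 0|).
      by near: y; apply: nbhs_right_lt; rewrite divr_gt0 //; have := normr_ge0 (f 0); lra.
    rewrite distrC; apply: le_trans (dP y _ _ _) _; rewrite ?subr0 ?(gtr0_norm y0); try exact: ltW.
    have f1 : 0 < 1 + `|f 0| by have := normr_ge0 (f 0); lra.
    by move: ye; rewrite ltr_pdivlMr // mulrC => /ltW.
  + apply/cvgrPdist_le => e e0.
    have [d d0 dP] := derivative_on_lipschitz Hf (ltW a0) (lexx a).
    have f1 : 0 < 1 + `|f a| by have := normr_ge0 (f a); lra.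
    near=> y; have ya : y < a by near: y; exact: nbhs_left_lt.
    have y0 : 0 < y by near: y; exact: nbhs_left_gt.
    have yd : a - d < y by near: y; apply: nbhs_left_gt; lra.
    have ye : a - e / (1 + `|f a|) < y.
      by near: y; apply: nbhs_left_gt; have := divr_gt0 e0 f1; lra.
    rewrite distrC; apply: le_trans (dP y _ _ _) _; try exact: ltW.
      by rewrite distrC gtr0_norm; lra.
    rewrite distrC (@gtr0_norm _ (a - y)) ?subr_gt0 //.
    have : (a - y) < e / (1 + `|f a|) by lra.
    by rewrite ltr_pdivlMr // mulrC => /ltW.
- move=> x /dH cx; rewrite derive1E; apply: cvg_lim => //.
  by under eq_fun do rewrite [_ *: 1]mulr1.
Unshelve. all: by end_near. Qed.

(** The increments are Lebesgue integrals of the derivatives. Lebesgue's theorem is what makes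
    pointwise convergence with a common bound enough, without any uniformity in [x]. *)
Lemma bounded_convergence a M (H f : nat -> R -> R) : 0 < a ->
  (forall k, derivative_on a (H k) (f k)) ->
  (forall k, {within `[0, a], continuous (f k)}) ->
  (forall k x, 0 <= x -> x <= a -> `|f k x| <= M) ->
  (forall x, 0 <= x -> x <= a -> f ^~ x @ \oo --> 0) ->
  (fun k => H k a - H k 0) @ \oo --> 0.
Proof.
move=> a0 Hf cf fM f0; pose mu := @lebesgue_measure R.
have [||||||_ _ +] := @dominated_convergence _ _ R mu `[0, a]%classic _
  (fun k x => (f k x)%:E) (cst 0%E) (cst M%:E).
- exact: measurable_itv.
- move=> k; apply/measurable_realfun.measurable_EFinP; apply: measurable_realfun.subspace_continuous_measurable_fun => //; exact: cf.
- exact: measurable_cst.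
- apply: aeW => x /=; rewrite in_itv /= => /andP[x0 xa].
  by apply: cvg_EFin; [exact: nearW|exact: f0].
- apply: continuous_compact_integrable; first exact: segment_compact.
  by move=> x; exact: cvg_cst.
- apply: aeW => x k /=; rewrite in_itv /= => /andP[x0 xa].
  by rewrite lee_fin; exact: fM.
rewrite integral0.
under eq_fun do rewrite (integral_derivative a0 (Hf _) (cf _)) -EFinB.
by move/fine_cvgP => [_].
Qed.

End BoundedConvergence.

(** * Weak limits of approximate evolutions *)

Section Evolution.
Context {R : realType} {V : lmodType R} (Q : gauges V) (F : R -> {linear V -> V}).
Implicit Types (q : V -> R) (x y : V) (psi eta : {scalar V}).

Definition evolve (h a : R) : V -> V := power (F h) (Num.truncn (a / h)).

(** Uniformity on bounded sets is convergence in the strong topology of the dual, here for real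
    functionals. *)
Definition adjoint_derivative psi eta := [/\ bounded_functional Q psi,
  bounded_functional Q eta & forall A, gauge_bounded Q A -> forall e, 0 < e ->
    \forall h \near 0^'+, forall x, A x ->
      `|h^-1 * (psi (F h x) - psi x) - eta x : R| <= e].

Context (F_eq : locally_equicontinuous Q F).

(** The points [power (F h) j x] of bounded total time form a bounded set, all steps taken together.
    Uniform convergence of the adjoint difference quotients on this set allows the points to move
    with [h], and the errors are then summed along the telescoping sum. *)
Lemma adjoint_power psi eta x S e : adjoint_derivative psi eta -> 0 < e ->
  \forall h \near 0^'+, forall m, m%:R * h <= S ->
    `|psi (power (F h) m x - x) - h * \sum_(0 <= j < m) eta (power (F h) j x) : R|
      <= e.
Proof.
move=> [_ _ adj] e0; have S0 := normr_ge0 S.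
pose A y := exists h j, [/\ 0 <= h, j%:R * h <= `|S| & y = power (F h) j x].
have bA : gauge_bounded Q A.
  move=> q Qq; have [q' Qq' qq'] := F_eq `|S| Qq.
  by exists (q' x) => _ [h [j [h0 jS ->]]]; exact: qq'.
have e1 : 0 < e / (`|S| + 1) by rewrite divr_gt0 //; lra.
near=> h => m mS; have h0 : 0 < h by near: h; exact: nbhs_right_gt.
have adjh : forall x, A x -> `|h^-1 * (psi (F h x) - psi x) - eta x : R| <= e / (`|S| + 1).
  by near: h; exact: adj.
have mS' : m%:R * h <= `|S| by apply: le_trans (ler_norm _).
have step j : (0 <= j < m)%N ->
    `|psi (F h (power (F h) j x) - power (F h) j x) - h * eta (power (F h) j x) : R|
    <= h * (e / (`|S| + 1)).
  move=> /andP[_ jm]; have Aj : A (power (F h) j x).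
    exists h, j; split; [exact: ltW| |by []].
    by apply: (le_trans _ mS'); rewrite ler_pM2r // ler_nat ltnW.
  have := adjh _ Aj; rewrite -(ler_pM2l h0) => /(le_trans _); apply.
  rewrite -[X in _ <= X * _](gtr0_norm h0) -normrM raddfB /= mulrBr mulrA.
  by rewrite divff ?mul1r // lt0r_neq0.
have -> : psi (power (F h) m x - x) - h * \sum_(0 <= j < m) eta (power (F h) j x) =
  \sum_(0 <= j < m) (psi (F h (power (F h) j x) - power (F h) j x)
                     - h * eta (power (F h) j x)) :> R.
  rewrite sumrB mulr_sumr; congr (_ - _).
  rewrite -raddf_sum; congr (psi _).
  by rewrite -(telescope_sumr (fun i => power (F h) i x) (leq0n m)).
apply: le_trans (ler_norm_sum _ _ _) _.
rewrite big_nat_cond; apply: (@le_trans _ _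
  (\sum_(0 <= j < m | (0 <= j < m)%N && true) h * (e / (`|S| + 1)))).
  by apply: ler_sum => j /andP[jm _]; exact: step.
rewrite -big_nat_cond sumr_const_nat subn0 -[X in X <= _]mulr_natl mulrA.
apply: le_trans (ler_wpM2r (ltW e1) mS') _.
by rewrite mulrCA ger_pMr // ler_pdivrMr; lra.
Unshelve. all: by end_near. Qed.

(** [L] is fixed before [e]: the additive error disappears as the steps tend to 0, the Lipschitz
    constant remains. *)
Lemma near_evolve_lipschitz x y q S : approx_derivative Q F x y -> Q q ->
  exists2 L, 0 <= L & forall e, 0 < e -> \forall h \near 0^'+, forall l m,
    (l + m)%:R * h <= S ->
    q (power (F h) (l + m) x - power (F h) l x) <= L * (m%:R * h) + e.
Proof.
move=> xy Qq; have sq := gauge_seminorm Qq.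
have [q' Qq' qq'] := F_eq S Qq; have sq' := gauge_seminorm Qq'.
have [q2 Qq2 qq2] := F_eq S Qq'; have sq2 := gauge_seminorm Qq2.
exists (q2 y); first exact: seminorm_ge0.
move=> e e0; near=> h => l m lmS; have h0 : 0 < h by near: h; exact: nbhs_right_gt.
have lm : l%:R * h <= (l + m)%:R * h by rewrite ler_pM2r // ler_nat leq_addr.
have ml : m%:R * h <= (l + m)%:R * h by rewrite ler_pM2r // ler_nat leq_addl.
rewrite powerD -linearB; apply: le_trans (qq' h l _ (ltW h0) (le_trans lm lmS)) _.
have k1 : forall m, m%:R * h <= S ->
    q' (power (F h) m x - x - h *: \sum_(0 <= j < m) power (F h) j y) <= e.
  by near: h; exact: (power_approx F_eq S xy Qq' e0).
have {}k1 := k1 m (le_trans ml lmS).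
have k2 : q' (\sum_(0 <= j < m) power (F h) j y) <= (m%:R - 0%:R) * q2 y.
  apply: seminorm_sum_nat => // j /andP[_ jm]; apply: qq2; first exact: ltW.
  by apply: (le_trans _ (le_trans ml lmS)); rewrite ler_pM2r // ler_nat ltnW.
rewrite -(subrK (h *: \sum_(0 <= j < m) power (F h) j y) (power (F h) m x - x)).
apply: le_trans (seminormD sq' _ _) _; rewrite [leRHS]addrC; apply: lerD k1 _.
rewrite (seminormZ sq') (gtr0_norm h0); apply: le_trans (ler_wpM2l (ltW h0) k2) _.
by apply: ler_of_eq; ring.
Unshelve. all: by end_near. Qed.

Context (F_dense : densely_differentiable Q F).

(** The approximants in [approx_derivative] are controlled by one seminorm and need not form a
    bounded set, so the adjoint quotients cannot be evaluated on them. Instead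
    [psi (power (F h) m x - x)] is computed twice along the powers at the fixed point [x], for a
    total time between [d / 2] and [d]: once as about [m * h * psi y], once as about
    [m * h * eta x]. *)
Lemma adjoint_derivativeE psi eta x y : adjoint_derivative psi eta ->
  approx_derivative Q F x y -> psi y = eta x.
Proof.
move=> adj xy; have [bpsi beta _] := adj.
apply/eqP; rewrite -subr_eq0 -normr_eq0; apply/eqP/le_anti; rewrite normr_ge0 andbT.
apply/ler_addgt0Pl => e e0; rewrite addr0; have e4 : 0 < e / 4 by lra.
near (0 : R)^'+ => d; have d0 : 0 < d by near: d; exact: nbhs_right_gt.
have dy : \forall h \near 0^'+, forall j, j%:R * h <= d ->
    `|psi (power (F h) j y - y) : R| <= e / 4.
  by near: d; exact: (power_small_time F_eq F_dense _ bpsi e4).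
have dx : \forall h \near 0^'+, forall j, j%:R * h <= d ->
    `|eta (power (F h) j x - x) : R| <= e / 4.
  by near: d; exact: (power_small_time F_eq F_dense _ beta e4).
have de : 0 < d * e / 16 by rewrite divr_gt0 // mulr_gt0.
near (0 : R)^'+ => h; have h0 : 0 < h by near: h; exact: nbhs_right_gt.
have hd : h < d / 2 by near: h; apply: nbhs_right_lt; lra.
have hx : forall j, j%:R * h <= d -> `|eta (power (F h) j x - x) : R| <= e / 4 by near: h.
have hy : forall j, j%:R * h <= d -> `|psi (power (F h) j y - y) : R| <= e / 4 by near: h.
have k1 : forall m, m%:R * h <= d -> `|psi (power (F h) m x - x -
    h *: \sum_(0 <= j < m) power (F h) j y) : R| <= d * e / 16.
  by near: h; exact: (power_approx F_eq d xy bpsi de).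
have k2 : forall m, m%:R * h <= d -> `|psi (power (F h) m x - x) -
    h * \sum_(0 <= j < m) eta (power (F h) j x) : R| <= d * e / 16.
  by near: h; exact: adjoint_power.
have [m1 m2] := truncn_divP h0 (ltW d0); move: (Num.truncn _) m1 m2 => m m1 m2.
have {}k1 := k1 m m1; have {}k2 := k2 m m1.
pose A : R := \sum_(0 <= j < m) psi (power (F h) j y - y).
pose B : R := \sum_(0 <= j < m) eta (power (F h) j x - x).
have bnd (f : nat -> R) : (forall j, j%:R * h <= d -> `|f j| <= e / 4) ->
    `|h * \sum_(0 <= j < m) f j| <= m%:R * h * (e / 4).
  move=> fe; rewrite normrM gtr0_norm // (mulrC m%:R) -mulrA ler_pM2l //.
  apply: le_trans (ler_norm_sum _ _ _) _.
  rewrite big_nat_cond; apply: (@le_trans _ _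
    (\sum_(0 <= j < m | (0 <= j < m)%N && true) e / 4)).
    apply: ler_sum => j /andP[/andP[_ jm] _]; apply: fe.
    by apply: (le_trans _ m1); rewrite ler_pM2r // ler_nat ltnW.
  by rewrite -big_nat_cond sumr_const_nat subn0 mulr_natl.
have kA := bnd _ hy; have kB := bnd _ hx; rewrite -/A in kA; rewrite -/B in kB.
have E1 : psi (h *: \sum_(0 <= j < m) power (F h) j y) = h * A + m%:R * h * psi y :> R.
  rewrite linearZ /= raddf_sum /A; under [in RHS]eq_bigr do rewrite raddfB /=.
  by rewrite sumrB sumr_const_nat subn0 -[psi y *+ m]mulr_natl; ring.
have E2 : h * \sum_(0 <= j < m) eta (power (F h) j x) = h * B + m%:R * h * eta x :> R.
  rewrite /B; under [in RHS]eq_bigr do rewrite raddfB /=.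
  by rewrite sumrB sumr_const_nat subn0 -[eta x *+ m]mulr_natl; ring.
rewrite raddfB /= E1 in k1; rewrite E2 in k2.
have mh : 0 < m%:R * h by clear -m2 hd d0; lra.
rewrite -(ler_pM2l mh) -[m%:R * h in leLHS]gtr0_norm // -normrM.
have M2 : d * e <= 2 * (m%:R * h) * e by rewrite ler_pM2r //; clear -m2 hd; lra.
move: M2 k1 k2 kA kB; rewrite !ler_norml; clear => M2 /andP[? ?] /andP[? ?] /andP[? ?] /andP[? ?].
by apply/andP; split; lra.
Unshelve. all: by end_near. Qed.

End Evolution.

(** * Diagonal subsequences and weak limits *)

Definition increasing_index (k : nat -> nat) := {homo k : m n / (m < n)%N}.

Lemma increasing_index_ge k : increasing_index k -> forall n, (n <= k n)%N.
Proof.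
by move=> ki; elim=> // n IH; apply: leq_ltn_trans IH _; exact: ki.
Qed.

Lemma increasing_index_comp k l : increasing_index k -> increasing_index l ->
  increasing_index (k \o l).
Proof. by move=> ki li m n mn; apply/ki/li. Qed.

Lemma near_increasing_index (P : nat -> Prop) k : increasing_index k ->
  (\forall n \near \oo, P n) -> \forall n \near \oo, P (k n).
Proof.
move=> ki [N _ NP]; exists N => // n /= Nn; apply: NP => /=.
exact: leq_trans Nn (increasing_index_ge ki n).
Qed.

(** The second hypothesis has this form because the diagonal is a subsequence of the [i]-th
    extraction only after its first terms, and there its indices are at least as large. *)
Lemma diagonal_subsequence (P : nat -> (nat -> nat) -> Prop) :
  (forall i k, increasing_index k -> exists l, increasing_index l /\ P i (k \o l)) ->
  (forall i k d, P i k -> (forall j, (i < j)%N -> exists2 m, (j <= m)%N & d j = k m) ->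
     P i d) ->
  exists d, increasing_index d /\ forall i, P i d.
Proof.
move=> sub inv.
have /choice[L0 L0P] : forall ik : nat * (nat -> nat), exists l,
    increasing_index ik.2 -> increasing_index l /\ P ik.1 (ik.2 \o l).
  (* [id] is a default value: the choice function is applied to increasing sequences. *)
  move=> [i k]; have [ki|nki] := pselect (increasing_index k); last by exists id.
  by have [l lP] := sub i k ki; exists l.
pose K := fix K i := if i is i'.+1 then K i' \o L0 (i', K i') else id.
have Ki i : increasing_index (K i).
  by elim: i => // i IH; apply: increasing_index_comp => //; have [] := L0P (i, K i) IH.
have KP i : P i (K i.+1) by have [] := L0P (i, K i) (Ki i).
have Li i : increasing_index (L0 (i, K i)) by have [] := L0P (i, K i) (Ki i).
have factor i j : (i <= j)%N -> exists2 m, increasing_index m & K j = K i \o m.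
  elim: j => [|j IH]; first by rewrite leqn0 => /eqP->; exists id.
  rewrite leq_eqVlt => /orP[/eqP->|]; first by exists id.
  rewrite ltnS => /IH[m mi E]; exists (m \o L0 (j, K j)).
    exact: increasing_index_comp.
  by rewrite [K j.+1]/(K j \o _) {1}E.
exists (fun j => K j j); split=> [|i].
  suff step j : (K j j < K j.+1 j.+1)%N.
    move=> m n; elim: n => // n IH; rewrite ltnS leq_eqVlt => /orP[/eqP->//|/IH h].
    exact: ltn_trans h _.
  by apply: Ki; apply: (leq_trans _ (increasing_index_ge (Li j) j.+1)).
apply: inv (KP i) _ => j ij; have [m mi ->] := factor i.+1 j ij.
by exists (m j) => //; exact: increasing_index_ge.
Qed.

Section WeakLimits.
Context {R : realType} {V : lmodType R} (Q : gauges V).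
Implicit Types (q : V -> R) (x y : V) (rho : {scalar V}).

Definition weakly_subsequential (u : nat -> V) := forall k, increasing_index k ->
  exists l x, increasing_index l /\ weak_limit Q (u \o k \o l) x.

Lemma weak_limit_comp u x k : increasing_index k -> weak_limit Q u x ->
  weak_limit Q (u \o k) x.
Proof.
by move=> ki ux rho rb e e0; exact: (near_increasing_index ki (ux rho rb e e0)).
Qed.

Lemma weak_limitD u v x y : weak_limit Q u x -> weak_limit Q v y ->
  weak_limit Q (fun n => u n + v n) (x + y).
Proof.
move=> ux vy rho rb e e0; have e2 : 0 < e / 2 by lra.
near=> n; have k1 : `|rho (u n - x) : R| <= e / 2 by near: n; exact: ux.
have k2 : `|rho (v n - y) : R| <= e / 2 by near: n; exact: vy.
have -> : u n + v n - (x + y) = (u n - x) + (v n - y) by module_eq V.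
by rewrite raddfD; apply: le_trans (ler_normD _ _) _; lra.
Unshelve. all: by end_near. Qed.

Lemma weak_limitN u x : weak_limit Q u x -> weak_limit Q (fun n => - u n) (- x).
Proof.
move=> ux rho rb e e0; near=> n.
by rewrite -opprD raddfN normrN; near: n; exact: ux.
Unshelve. all: by end_near. Qed.

Lemma weak_limit_cst x : weak_limit Q (fun=> x) x.
Proof. by move=> rho rb e e0; near=> n; rewrite subrr raddf0 normr0 ltW.
Unshelve. all: by end_near. Qed.

Lemma weak_limit_uniq u x y : weak_limit Q u x -> weak_limit Q u y -> x = y.
Proof.
move=> ux uy; apply/eqP; rewrite -subr_eq0; apply/eqP.
apply: (@gauge_eq0 _ _ Q) => q e Qq e0.
have h := weak_limitD ux (weak_limitN uy).
apply: (weak_limit_le Qq h); near=> n.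
by rewrite subrr (seminorm0 (gauge_seminorm Qq)) ltW.
Unshelve. all: by end_near. Qed.

End WeakLimits.

(** * Estimates of evolutions in continuous time *)

Section EvolutionEstimates.
Context {R : realType} {V : lmodType R} (Q : gauges V) (F : R -> {linear V -> V}).
Implicit Types (q : V -> R) (x y : V) (psi eta : {scalar V}).

Context (F_eq : locally_equicontinuous Q F).
Context (F_dense : densely_differentiable Q F).

Context (t : R).
Context (t0 : 0 < t).

Lemma near_step (P : R -> Prop) : (\forall h \near 0^'+, P h) ->
  \forall n \near \oo, P (t / n%:R).
Proof.
move=> /nbhs_ballP[e /= e0 eP]; near=> n.
have n0 : 0 < n%:R :> R by rewrite ltr0n; near: n; exact: nbhs_infty_gt.
have ne : t / e < n%:R by near: n; exact: nbhs_infty_gtr.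
have tn : 0 < t / n%:R by rewrite divr_gt0.
apply: eP => //; rewrite /ball /= sub0r normrN gtr0_norm //.
by rewrite ltr_pdivrMr // mulrC -ltr_pdivrMr.
Unshelve. all: by end_near. Qed.

Lemma evolve_lipschitz x y q S : approx_derivative Q F x y -> Q q ->
  exists2 L, 0 <= L & forall e, 0 < e -> \forall h \near 0^'+, forall a b,
    0 <= a -> a <= b -> b <= S ->
    q (evolve F h b x - evolve F h a x) <= L * (b - a) + e.
Proof.
move=> xy Qq; have [L L0 LP] := near_evolve_lipschitz F_eq S xy Qq.
exists L => // e e0; have e2 : 0 < e / 2 by lra.
near=> h => a b a0 ab bS; have h0 : 0 < h by near: h; exact: nbhs_right_gt.
have hL : h < e / 2 / (L + 1).
  by near: h; apply: nbhs_right_lt; rewrite divr_gt0 //; lra.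
have lip : forall l m, (l + m)%:R * h <= S ->
    q (power (F h) (l + m) x - power (F h) l x) <= L * (m%:R * h) + e / 2.
  by near: h; exact: LP.
have [a1 a2] := truncn_divP h0 a0; have [b1 b2] := truncn_divP h0 (le_trans a0 ab).
have mab := truncn_div_le h0 ab; rewrite /evolve -(subnKC mab).
move: (Num.truncn (a / h)) (Num.truncn (b / h)) mab a1 a2 b1 b2 => l m lm a1 a2 b1 b2.
apply: le_trans (lip l (m - l)%N _) _; first by rewrite subnKC //; lra.
rewrite natrB //; move: hL; rewrite ltr_pdivlMr; last by lra.
have : (m%:R - l%:R) * h <= b - a + h by lra.
by move=> /(ler_wpM2l L0); lra.
Unshelve. all: by end_near. Qed.

(** In [adjoint_power] the sum runs over all intermediate times, where no weak limit can be taken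
    termwise. Lipschitz continuity replaces it by the value at [a] with an error quadratic in
    [b - a], so that only the two times [a] and [b] remain. *)
Lemma adjoint_evolve psi eta x y S : adjoint_derivative Q F psi eta ->
  approx_derivative Q F x y ->
  exists2 L, 0 <= L & forall e, 0 < e -> \forall h \near 0^'+, forall a b,
    0 <= a -> a <= b -> b <= S ->
    `|psi (evolve F h b x - evolve F h a x) - (b - a) * eta (evolve F h a x) : R|
      <= L * (b - a) ^+ 2 + e.
Proof.
move=> adj xy; have [bpsi beta _] := adj.
have [L L0 LP] := near_evolve_lipschitz F_eq S xy beta.
have [q' Qq' qq'] := F_eq S beta; have C0 := gauge_ge0 x Qq'.
have S0 := normr_ge0 S.
(* [K] is the sum of the coefficients of [e'] in the final estimate: rounding to multiples of [h],
   the Lipschitz error and the two uses of [adjoint_power]. *)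
exists L => // e e0; pose K := 2 + 2 * L * `|S| + L + `|S| + q' x.
have LS0 : 0 <= L * `|S| by exact: mulr_ge0.
have K0 : 0 < K by rewrite /K; lra.
pose e' := Num.min 1 (e / K).
have e'0 : 0 < e' by rewrite lt_min ltr01 divr_gt0.
have e'1 : e' <= 1 by rewrite ge_min lexx.
have e'e : e' * K <= e.
  by rewrite -ler_pdivlMr // ge_min lexx orbT.
have e'2 : 0 < e' / 2 by lra.
near=> h => a b a0 ab bS; have h0 : 0 < h by near: h; exact: nbhs_right_gt.
have he : h < e' by near: h; exact: nbhs_right_lt.
have lip : forall l m, (l + m)%:R * h <= S ->
    `|eta (power (F h) (l + m) x - power (F h) l x) : R| <= L * (m%:R * h) + e'.
  by near: h; exact: LP.
have adjh : forall m, m%:R * h <= S -> `|psi (power (F h) m x - x) -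
    h * \sum_(0 <= j < m) eta (power (F h) j x) : R| <= e' / 2.
  by near: h; exact: (adjoint_power F_eq x S adj e'2).
have [a1 a2] := truncn_divP h0 a0; have [b1 b2] := truncn_divP h0 (le_trans a0 ab).
have mab := truncn_div_le h0 ab; rewrite /evolve.
move: (Num.truncn (a / h)) (Num.truncn (b / h)) mab a1 a2 b1 b2 => l m lm a1 a2 b1 b2.
have dS : b - a <= `|S| by have := ler_norm S; lra.
have lS : l%:R * h <= S by lra.
have mS : m%:R * h <= S by lra.
have kl := adjh l lS; have km := adjh m mS.
have kC : `|eta (power (F h) l x) : R| <= q' x by apply: qq' => //; exact: ltW.
pose D : R := \sum_(l <= j < m) (eta (power (F h) j x - power (F h) l x)).
have M0 : 0 <= m%:R - l%:R :> R by rewrite subr_ge0 ler_nat.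
pose s := (m%:R - l%:R) * h.
have s0 : 0 <= s by rewrite mulr_ge0 // ltW.
have s1 : s <= b - a + h by rewrite /s; clear -a1 a2 b1 b2; lra.
have s2 : `|s - (b - a)| <= h.
  by rewrite /s ler_norml; clear -a1 a2 b1 b2; apply/andP; split; lra.
have kD : `|h * D| <= s * (L * s + e').
  rewrite normrM gtr0_norm // /s (mulrC _ h) -mulrA ler_pM2l //.
  apply: le_trans (ler_norm_sum _ _ _) _; rewrite big_nat_cond.
  apply: (@le_trans _ _ (\sum_(l <= j < m | (l <= j < m)%N && true) (L * s + e'))).
    apply: ler_sum => j /andP[/andP[lj jm] _].
    have jh : j%:R * h <= m%:R * h by rewrite ler_pM2r // ler_nat ltnW.
    have := lip l (j - l)%N; rewrite subnKC // => /(_ (le_trans jh mS)) /le_trans; apply.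
    by rewrite lerD2r ler_wpM2l // natrB // /s; clear -jh F_eq F_dense t0; lra.
  by rewrite -big_nat_cond sumr_const_nat -[X in X <= _]mulr_natl natrB // /s [h * _]mulrC.
have E : psi (power (F h) m x - power (F h) l x) - (b - a) * eta (power (F h) l x) =
  (psi (power (F h) m x - x) - h * \sum_(0 <= j < m) eta (power (F h) j x)) -
  (psi (power (F h) l x - x) - h * \sum_(0 <= j < l) eta (power (F h) j x)) +
  h * D + (s - (b - a)) * eta (power (F h) l x) :> R.
  have -> : D = \sum_(l <= j < m) eta (power (F h) j x) -
      (m%:R - l%:R) * eta (power (F h) l x).
    rewrite /D; under eq_bigr do rewrite raddfB /=.
    by rewrite sumrB sumr_const_nat -[eta (power _ l x) *+ _]mulr_natl natrB.
  rewrite (big_cat_nat (leq0n l) lm) /= /s.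
  by rewrite !raddfB /=; ring.
rewrite E.
apply: le_trans (ler_normD _ _) _; apply: le_trans (lerD (ler_normD _ _) (lexx _)) _.
apply: le_trans (lerD (lerD (ler_normB _ _) (lexx _)) (lexx _)) _.
rewrite [`|(s - _) * _|]normrM.
have k1 : `|s - (b - a)| * `|eta (power (F h) l x) : R| <= e' * q' x.
  by apply: ler_pM => //; apply: le_trans s2 (ltW he).
have k2 : s * (L * s + e') <= L * (b - a) ^+ 2 + e' * (2 * L * `|S| + L + `|S| + 1).
  have d0 : 0 <= b - a by rewrite subr_ge0.
  have s3 : s <= (b - a) + e' by clear -s1 he; lra.
  apply: (@le_trans _ _ (((b - a) + e') * (L * ((b - a) + e') + e'))).
    by apply: ler_pM => //; [rewrite addr_ge0 ?mulr_ge0 // ltW|rewrite lerD2r ler_wpM2l].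
  have := ler_wpM2l (mulr_ge0 L0 (ltW e'0)) dS.
  have := ler_wpM2l (mulr_ge0 L0 (ltW e'0)) e'1.
  have := ler_wpM2l (ltW e'0) dS; have := ler_wpM2l (ltW e'0) e'1.
  by clear; rewrite expr2; lra.
by have := e'0; move: e'e kD k1 k2 km kl; rewrite /K; clear; lra.
Unshelve. all: by end_near. Qed.

End EvolutionEstimates.

Lemma scalar_linearZ (R : realType) (V : lmodType R) (rho : {scalar V}) a x :
  rho (a *: x) = a * rho x.
Proof. by rewrite linearZ. Qed.

(** * The weak trajectory and its integrated equation *)

Section WeakTrajectories.
Context {R : realType} {V : lmodType R} (Q : gauges V) (F : R -> {linear V -> V}).
Implicit Types (q : V -> R) (psi eta rho : {scalar V}).

Context (F_eq : locally_equicontinuous Q F) (F_dense : densely_differentiable Q F).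
Context (t : R) (t0 : 0 < t).
Context (Z : V -> V -> Prop) (Z_linear : linear_relation Z)
  (Z_closed : closed_relation Q Z)
  (Z_approx : forall x y, Z x y -> approx_derivative Q F x y).
Context (adjoint_dense : forall rho, bounded_functional Q rho ->
  exists psi eta : nat -> {scalar V},
    (forall k, adjoint_derivative Q F (psi k) (eta k)) /\
    forall x, (fun k => psi k x : R) @ \oo --> (rho x : R)).
Context (f z : V) (Zfz : Z f z).
Context (f_approx : forall s, 0 <= s -> exists u v : nat -> V,
  [/\ forall n, (0 < n)%N -> Z (u n) (v n),
      weak_limit Q (fun n => evolve F (t / n%:R) s f - u n) 0,
      weakly_subsequential Q v & weakly_subsequential Q u]).

Let P (n : nat) (s : R) := evolve F (t / n%:R) s f.

Lemma evolve_subsequential s : 0 <= s -> weakly_subsequential Q (fun n => P n s).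
Proof.
move=> s0 k ki; have [u [v [_ Pu _ us]]] := f_approx s0.
have [l [x [li ux]]] := us k ki; exists l, x; split=> //.
rewrite -[x]add0r.
have := weak_limitD (weak_limit_comp (increasing_index_comp ki li) Pu) ux.
by under [X in weak_limit Q X]eq_fun do rewrite /= subrK.
Qed.

(** Off the grid the Lipschitz estimate makes the diagonal sequence weakly Cauchy, but this alone
    provides no limit in [V]. The limit [x] comes from one more extraction at the time [r];
    comparison with a nearby grid time shows that the whole diagonal sequence converges to it. *)
Lemma weak_trajectory : exists d u, increasing_index d /\
  forall r : R, 0 <= r -> weak_limit Q (fun j => P (d j) r) (u r).
Proof.
(* An enumeration of the nonnegative rationals, with 0 as the default for numbers that encode no
   pair. *)
pose grid (i : nat) : R :=
  if (unpickle i : option (nat * nat)) is Some (a, b) then a%:R / b.+1%:R else 0.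
have grid0 i : 0 <= grid i by rewrite /grid; case: unpickle => // -[a b]; exact: divr_ge0.
have [||d [di dP]] := @diagonal_subsequence
    (fun i k => exists x, weak_limit Q (fun j => P (k j) (grid i)) x).
- move=> i k ki; have [l [x [li xP]]] := evolve_subsequential (grid0 i) ki.
  by exists l; split=> //; exists x.
- move=> i k d [x xP] dk; exists x => rho rb e e0.
  have [N _ NP] := xP rho rb e e0; exists (maxn i.+1 N) => // j /=.
  rewrite geq_max => /andP[ij Nj]; have [m jm ->] := dk j ij.
  by apply: NP => /=; exact: leq_trans jm.
suff h r : exists x, 0 <= r -> weak_limit Q (fun j => P (d j) r) x.
  by have /choice[u uP] := h; exists d, u; split.
have [r0|r0] := leP 0 r; last by exists 0 => r0'; lra.
have [l [x [li xP]]] := evolve_subsequential r0 di.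
exists x => _ rho rb e e0.
have [L L0 LP] := evolve_lipschitz F_eq (r + 1) (Z_approx Zfz) rb.
have e8 : 0 < e / 8 by lra.
have [i [ri ir iL]] : exists i, [/\ grid i <= r, 0 <= r - grid i & L * (r - grid i) <= e / 8].
  have c0 : 0 < e / 8 / (L + 1) by rewrite divr_gt0 //; lra.
  have [b _ bP] := near_infty_natSinv_lt (PosNum c0).
  pose B : R := b.+1%:R^-1; have B0 : 0 < B by rewrite invr_gt0.
  have [a1 a2] := truncn_divP B0 r0.
  have BL : B * (L + 1) < e / 8.
    by have := bP b (leqnn b) => /=; rewrite ltr_pdivlMr //; lra.
  exists (pickle (Num.truncn (r / B), b)).
  have -> : grid (pickle (Num.truncn (r / B), b)) = (Num.truncn (r / B))%:R * B.
    by rewrite /grid pickleK.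
  clearbody B; move: ((Num.truncn (r / B))%:R : R) a1 a2 => A a1 a2.
  split; [lra|lra|].
  by apply: le_trans (ler_wpM2l L0 (_ : r - A * B <= B)) _; [lra|nra].
have [y yP] := dP i.
have near1 : \forall j \near \oo, `|rho (P (d j) r - y) : R| <= 3 * (e / 8).
  near=> j; have k1 : `|rho (P (d j) (grid i) - y) : R| <= e / 8.
    by near: j; exact: (yP rho rb).
  have k2 : `|rho (P (d j) r - P (d j) (grid i)) : R| <= L * (r - grid i) + e / 8.
    near: j; apply: (near_increasing_index di (P := fun n =>
      `|rho (P n r - P n (grid i)) : R| <= L * (r - grid i) + e / 8)).
    apply: (near_step t0 (P := fun h => `|rho (evolve F h r f - evolve F h (grid i) f) : R|
      <= L * (r - grid i) + e / 8)).
    apply: filterS (LP _ e8) => h; apply=> //; lra.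
  have /= := seminorm_dist (seminorm_functional rho) (P (d j) (grid i)) (P (d j) r) y; lra.
have k3 : `|rho (x - y) : R| <= 4 * (e / 8).
  near \oo => j.
  have k1 : `|rho (P (d (l j)) r - x) : R| <= e / 8 by near: j; exact: (xP rho rb).
  have k2 : `|rho (P (d (l j)) r - y) : R| <= 3 * (e / 8).
    by near: j; exact: (near_increasing_index li near1).
  have /= := seminorm_dist (seminorm_functional rho) (P (d (l j)) r) x y.
  rewrite (seminormC (seminorm_functional rho) x (P _ _)) /=; lra.
near=> j.
have k1 : `|rho (P (d j) r - y) : R| <= 3 * (e / 8) by near: j.
have /= := seminorm_dist (seminorm_functional rho) y (P (d j) r) x.
rewrite (seminormC (seminorm_functional rho) y x) /=; lra.
Unshelve. all: by end_near. Qed.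

Section Trajectory.
Context (d : nat -> nat) (u : R -> V) (di : increasing_index d)
  (uP : forall r : R, 0 <= r -> weak_limit Q (fun j => P (d j) r) (u r)).

Lemma near_trajectory (A : R -> Prop) : (\forall h \near 0^'+, A h) ->
  \forall j \near \oo, A (t / (d j)%:R).
Proof.
by move=> /(near_step t0)/(near_increasing_index di).
Qed.

Lemma trajectory0 : u 0 = f.
Proof.
apply: (weak_limit_uniq (uP (lexx 0))).
by under [X in weak_limit Q X]eq_fun do rewrite /P /evolve mul0r truncn0; exact: weak_limit_cst.
Qed.

Lemma trajectory_lipschitz q S : Q q -> exists2 L, 0 <= L &
  forall a b, 0 <= a -> a <= b -> b <= S -> q (u b - u a) <= L * (b - a).
Proof.
move=> Qq; have [L L0 LP] := evolve_lipschitz F_eq S (Z_approx Zfz) Qq.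
exists L => // a b a0 ab bS; apply/ler_addgt0Pl => e e0; rewrite [leRHS]addrC.
have := weak_limitD (uP (le_trans a0 ab)) (weak_limitN (uP a0)).
move=> /(weak_limit_le Qq); apply; near=> j.
have : forall a b, 0 <= a -> a <= b -> b <= S ->
    q (evolve F (t / (d j)%:R) b f - evolve F (t / (d j)%:R) a f) <= L * (b - a) + e.
  by near: j; exact: (near_trajectory (LP e e0)).
by apply.
Unshelve. all: by end_near. Qed.

Lemma trajectory_continuous : uniformly_continuous Q u.
Proof.
move=> q Qq S e e0; have [L L0 LP] := trajectory_lipschitz S Qq.
have sq := gauge_seminorm Qq.
have d0 : 0 < e / (L + 1) by rewrite divr_gt0 //; lra.
exists (e / (L + 1)) => // r s r0 rS s0 sS; rewrite ler_pdivlMr; last by lra.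
have [rs|/ltW sr] := leP r s.
  rewrite (seminormC sq) distrC ger0_norm ?subr_ge0 // => h.
  by apply: le_trans (LP r s r0 rs sS) _; nra.
rewrite ger0_norm ?subr_ge0 // => h.
by apply: le_trans (LP s r s0 sr rS) _; nra.
Qed.

Lemma trajectory_domain r : 0 <= r -> exists w, Z (u r) w.
Proof.
move=> r0; have [x [v [Zxv Px vs _]]] := f_approx r0.
have [l [w [li vw]]] := vs d di; exists w.
have dli := increasing_index_comp di li.
have xu : weak_limit Q (x \o d \o l) (u r).
  have := weak_limitD (weak_limit_comp li (uP r0)) (weak_limitN (weak_limit_comp dli Px)).
  rewrite oppr0 addr0; under [X in weak_limit Q X]eq_fun do rewrite /= opprB /P addrC subrK.
  by [].
apply: (weak_limit_relation Z_linear Z_closed _ xu vw).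
(* Membership in [Z] is known for positive indices only; [d (l n)] is at least [n]. *)
near=> n; apply: Zxv; apply: leq_trans (increasing_index_ge dli n).
by near: n; exact: nbhs_infty_gt.
Unshelve. all: by end_near. Qed.

Lemma trajectory_adjoint_local psi eta S : adjoint_derivative Q F psi eta ->
  exists2 L, 0 <= L & forall a b, 0 <= a -> a <= b -> b <= S ->
    `|psi (u b - u a) - (b - a) * eta (u a) : R| <= L * (b - a) ^+ 2.
Proof.
move=> adj; have [bpsi beta _] := adj.
have [L L0 LP] := adjoint_evolve F_eq S adj (Z_approx Zfz).
exists L => // a b a0 ab bS; apply/ler_addgt0Pl => e e0.
have e4 : 0 < e / 4 by lra.
have e5 : 0 < e / 4 / (b - a + 1) by rewrite divr_gt0 //; lra.
have b0 : 0 <= b by lra.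
near \oo => j.
have k1 : `|psi (P (d j) b - u b) : R| <= e / 4 by near: j; exact: (uP b0 bpsi).
have k2 : `|psi (P (d j) a - u a) : R| <= e / 4 by near: j; exact: (uP a0 bpsi).
have k3 : `|eta (P (d j) a - u a) : R| <= e / 4 / (b - a + 1).
  by near: j; exact: (uP a0 beta).
have k4 : forall a b, 0 <= a -> a <= b -> b <= S ->
    `|psi (evolve F (t / (d j)%:R) b f - evolve F (t / (d j)%:R) a f) -
      (b - a) * eta (evolve F (t / (d j)%:R) a f) : R| <= L * (b - a) ^+ 2 + e / 4.
  by near: j; exact: (near_trajectory (LP _ e4)).
have {}k4 := k4 a b a0 ab bS; rewrite -/(P (d j) a) -/(P (d j) b) in k4.
have k5 : `|(b - a) * eta (P (d j) a - u a) : R| <= e / 4.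
  rewrite normrM ger0_norm ?subr_ge0 //.
  apply: le_trans (ler_wpM2l _ k3) _; first by lra.
  by rewrite mulrCA ger_pMr // ler_pdivrMr; lra.
have -> : psi (u b - u a) - (b - a) * eta (u a) =
  (psi (P (d j) b - P (d j) a) - (b - a) * eta (P (d j) a)) -
  (psi (P (d j) b - u b) - psi (P (d j) a - u a)) + (b - a) * eta (P (d j) a - u a) :> R.
  by rewrite !raddfB /=; ring.
apply: le_trans (ler_normD _ _) _; apply: le_trans (lerD (ler_normB _ _) (lexx _)) _.
by have := ler_normB (psi (P (d j) b - u b) : R) (psi (P (d j) a - u a)); lra.
Unshelve. all: by end_near. Qed.

Lemma trajectory_adjoint_bound (psi eta : nat -> {scalar V}) a :
  (forall k, adjoint_derivative Q F (psi k) (eta k)) ->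
  (forall x, exists c, forall k, `|psi k x : R| <= c) ->
  exists M, forall k r, 0 <= r -> r <= a -> `|eta k (u r) : R| <= M.
Proof.
move=> adj bnd.
pose A x := exists r s, [/\ 0 <= r, r < s, s <= a + 1 & x = (s - r)^-1 *: (u s - u r)].
have bA : gauge_bounded Q A.
  move=> q Qq; have [L L0 LP] := trajectory_lipschitz (a + 1) Qq; exists L.
  move=> _ [r [s [r0 rs sa ->]]]; have sr : 0 < s - r by lra.
  rewrite (seminormZ (gauge_seminorm Qq)) gtr0_norm ?invr_gt0 //.
  by rewrite ler_pdivrMl // mulrC; apply: LP => //; exact: ltW.
have bpsi k : bounded_functional Q (psi k) by have [] := adj k.
have [M MP] := uniformly_bounded_functionals bpsi bnd bA.
exists M => k r r0 ra; apply/ler_addgt0Pl => e e0; rewrite [leRHS]addrC.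
have [L L0 LP] := trajectory_adjoint_local (a + 1) (adj k).
pose s := Num.min 1 (e / (L + 1)).
have s0 : 0 < s by rewrite lt_min ltr01 divr_gt0 //; lra.
have s1 : s <= 1 by rewrite ge_min lexx.
have sL : s * (L + 1) <= e by rewrite -ler_pdivlMr; [rewrite ge_min lexx orbT|lra].
have rs : r <= r + s by lra.
have ra1 : r + s <= a + 1 by lra.
have := LP r (r + s) r0 rs ra1.
have rss : r + s - r = s by ring.
rewrite rss => h.
have : `|psi k (s^-1 *: (u (r + s) - u r)) : R| <= M.
  by apply: MP; exists r, (r + s); split=> //; [lra|rewrite rss].
rewrite linearZ /= normrM gtr0_norm ?invr_gt0 // ler_pdivrMl // => h2.
rewrite -(ler_pM2l s0) -[s in leLHS]gtr0_norm // -normrM.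
have := ler_normB (psi k (u (r + s) - u r) : R)
  (psi k (u (r + s) - u r) - s * eta k (u r)).
rewrite subKr; move: h2 h; rewrite expr2.
move: (`|psi k _ : R|) (`|_ - _|) => x y h2 h /le_trans; apply.
have := ler_wpM2l (ltW s0) sL; nra.
Qed.

Context (v : R -> V) (v0 : v 0 = 0) (vu : primitive Q v u).

(** [psi \o u] and [eta \o v] have the same first-order expansion with derivative [eta \o u],
    uniformly on [[0, a]], so their difference [E] is constant. *)
Lemma trajectory_adjoint psi eta a : adjoint_derivative Q F psi eta -> 0 <= a ->
  psi (u a - f) = eta (v a).
Proof.
move=> adj a0; have [bpsi beta _] := adj.
have [L L0 LP] := trajectory_adjoint_local a adj.
pose E x : R := psi (u x) - eta (v x).
suff h e : 0 < e -> `|E a - E 0| <= e * (a - 0).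
  apply/eqP; rewrite -subr_eq0 -normr_eq0; apply/eqP/le_anti; rewrite normr_ge0 andbT.
  apply/ler_addgt0Pl => e e0; rewrite addr0.
  have ea : 0 < e / (a + 1) by rewrite divr_gt0 //; lra.
  have := h _ ea; rewrite subr0 /E trajectory0 v0 raddf0 subr0.
  rewrite raddfB /= -!addrA [- _ + - _]addrC => /le_trans; apply.
  by rewrite mulrAC ler_pdivrMr; [nra|lra].
move=> e0; have e2 : 0 < e / 2 by lra.
have [d1 d10 d1P] := vu beta a e2.
pose dd := Num.min d1 (e / 2 / (L + 1)).
have dd0 : 0 < dd by rewrite lt_min d10 divr_gt0 //; lra.
apply: (le_of_local (D := fun x y => `|E y - E x|) _ dd0) => //.
  by move=> x y w; rewrite [leRHS]addrC; exact: ler_distD.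
move=> x y x0 xy ya; rewrite le_min => /andP[yx1].
rewrite ler_pdivlMr => [yx2|]; last by lra.
have h1 := d1P x y x0 xy ya yx1; have h2 := LP x y x0 xy ya.
rewrite /= in h1.
have -> : E y - E x = (psi (u y - u x) - (y - x) * eta (u x)) -
    eta (v y - v x - (y - x) *: u x).
  by rewrite /E !raddfB /= (scalar_linearZ eta); ring.
apply: le_trans (ler_normB _ _) _.
have yx0 : 0 <= y - x by lra.
have h3 : L * (y - x) ^+ 2 <= e / 2 * (y - x).
  by rewrite expr2 mulrA ler_wpM2r //; lra.
lra.
Qed.

(* Separation by a functional (rho1, rho2) vanishing on [Z] would be refuted by
   approximating rho2 by the psi_k: the scalar functions eta_k o u + rho1 o u are
   then bounded and tend to 0 pointwise, hence so do their integrals. *)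
Lemma trajectory_integral a : 0 <= a -> Z (v a) (u a - f).
Proof.
move=> a0; have [<-|ane] := eqVneq 0 a.
  by rewrite v0 trajectory0 subrr; have [] := Z_linear.
have {ane}a0' : 0 < a by rewrite lt_neqAle ane.
apply: contrapT => nZ.
have [rho1 [rho2 [b1 b2 Z0 /eqP]]] := separate_relation Z_linear Z_closed nZ; apply.
have [psi [eta [adj psirho]]] := adjoint_dense b2.
have bnd x : exists c, forall k, `|psi k x : R| <= c.
  have : cvgn (fun k => psi k x : R) by apply/cvg_ex; exists (rho2 x); exact: psirho.
  move=> /cvg_seq_bounded [c [_ cP]]; exists (c + 1) => k.
  by apply: (cP (c + 1)) => //; rewrite ltrDl.
have [M MP] := trajectory_adjoint_bound a adj bnd.
have [L L0 LP] := trajectory_lipschitz a b1.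
have beta k : bounded_functional Q (eta k) by have [] := adj k.
pose g k r : R := eta k (u r) + rho1 (u r).
pose G k r : R := eta k (v r) + rho1 (v r).
have scalar_cont (rho : {scalar V}) e : bounded_functional Q rho -> 0 < e ->
    exists2 d, 0 < d & forall r s, 0 <= r -> r <= a -> 0 <= s -> s <= a ->
      `|r - s| <= d -> `|rho (u r) - rho (u s) : R| <= e.
  move=> br e0; have [dd dd0 ddP] := trajectory_continuous br a e0.
  by exists dd => // r s r0 ra s0 sa rs; rewrite -raddfB; exact: ddP.
have scalar_deriv (rho : {scalar V}) : bounded_functional Q rho ->
    derivative_on a (fun r => rho (v r)) (fun r => rho (u r)).
  move=> br x e x0 xa e0; have e2 : 0 < e / 2 by lra.
  have [d1 d10 d1P] := vu br a e2; have [d2 d20 d2P] := scalar_cont rho _ br e2.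
  exists (Num.min d1 d2); first by rewrite lt_min d10.
  move=> y y0 ya; rewrite le_min => /andP[yd1 yd2].
  have [xy|/ltW yx] := leP x y.
    rewrite ger0_norm ?subr_ge0 // in yd1 *.
    have := d1P x y x0 xy ya yd1; rewrite /= !raddfB /= (scalar_linearZ rho) => h.
    by apply: le_trans h _; rewrite ler_wpM2r ?subr_ge0 //; lra.
  (* [primitive] expands at left endpoints only: for [y <= x] the expansion is made at [y], and
     continuity of [rho \o u] moves the derivative to [x]. *)
  have h2 := d2P y x y0 ya x0 xa yd2.
  rewrite distrC ger0_norm ?subr_ge0 // in yd1 *.
  have := d1P y x y0 yx xa yd1; rewrite /= !raddfB /= (scalar_linearZ rho) => h.
  have -> : rho (v y) - rho (v x) - (y - x) * rho (u x) =
    - (rho (v x) - rho (v y) - (x - y) * rho (u y)) - (x - y) * (rho (u y) - rho (u x)) :> R.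
    by ring.
  apply: le_trans (ler_normB _ _) _; rewrite normrN normrM (@ger0_norm _ (x - y)) ?subr_ge0 //.
  have xy0 : 0 <= x - y by lra.
  by have := ler_wpM2l xy0 h2; lra.
have Gcvg : (fun k => G k a - G k 0) @ \oo --> 0.
  apply: (@bounded_convergence _ a (M + (`|rho1 f : R| + L * a)) G g a0').
  - move=> k x e x0 xa e0; have e2 : 0 < e / 2 by lra.
    have [d1 d10 d1P] := scalar_deriv _ (beta k) x _ x0 xa e2.
    have [d2 d20 d2P] := scalar_deriv _ b1 x _ x0 xa e2.
    exists (Num.min d1 d2); first by rewrite lt_min d10.
    move=> y y0 ya; rewrite le_min => /andP[yd1 yd2].
    have -> : G k y - G k x - (y - x) * g k x =
      (eta k (v y) - eta k (v x) - (y - x) * eta k (u x)) +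
      (rho1 (v y) - rho1 (v x) - (y - x) * rho1 (u x)) by rewrite /G /g; ring.
    apply: le_trans (ler_normD _ _) _.
    by have := d1P y y0 ya yd1; have := d2P y y0 ya yd2; lra.
  - move=> k; apply/subspace_continuousP => x /=; rewrite in_itv /= => /andP[x0 xa].
    apply/cvgrPdist_le => e e0; have e2 : 0 < e / 2 by lra.
    have [d1 d10 d1P] := scalar_cont _ _ (beta k) e2.
    have [d2 d20 d2P] := scalar_cont _ _ b1 e2.
    have dd0 : 0 < Num.min d1 d2 by rewrite lt_min d10.
    have : \forall y \near x, `|x - y| <= Num.min d1 d2.
      have /cvgrPdist_le := @cvg_id _ (nbhs x); exact.
    apply: filterS => y; rewrite le_min => /andP[yd1 yd2] /=.
    rewrite in_itv /= => /andP[y0 ya].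
    have -> : g k x - g k y = (eta k (u x) - eta k (u y)) + (rho1 (u x) - rho1 (u y)).
      by rewrite /g; ring.
    apply: le_trans (ler_normD _ _) _.
    by have := d1P x y x0 xa y0 ya yd1; have := d2P x y x0 xa y0 ya yd2; lra.
  - move=> k x x0 xa; apply: le_trans (ler_normD _ _) (lerD (MP k x x0 xa) _).
    have := LP 0 x (lexx 0) x0 xa; rewrite trajectory0 subr0 /= => h.
    have := seminorm_sub (seminorm_functional rho1) f (u x) => /= h2.
    by apply: le_trans h2 _; rewrite lerD2l; apply: le_trans h _; rewrite ler_wpM2l.
  - move=> x x0 xa; have [w Zw] := trajectory_domain x0.
    have -> : g ^~ x = fun k => psi k w + rho1 (u x).
      apply/funext => k; rewrite /g; congr (_ + _); symmetry.
      exact: (adjoint_derivativeE F_eq F_dense (adj k) (Z_approx Zw)).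
    rewrite -(Z0 _ _ Zw) [_ + rho2 w]addrC; apply: cvgD; first exact: psirho.
    exact: cvg_cst.
have Gcvg2 : (fun k => G k a - G k 0) @ \oo --> (rho1 (v a) + rho2 (u a - f) : R).
  have -> : (fun k => G k a - G k 0) = fun k => psi k (u a - f) + rho1 (v a).
    apply/funext => k; rewrite /G v0 !raddf0 addr0 subr0; congr (_ + _).
    by rewrite (trajectory_adjoint (adj k) a0).
  by rewrite [rho1 _ + _]addrC; apply: cvgD; [exact: psirho|exact: cvg_cst].
exact: (cvg_unique _ Gcvg2 Gcvg).
Qed.

End Trajectory.

Theorem integrated_trajectory : exists u v : R -> V,
  [/\ uniformly_continuous Q u, u 0 = f, v 0 = 0, primitive Q v u &
      forall a, 0 <= a -> Z (v a) (u a - f)].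
Proof.
have [d [u [di uP]]] := weak_trajectory.
have uc := trajectory_continuous di uP.
have [v v0 vu] := primitive_exists uc.
exists u, v; split=> //; first exact: (trajectory0 uP).
by move=> a; exact: (trajectory_integral di uP v0 vu).
Qed.

End WeakTrajectories.

Lemma seminorm_distl (R : realType) (V : lmodType R) (q : V -> R) : seminorm q ->
  forall y x z, q (x - z) <= q (y - x) + q (y - z).
Proof. by move=> sq y x z; rewrite (seminormC sq y x); exact: seminorm_dist. Qed.

(** * Equicontinuous semigroups *)

Section Semigroups.
Context {R : realType} {V : lmodType R} (Q : gauges V).
Implicit Types (q : V -> R).

Record equicontinuous_semigroup (T : R -> V -> V) : Prop := {
  semigroup_linear : forall a, linear (T a);
  semigroup0 : forall x, T 0 x = x;
  semigroupD : forall a b x, 0 <= a -> 0 <= b -> T (a + b) x = T a (T b x);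
  semigroup_bound : forall q S, Q q -> exists2 q', Q q' &
    forall a x, 0 <= a -> a <= S -> q (T a x) <= q' x;
  semigroup_cont : forall x q e, Q q -> 0 < e -> exists2 d, 0 < d &
    forall s, 0 <= s -> s <= d -> q (T s x - x) <= e
}.

Definition generates (T : R -> V -> V) x y := forall q e, Q q -> 0 < e ->
  \forall h \near 0^'+, q (h^-1 *: (T h x - x) - y) <= e.

End Semigroups.

(** * The limit of the powers as a semigroup *)

Section Construction.
Context {R : realType} {V : lmodType R} (Q : gauges V) (F : R -> {linear V -> V}).
Implicit Types (q : V -> R).

Context (F_eq : locally_equicontinuous Q F) (F_dense : densely_differentiable Q F).

Lemma evolveB h a x y : evolve F h a (x - y) = evolve F h a x - evolve F h a y.
Proof. exact: linearB. Qed.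

Lemma evolveZ h a c x : evolve F h a (c *: x) = c *: evolve F h a x.
Proof. exact: linearZZ. Qed.

(** The limit is along all steps [h], unlike the subsequence of [t / n] that produces a trajectory.
    It therefore depends on [F], [a] and [x] alone. *)
Definition evolves_to a x l := forall q e, Q q -> 0 < e ->
  \forall h \near 0^'+, q (evolve F h a x - l) <= e.

Lemma evolves_to_uniq a x l l' : evolves_to a x l -> evolves_to a x l' -> l = l'.
Proof.
move=> xl xl'; apply/eqP; rewrite -subr_eq0; apply/eqP.
apply: (@gauge_eq0 _ _ Q) => q e Qq e0; have sq := gauge_seminorm Qq.
have e2 : 0 < e / 2 by lra.
near (0 : R)^'+ => h.
have k1 : q (evolve F h a x - l) <= e / 2 by near: h; exact: xl.
have k2 : q (evolve F h a x - l') <= e / 2 by near: h; exact: xl'.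
by have := seminorm_distl sq (evolve F h a x) l l'; lra.
Unshelve. all: by end_near. Qed.

Lemma evolves_to_linear a c x x' l l' : evolves_to a x l -> evolves_to a x' l' ->
  evolves_to a (c *: x + x') (c *: l + l').
Proof.
move=> xl xl' q e Qq e0; have sq := gauge_seminorm Qq.
have e2 : 0 < e / 2 by lra.
have c0 : 0 < `|c| + 1 by have := normr_ge0 c; lra.
have e3 : 0 < e / 2 / (`|c| + 1) by rewrite divr_gt0.
near=> h.
have k1 : q (evolve F h a x - l) <= e / 2 / (`|c| + 1) by near: h; exact: xl.
have k2 : q (evolve F h a x' - l') <= e / 2 by near: h; exact: xl'.
rewrite /evolve linearP -/(evolve F h a x) -/(evolve F h a x').
have -> : c *: evolve F h a x + evolve F h a x' - (c *: l + l') =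
  c *: (evolve F h a x - l) + (evolve F h a x' - l') by module_eq V.
apply: le_trans (seminormD sq _ _) _; rewrite (seminormZ sq).
rewrite ler_pdivlMr // in k1.
have := seminorm_ge0 sq (evolve F h a x - l); lra.
Unshelve. all: by end_near. Qed.

Lemma evolves_to_map (g : {linear V -> V}) a x l :
  (forall h y, g (F h y) = F h (g y)) ->
  (forall q, Q q -> exists2 q', Q q' & forall x, q (g x) <= q' x) ->
  evolves_to a x l -> evolves_to a (g x) (g l).
Proof.
move=> gF gQ xl q e Qq e0; have [q' Qq' qq'] := gQ q Qq.
near=> h.
have -> : evolve F h a (g x) = g (evolve F h a x).
  by rewrite /evolve /power; elim: Num.truncn => //= m ->; rewrite gF.
by rewrite -linearB; apply: le_trans (qq' _) _; near: h; exact: xl.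
Unshelve. all: by end_near. Qed.

Lemma evolve_bound q S : Q q -> exists2 q', Q q' & forall h a x, 0 < h ->
  0 <= a -> a <= S -> q (evolve F h a x) <= q' x.
Proof.
move=> Qq; have [q' Qq' qq'] := F_eq S Qq; exists q' => // h a x h0 a0 aS.
apply: qq'; first exact: ltW.
by have [k _] := truncn_divP h0 a0; exact: le_trans aS.
Qed.

(** Completeness concerns sequences, so the limit is first taken along the steps [1 / n]. It is the
    limit along all [h], because for small [h] the evolutions stay close to a common vector [y]. *)
Lemma evolves_to_approx a x : 0 <= a ->
  (forall q e, Q q -> 0 < e -> exists f l, evolves_to a f l /\ q (x - f) <= e) ->
  exists l, evolves_to a x l.
Proof.
move=> a0 xf.
have close q e : Q q -> 0 < e -> exists l, \forall h \near 0^'+, q (evolve F h a x - l) <= e.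
  move=> Qq e0; have sq := gauge_seminorm Qq; have e2 : 0 < e / 2 by lra.
  have [q' Qq' qq'] := evolve_bound a Qq; have [f [l [fl fx]]] := xf q' _ Qq' e2.
  exists l; near=> h; have h0 : 0 < h by near: h; exact: nbhs_right_gt.
  have k1 : q (evolve F h a f - l) <= e / 2 by near: h; exact: fl.
  have k2 := qq' h a (x - f) h0 a0 (lexx a).
  rewrite evolveB in k2.
  by have := seminorm_dist sq (evolve F h a f) (evolve F h a x) l; lra.
have [l lP] : exists l, limit_for Q (fun n => evolve F (1 / n%:R) a x) l.
  apply: gauge_complete => q Qq e e0; have sq := gauge_seminorm Qq.
  have e2 : 0 < e / 2 by lra.
  have [y yP] := close q _ Qq e2.
  have [N _ NP] := near_step ltr01 yP; exists N => m n Nm Nn.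
  have k1 := NP m Nm; have k2 := NP n Nn; rewrite /= in k1 k2.
  apply: le_trans (seminorm_dist sq y _ _) _; rewrite (seminormC sq y); lra.
exists l => q e Qq e0; have sq := gauge_seminorm Qq; have e3 : 0 < e / 3 by lra.
have [y yP] := close q _ Qq e3.
near \oo => n.
have k1 : q (evolve F (1 / n%:R) a x - l) <= e / 3 by near: n; exact: lP.
have k2 : q (evolve F (1 / n%:R) a x - y) <= e / 3.
  by near: n; exact: (near_step ltr01 yP).
near=> h.
have k3 : q (evolve F h a x - y) <= e / 3 by near: h.
have := seminorm_dist sq y (evolve F h a x) l.
by have := seminorm_distl sq (evolve F (1 / n%:R) a x) y l; lra.
Unshelve. all: by end_near. Qed.

Context (Z : V -> V -> Prop) (Z_linear : linear_relation Z)
  (Z_closed : closed_relation Q Z)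
  (Z_approx : forall x y, Z x y -> approx_derivative Q F x y).

Definition integrated_solution f (u v : R -> V) :=
  [/\ uniformly_continuous Q u, u 0 = f, v 0 = 0, primitive Q v u &
      forall a, 0 <= a -> Z (v a) (u a - f)].

(* For fixed s, [v (a + s) - v a] solves the homogeneous equation with initial
   value [v s], and [v s / s] is close to [f] for small s. *)
Lemma integrated_solution_limit f u v a : integrated_solution f u v -> 0 <= a ->
  evolves_to a f (u a).
Proof.
move=> [uc u0 v0 vu Zv] a0 q e Qq e0; have sq := gauge_seminorm Qq.
have [q' Qq' qq'] := evolve_bound a Qq; have sq' := gauge_seminorm Qq'.
have e4 : 0 < e / 4 by lra.
have [d1 d10 d1P] := vu q Qq (a + 1) _ e4.
have [d2 d20 d2P] := vu q' Qq' (a + 1) _ e4.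
pose s := Num.min 1 (Num.min d1 d2).
have s0 : 0 < s by rewrite !lt_min ltr01 d10.
have [s1 sd1 sd2] : [/\ s <= 1, s <= d1 & s <= d2].
  by split; rewrite !ge_min lexx ?orbT.
pose w r := v (r + s) - v r; pose y r := u (r + s) - u r.
have wp : primitive Q w y by exact: (primitiveB (primitive_shift (ltW s0) vu) vu).
have yc : uniformly_continuous Q y.
  move=> p Qp S c c0; have sp := gauge_seminorm Qp; have c2 : 0 < c / 2 by lra.
  have [b b0 bP] := uc p Qp (S + s) _ c2; exists b => // r r' r0 rS r'0 r'S rr'.
  have -> : y r - y r' = (u (r + s) - u (r' + s)) - (u r - u r').
    by rewrite /y; module_eq V.
  apply: le_trans (seminormB sp _ _) _.
  have k1 : p (u (r + s) - u (r' + s)) <= c / 2.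
    apply: bP; try lra.
    by have -> : r + s - (r' + s) = r - r' by ring.
  by have := bP r r' r0 _ r'0 _ rr'; lra.
have wy r : 0 <= r -> approx_derivative Q F (w r) (y r).
  move=> r0; apply: Z_approx; have rs : 0 <= r + s by lra.
  have := Z_linear.2 (-1) _ _ _ _ (Zv r r0) (Zv (r + s) rs).
  have -> : -1 *: v r + v (r + s) = w r by rewrite /w; module_eq V.
  by have -> : -1 *: (u r - f) + (u (r + s) - f) = y r by rewrite /y; module_eq V.
have es : 0 < e / 4 * s by rewrite mulr_gt0.
near=> h; have h0 : 0 < h by near: h; exact: nbhs_right_gt.
have k1 : q (power (F h) (Num.truncn (a / h)) (w 0) - w a) <= e / 4 * s.
  by near: h; exact: (chernoff_solution F_eq F_dense wy wp yc Qq a0 es).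
have w0 : w 0 = v s by rewrite /w add0r v0 subr0.
rewrite w0 -/(evolve F h a (v s)) in k1.
have k2 : q' (v s - s *: f) <= e / 4 * s.
  have := d2P 0 s (lexx 0) (ltW s0); rewrite v0 u0 !subr0; apply; lra.
have k3 : q (v (a + s) - v a - s *: u a) <= e / 4 * s.
  have as_ : a + s - a = s by ring.
  have := d1P a (a + s) a0; rewrite as_; apply; lra.
have k4 := qq' h a (v s - s *: f) h0 a0 (lexx a).
(* Each of the three terms is at most [e / 4 * s], so [s] can be cancelled: it is fixed before [h],
   and the tolerance of the convergence for [w] may depend on it. *)
have E : s *: (evolve F h a f - u a) =
   (evolve F h a (v s) - w a) - evolve F h a (v s - s *: f)
   + (v (a + s) - v a - s *: u a).
  by rewrite evolveB evolveZ /w; module_eq V.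
rewrite -(ler_pM2l s0) -[s in leLHS]gtr0_norm // -(seminormZ sq) E.
apply: le_trans (seminormD sq _ _) _.
by have := seminormB sq (evolve F h a (v s) - w a) (evolve F h a (v s - s *: f)); lra.
Unshelve. all: by end_near. Qed.

Context (A : V -> Prop)
  (A_dense : forall x q e, Q q -> 0 < e -> exists f, A f /\ q (x - f) <= e)
  (A_solution : forall f, A f -> exists u v, integrated_solution f u v).

Theorem evolution_limit : exists T : R -> V -> V, forall a x, evolves_to a x (T a x).
Proof.
have : forall ax : R * V, exists l, evolves_to ax.1 ax.2 l.
  move=> [a x] /=; have [a0|a0] := leP 0 a.
    apply: evolves_to_approx => // q e Qq e0; have [f [Af fx]] := A_dense x Qq e0.
    have [u [v uv]] := A_solution Af; exists f, (u a); split=> //.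
    exact: integrated_solution_limit uv a0.
  (* At negative times truncation leaves no step, so the limit is [x] and [T] is defined for all
     real times. *)
  exists x => q e Qq e0; near=> h; have h0 : 0 < h by near: h; exact: nbhs_right_gt.
  have ah : a / h < 0 by rewrite pmulr_llt0 // invr_gt0.
  have -> : evolve F h a x = x.
    by rewrite /evolve (_ : Num.truncn _ = 0%N) //; apply/truncn0Pn; rewrite -ltNge; lra.
  by rewrite subrr (seminorm0 (gauge_seminorm Qq)) ltW.
move=> /choice[T TP]; exists (fun a x => T (a, x)) => a x; exact: (TP (a, x)).
Unshelve. all: by end_near. Qed.

Context (T : R -> V -> V) (T_lim : forall a x, evolves_to a x (T a x)).

Lemma limit_linear a : linear (T a).
Proof.
by move=> c x y; apply: (evolves_to_uniq (T_lim _ _)); exact: evolves_to_linear.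
Qed.

Lemma limit_bound q S : Q q -> exists2 q', Q q' &
  forall a x, 0 <= a -> a <= S -> q (T a x) <= q' x.
Proof.
move=> Qq; have [q' Qq' qq'] := evolve_bound S Qq; exists q' => // a x a0 aS.
have sq := gauge_seminorm Qq; apply/ler_addgt0Pl => e e0.
near (0 : R)^'+ => h; have h0 : 0 < h by near: h; exact: nbhs_right_gt.
have k1 : q (evolve F h a x - T a x) <= e by near: h; exact: T_lim.
have := qq' h a x h0 a0 aS; have := seminorm_sub sq (evolve F h a x) (T a x).
by rewrite (seminormC sq (T a x)); lra.
Unshelve. all: by end_near. Qed.

Lemma limit_small_time x q e : Q q -> 0 < e -> exists2 d, 0 < d &
  forall s, 0 <= s -> s <= d -> q (T s x - x) <= e.
Proof.
move=> Qq e0; have sq := gauge_seminorm Qq; have e2 : 0 < e / 2 by lra.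
near (0 : R)^'+ => d; exists d; first by near: d; exact: nbhs_right_gt.
have dP : \forall h \near 0^'+, forall j, j%:R * h <= d -> q (power (F h) j x - x) <= e / 2.
  by near: d; exact: (power_small_time F_eq F_dense x Qq e2).
move=> s s0 sd; near (0 : R)^'+ => h.
have h0 : 0 < h by near: h; exact: nbhs_right_gt.
have k1 : q (evolve F h s x - T s x) <= e / 2 by near: h; exact: T_lim.
have k2 : forall j, j%:R * h <= d -> q (power (F h) j x - x) <= e / 2 by near: h.
have [m1 m2] := truncn_divP h0 s0; have {}k2 := k2 _ (le_trans m1 sd).
rewrite -/(evolve F h s x) in k2.
by have := seminorm_distl sq (evolve F h s x) (T s x) x; lra.
Unshelve. all: by end_near. Qed.

Lemma limit0 x : T 0 x = x.
Proof.
apply: (evolves_to_uniq (T_lim 0 x)) => q e Qq e0; near=> h.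
by rewrite /evolve mul0r truncn0 power0 subrr (seminorm0 (gauge_seminorm Qq)) ltW.
Unshelve. all: by end_near. Qed.

Lemma limitD a b x : 0 <= a -> 0 <= b -> T (a + b) x = T a (T b x).
Proof.
move=> a0 b0; apply/esym/(evolves_to_uniq (T_lim a (T b x))) => q e Qq e0.
have sq := gauge_seminorm Qq; have e3 : 0 < e / 3 by lra.
have [q' Qq' qq'] := F_eq (a + b) Qq; have sq' := gauge_seminorm Qq'.
near (0 : R)^'+ => d; have d0 : 0 < d by near: d; exact: nbhs_right_gt.
have dP : \forall h \near 0^'+, forall j, j%:R * h <= d -> q' (power (F h) j x - x) <= e / 3.
  by near: d; exact: (power_small_time F_eq F_dense x Qq' e3).
near=> h; have h0 : 0 < h by near: h; exact: nbhs_right_gt.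
(* Rounding [a], [b] and [a + b] separately loses at most [2 * h] of total time, a gap bridged by
   powers that hardly move [x]. *)
have hd : h < d / 2 by near: h; apply: nbhs_right_lt; lra.
have k1 : q (evolve F h (a + b) x - T (a + b) x) <= e / 3 by near: h; exact: T_lim.
have k2 : q' (evolve F h b x - T b x) <= e / 3 by near: h; exact: T_lim.
have k3 : forall j, j%:R * h <= d -> q' (power (F h) j x - x) <= e / 3 by near: h.
have [a1 a2] := truncn_divP h0 a0; have [b1 b2] := truncn_divP h0 b0.
have ab0 := addr_ge0 a0 b0; have [c1 c2] := truncn_divP h0 ab0.
have k4 : q (evolve F h a (evolve F h b x) - evolve F h (a + b) x) <= e / 3.
  rewrite /evolve -powerD.
  have mnk : (Num.truncn (a / h) + Num.truncn (b / h) <= Num.truncn ((a + b) / h))%N.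
    rewrite truncn_ge_nat ?divr_ge0 ?(ltW h0) //.
    by rewrite ler_pdivlMr // natrD mulrDl lerD.
  move: (Num.truncn (a / h)) (Num.truncn (b / h)) (Num.truncn ((a + b) / h)) mnk a1 a2 b1 b2 c1 c2.
  move=> m n k mnk a1 a2 b1 b2 c1 c2.
  have mnE : (m + n)%:R = m%:R + n%:R :> R by rewrite natrD.
  rewrite (seminormC sq) -(subnKC mnk) powerD -linearB.
  have mnh : (m + n)%:R * h <= a + b by rewrite mnE; lra.
  apply: le_trans (qq' _ _ _ (ltW h0) mnh) _; apply: k3.
  by rewrite natrB // mnE; lra.
have k5 : q (evolve F h a (evolve F h b x) - evolve F h a (T b x)) <= e / 3.
  rewrite -evolveB; apply: le_trans k2; apply: qq'; first exact: ltW.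
  by lra.
have := seminorm_distl sq (evolve F h a (evolve F h b x)) (evolve F h a (T b x)) (T (a + b) x).
have := seminorm_dist sq (evolve F h (a + b) x) (evolve F h a (evolve F h b x)) (T (a + b) x).
lra.
Unshelve. all: by end_near. Qed.

Lemma limit_semigroup : equicontinuous_semigroup Q T.
Proof.
split; [exact: limit_linear|exact: limit0|exact: limitD|exact: limit_bound|].
exact: limit_small_time.
Qed.

(** In [power_approx] the step [h] tends to 0 at a fixed time [s], with a tolerance proportional to
    [s] because the increment is divided by [s]. *)
Lemma limit_differentiable x y : approx_derivative Q F x y -> generates Q T x y.
Proof.
move=> xy q e Qq e0; have sq := gauge_seminorm Qq; have e4 : 0 < e / 4 by lra.
near (0 : R)^'+ => d; have d0 : 0 < d by near: d; exact: nbhs_right_gt.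
have dP : \forall h \near 0^'+, forall j, j%:R * h <= d -> q (power (F h) j y - y) <= e / 4.
  by near: d; exact: (power_small_time F_eq F_dense y Qq e4).
near=> s; have s0 : 0 < s by near: s; exact: nbhs_right_gt.
have sd : s < d by near: s; exact: nbhs_right_lt.
have es : 0 < e / 4 * s by rewrite mulr_gt0.
have Y1 : 0 < q y + 1 by have := seminorm_ge0 sq y; lra.
near (0 : R)^'+ => h; have h0 : 0 < h by near: h; exact: nbhs_right_gt.
have k1 : q (evolve F h s x - T s x) <= e / 4 * s by near: h; exact: T_lim.
have k2 : forall j, j%:R * h <= d -> q (power (F h) j y - y) <= e / 4 by near: h.
have k3 : forall m, m%:R * h <= d ->
   q (power (F h) m x - x - h *: \sum_(0 <= j < m) power (F h) j y) <= e / 4 * s.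
  by near: h; exact: (power_approx F_eq d xy Qq es).
have hq : h < e / 4 * s / (q y + 1) by near: h; apply: nbhs_right_lt; rewrite divr_gt0.
rewrite ltr_pdivlMr // in hq.
have [m1 m2] := truncn_divP h0 (ltW s0).
have {}k3 := k3 _ (le_trans m1 (ltW sd)); rewrite -/(evolve F h s x) in k3.
move: (Num.truncn _) m1 m2 k3 => m m1 m2 k3.
have k4 : q (\sum_(0 <= j < m) (power (F h) j y - y)) <= (m%:R - 0%:R) * (e / 4).
  apply: seminorm_sum_nat => // j /andP[_ jm]; apply: k2.
  apply: (le_trans _ (le_trans m1 (ltW sd))).
  by rewrite ler_pM2r // ler_nat ltnW.
have sZ w : s * q w = q (s *: w) by rewrite (seminormZ sq) gtr0_norm.
rewrite -(ler_pM2l s0) sZ.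
have -> : s *: (s^-1 *: (T s x - x) - y) =
  (evolve F h s x - x - h *: \sum_(0 <= j < m) power (F h) j y) - (evolve F h s x - T s x)
  + (h *: (\sum_(0 <= j < m) (power (F h) j y - y)) - (s - m%:R * h) *: y).
  rewrite sumrB sumr_const_nat subn0 -[y *+ m]scaler_nat scalerBr scalerA divff ?lt0r_neq0 //.
  by module_eq V.
apply: le_trans (seminormD sq _ _) _.
apply: le_trans (lerD (seminormB sq _ _) (seminormB sq _ _)) _.
rewrite !(seminormZ sq) (gtr0_norm h0) (@ger0_norm _ (s - _)); last by lra.
have k5 : h * q (\sum_(0 <= j < m) (power (F h) j y - y)) <= e / 4 * s.
  apply: le_trans (ler_wpM2l (ltW h0) k4) _.
  have := ler_wpM2l (ltW e4) m1; lra.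
have k6 : (s - m%:R * h) * q y <= h * q y.
  by rewrite ler_wpM2r ?(seminorm_ge0 sq) //; lra.
lra.
Unshelve. all: by end_near. Qed.

(** That the generator is not larger than [Z] is shown by means over [[0, a]]: for [f] in [A] the
    vector [a^-1 *: v a] lies in the domain of [Z] with value [a^-1 *: (T a f - f)]. This pair
    approximates [(x, y)] when [f] is chosen after [a], at a distance of order [a] from [x], and [Z]
    is closed. *)
Theorem limit_generates x y : generates Q T x y <-> Z x y.
Proof.
split=> [gxy|Zxy]; last exact/limit_differentiable/Z_approx.
apply: Z_closed => q e Qq e0; have sq := gauge_seminorm Qq.
have e2 : 0 < e / 2 by lra.
have [q' Qq' qq'] := limit_bound 1 Qq; have sq' := gauge_seminorm Qq'.
have [d d0 dP] := limit_small_time x Qq e2.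
near (0 : R)^'+ => a; have a0 : 0 < a by near: a; exact: nbhs_right_gt.
have a1 : a < 1 by near: a; exact: nbhs_right_lt.
have ad : a < d by near: a; exact: nbhs_right_lt.
have k1 : q (a^-1 *: (T a x - x) - y) <= e / 2 by near: a; exact: gxy.
have Qs := gaugeD Qq Qq'.
have ea : 0 < e / 2 * a by rewrite mulr_gt0.
have [f [Af fx]] := A_dense x Qs ea.
have [u [v uv]] := A_solution Af; have [uc u0 v0 vu Zv] := uv.
have uT r : 0 <= r -> u r = T r f.
  by move=> r0; exact: (evolves_to_uniq (integrated_solution_limit uv r0) (T_lim r f)).
have TB r z : T r (x - z) = T r x - T r z.
  by rewrite [x - z]addrC -[- z]scaleN1r limit_linear scaleN1r addrC.
have q0 z := seminorm_ge0 sq z; have q'0 z := seminorm_ge0 sq' z.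
exists (a^-1 *: v a), (a^-1 *: (u a - f)); split.
- have := Z_linear.2 a^-1 _ _ _ _ (Zv a (ltW a0)) Z_linear.1.
  by rewrite !addr0.
- have -> : x - a^-1 *: v a = - (a^-1 *: (v a - v 0 - (a - 0) *: x)).
    rewrite v0 !subr0 scalerBr scalerA mulVf ?lt0r_neq0 //; module_eq V.
  rewrite (seminormN sq) (seminormZ sq) gtr0_norm ?invr_gt0 // ler_pdivrMl //.
  have := @primitive_bound _ _ _ v u q 0 a x e vu Qq (lexx 0) (ltW a0).
  rewrite subr0 mulrC; apply => r r0 ra.
  have r1 : r <= 1 by lra.
  have := qq' r (x - f) r0 r1; rewrite TB -uT // => k2.
  have k3 := dP r r0 (le_trans ra (ltW ad)).
  have := seminorm_distl sq (T r x) (u r) x.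
  have : e / 2 * a <= e / 2 by rewrite ger_pMr; lra.
  by have := q0 (x - f); lra.
- have -> : y - a^-1 *: (u a - f) = - (a^-1 *: (T a x - x) - y)
      + a^-1 *: (T a (x - f) - (x - f)).
    by rewrite TB uT ?(ltW a0) //; module_eq V.
  apply: le_trans (seminormD sq _ _) _.
  rewrite (seminormN sq) (seminormZ sq) gtr0_norm ?invr_gt0 //.
  have : a^-1 * q (T a (x - f) - (x - f)) <= e / 2.
    rewrite ler_pdivrMl // mulrC; apply: le_trans (seminormB sq _ _) _.
    have := qq' a (x - f) (ltW a0) (ltW a1); lra.
  lra.
Unshelve. all: by end_near. Qed.

End Construction.

Lemma linear_endomorphism (R : realType) (V : lmodType R) (f : V -> V) : linear f ->
  exists g : {linear V -> V}, forall x, g x = f x.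
Proof.
by move=> fl; exists (HB.pack_for {linear V -> V} f (GRing.isLinear.Build R V V *:%R f fl)).
Qed.

(** * Orbits and integrals of an equicontinuous semigroup *)

Section SemigroupTheory.
Context {R : realType} {V : lmodType R} (Q : gauges V).
Implicit Types (q : V -> R).
Context (T : R -> V -> V) (T_semi : equicontinuous_semigroup Q T).

Lemma semigroupB a x y : T a (x - y) = T a x - T a y.
Proof.
by rewrite [x - y]addrC -[- y]scaleN1r (semigroup_linear T_semi) scaleN1r addrC.
Qed.

Lemma semigroupZ a c x : T a (c *: x) = c *: T a x.
Proof.
have T0 : T a 0 = 0 by have := semigroupB a 0 0; rewrite !subrr.
by have := semigroup_linear T_semi a c x 0; rewrite T0 !addr0.
Qed.

Lemma semigroup_uniform x : uniformly_continuous Q (fun r => T r x).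
Proof.
move=> q Qq S e e0; have sq := gauge_seminorm Qq.
have [q' Qq' qq'] := semigroup_bound T_semi S Qq.
have [d d0 dP] := semigroup_cont T_semi x Qq' e0.
have key r s : 0 <= r -> r <= s -> s <= S -> s - r <= d -> q (T s x - T r x) <= e.
  move=> r0 rs sS srd; have sr0 : 0 <= s - r by lra.
  have -> : T s x = T r (T (s - r) x) by rewrite -(semigroupD T_semi) // addrC subrK.
  rewrite -semigroupB; apply: le_trans (qq' _ _ r0 (le_trans rs sS)) _; exact: dP.
exists d => // r s r0 rS s0 sS; have [rs|/ltW sr] := leP r s.
  by rewrite (seminormC sq) distrC ger0_norm ?subr_ge0 // => ?; exact: key.
by rewrite ger0_norm ?subr_ge0 // => ?; exact: key.
Qed.

Lemma generates_orbit x z r : generates Q T x z -> 0 <= r ->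
  generates Q T (T r x) (T r z).
Proof.
move=> gx r0 q e Qq e0; have [q' Qq' qq'] := semigroup_bound T_semi r Qq.
near=> h; have h0 : 0 < h by near: h; exact: nbhs_right_gt.
have -> : T h (T r x) = T r (T h x).
  by rewrite -!(semigroupD T_semi) ?(ltW h0) // addrC.
rewrite -semigroupB -semigroupZ -semigroupB; apply: le_trans (qq' _ _ r0 (lexx r)) _.
by near: h; exact: gx.
Unshelve. all: by end_near. Qed.

(** The difference quotient at time [a] is [T a] applied to the one at time 0; equicontinuity makes
    the convergence uniform on bounded intervals. *)
Lemma generates_primitive x z : generates Q T x z ->
  primitive Q (fun r => T r x) (fun r => T r z).
Proof.
move=> gx q Qq S e e0; have sq := gauge_seminorm Qq.
have [q' Qq' qq'] := semigroup_bound T_semi S Qq; have sq' := gauge_seminorm Qq'.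
have := gx q' e Qq' e0; move=> /nbhs_ballP[d /= d0 dP].
exists (d / 2) => [|a b a0 ab bS bad]; first by lra.
have [<-|nab] := eqVneq a b.
  by rewrite !subrr scale0r subrr seminorm0 // mulr0.
have ba : 0 < b - a by rewrite subr_gt0 lt_neqAle nab.
have k : q' ((b - a)^-1 *: (T (b - a) x - x) - z) <= e.
  by apply: dP => //; rewrite /ball /= sub0r normrN gtr0_norm; lra.
have -> : T b x = T a (T (b - a) x).
  by rewrite -(semigroupD T_semi) ?(ltW ba) // addrC subrK.
rewrite -semigroupB -semigroupZ -semigroupB.
apply: le_trans (qq' _ _ a0 (le_trans ab bS)) _.
rewrite mulrC -ler_pdivrMl //; apply: le_trans k.
rewrite -[X in X * _]gtr0_norm ?invr_gt0 // -(seminormZ sq').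
apply: ler_of_eq; congr q'.
by rewrite scalerBr scalerA mulVf ?scale1r // lt0r_neq0.
Qed.

Section Comparison.
Context (F : R -> {linear V -> V}) (F_eq : locally_equicontinuous Q F)
  (F_dense : densely_differentiable Q F).
Context (T_approx : forall x y, generates Q T x y -> approx_derivative Q F x y)
  (T_dense : forall x q e, Q q -> 0 < e ->
     exists f g, generates Q T f g /\ q (x - f) <= e).

(** Orbits that start in the domain of the generator are classical solutions, so [chernoff_solution]
    applies to them; density and the equicontinuity of both families give the other orbits. *)
Lemma evolves_to_semigroup a x : 0 <= a -> evolves_to Q F a x (T a x).
Proof.
move=> a0 q e Qq e0; have sq := gauge_seminorm Qq; have e3 : 0 < e / 3 by lra.
have [q1 Qq1 qq1] := evolve_bound F_eq a Qq.
have [q2 Qq2 qq2] := semigroup_bound T_semi a Qq.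
have [f [g [fg fx]]] := T_dense x (gaugeD Qq1 Qq2) e3.
have fa r : 0 <= r -> approx_derivative Q F (T r f) (T r g).
  by move=> r0; apply: T_approx; exact: generates_orbit.
near=> h; have h0 : 0 < h by near: h; exact: nbhs_right_gt.
have k1 : q (power (F h) (Num.truncn (a / h)) (T 0 f) - T a f) <= e / 3.
  near: h; exact: (chernoff_solution F_eq F_dense fa (generates_primitive fg)
    (semigroup_uniform g) Qq a0 e3).
rewrite (semigroup0 T_semi) -/(evolve F h a f) in k1.
have k2 := qq1 h a (x - f) h0 a0 (lexx a); rewrite evolveB in k2.
have k3 := qq2 a (x - f) a0 (lexx a); rewrite semigroupB in k3.
have p1 := gauge_ge0 (x - f) Qq1; have p2 := gauge_ge0 (x - f) Qq2.
have := seminorm_dist sq (evolve F h a f) (evolve F h a x) (T a x).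
have := seminorm_dist sq (T a f) (evolve F h a f) (T a x).
by rewrite (seminormC sq (T a f)); lra.
Unshelve. all: by end_near. Qed.

End Comparison.

Lemma semigroup_integral : exists S : R -> V -> V,
  forall x, S 0 x = 0 /\ primitive Q (fun a => S a x) (fun a => T a x).
Proof.
have : forall x, exists v : R -> V, v 0 = 0 /\ primitive Q v (fun a => T a x).
  by move=> x; have [v v0 vx] := primitive_exists (semigroup_uniform x); exists v.
by move=> /choice[S SP]; exists (fun a x => S x a).
Qed.

Context (S : R -> V -> V).
Context (S_int : forall x, S 0 x = 0 /\ primitive Q (fun a => S a x) (fun a => T a x)).

Lemma integral_eq a x v : 0 <= a -> v 0 = 0 -> primitive Q v (fun r => T r x) -> v a = S a x.
Proof.
move=> a0 v0 vT; have [S0 ST] := S_int x.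
by have := primitive_uniq vT ST (lexx 0) a0; rewrite v0 S0 !subr0.
Qed.

(** Both sides are primitives of [T r (g x)] that vanish at 0. *)
Lemma integral_map (g : {linear V -> V}) a x : 0 <= a ->
  (forall r y, 0 <= r -> g (T r y) = T r (g y)) ->
  (forall q, Q q -> exists2 q', Q q' & forall y, q (g y) <= q' y) ->
  g (S a x) = S a (g x).
Proof.
move=> a0 gT gQ; have [S0 ST] := S_int x.
apply: (@integral_eq a (g x) (fun r => g (S r x)) a0); first by rewrite S0 raddf0.
have := primitive_comp gQ ST => gp q Qq r e e0; have [d d0 dP] := gp q Qq r e e0.
by exists d => // b c b0 bc cr cb; rewrite -gT //; exact: dP.
Qed.

Lemma integralB a x y : 0 <= a -> S a (x - y) = S a x - S a y.
Proof.
move=> a0; apply/esym/(@integral_eq a (x - y) (fun r => S r x - S r y) a0).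
  by rewrite !(S_int _).1 subrr.
have := primitiveB (S_int x).2 (S_int y).2 => p q Qq r e e0.
have [d d0 dP] := p q Qq r e e0; exists d => // b c b0 bc cr cb.
by rewrite semigroupB; exact: dP.
Qed.

Lemma semigroup_continuous r : 0 <= r -> forall q, Q q ->
  exists2 q', Q q' & forall x, q (T r x) <= q' x.
Proof.
move=> r0 q Qq; have [q' Qq' qq'] := semigroup_bound T_semi r Qq.
by exists q' => // x; exact: qq'.
Qed.

Lemma semigroup_comm r s x : 0 <= r -> 0 <= s -> T r (T s x) = T s (T r x).
Proof. by move=> r0 s0; rewrite -!(semigroupD T_semi) // addrC. Qed.

Lemma integral_comm h a x : 0 <= h -> 0 <= a -> T h (S a x) = S a (T h x).
Proof.
move=> h0 a0; have [g gT] := linear_endomorphism (semigroup_linear T_semi h).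
rewrite -!gT; apply: integral_map => //.
  by move=> r y r0; rewrite !gT semigroup_comm.
by move=> q Qq; have [q' Qq' qq'] := semigroup_continuous h0 Qq; exists q' => // y; rewrite gT.
Qed.

Lemma integral_scale c a x : 0 <= a -> S a (c *: x) = c *: S a x.
Proof.
move=> a0; have [g gE] : exists g : {linear V -> V}, forall y, g y = c *: y.
  by apply: linear_endomorphism => b y w; rewrite scalerDr !scalerA mulrC.
rewrite -!gE; apply/esym/integral_map => // [r y r0|q Qq].
  by rewrite !gE semigroupZ.
exists (fun y => `|c| * q y); first exact: gaugeZ.
by move=> y; rewrite gE (seminormZ (gauge_seminorm Qq)).
Qed.

Lemma integral_bound q b : Q q -> exists2 q', Q q' &
  forall a x, 0 <= a -> a <= b -> q (S a x) <= a * q' x.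
Proof.
move=> Qq; have [q' Qq' qq'] := semigroup_bound T_semi b Qq; exists q' => // a x a0 ab.
have [S0 ST] := S_int x.
have := @primitive_bound _ _ _ _ _ q 0 a 0 (q' x) ST Qq (lexx 0) a0.
rewrite S0 scaler0 !subr0 mulrC; apply => r r0 ra; rewrite subr0.
by apply: qq' => //; exact: le_trans ab.
Qed.

Lemma integral_near q a x c : Q q -> 0 <= a ->
  (forall r, 0 <= r -> r <= a -> q (T r x - x) <= c) -> q (S a x - a *: x) <= a * c.
Proof.
move=> Qq a0 h; have [S0 ST] := S_int x.
by have := primitive_bound ST Qq (lexx 0) a0 h; rewrite S0 !subr0 mulrC.
Qed.

(* Both sides are the integral of T from h to a + h minus that from 0 to a. *)
Lemma integral_shift h a x : 0 <= h -> 0 <= a ->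
  T h (S a x) - S a x = T a (S h x) - S h x.
Proof.
move=> h0 a0.
have add b c : 0 <= b -> 0 <= c -> S (c + b) x - S b x = T b (S c x).
  move=> b0 c0; rewrite integral_comm //.
  apply: (@integral_eq c (T b x) (fun r => S (r + b) x - S b x)) => //.
    by rewrite add0r subrr.
  move=> q Qq s e e0; have [d d0 dP] := primitive_shift b0 (S_int x).2 Qq s e0.
  exists d => // r r' r0 rr' rs rd.
  have -> : S (r' + b) x - S b x - (S (r + b) x - S b x) = S (r' + b) x - S (r + b) x.
    by module_eq V.
  by rewrite -(semigroupD T_semi) //; exact: dP.
by rewrite -(add h a) // -(add a h) // [h + a]addrC; module_eq V.
Qed.

(** By [integral_shift] the difference quotient at [S a y], with [y = S a x], is [T a - 1] applied
    to the mean of [T] over [[0, h]] at [y]. Since [T r y - y] is in turn [T a - 1] applied to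
    [S r x], it is of order [r]. The rate [h * q' x] is thus explicit in [x], hence uniform on
    bounded sets. *)
Lemma integral_regularizes q a : Q q -> 0 <= a -> exists2 q', Q q' &
  forall h x, 0 < h -> h <= 1 ->
    q (h^-1 *: (T h (S a (S a x)) - S a (S a x)) - (T a (S a x) - S a x)) <= h * q' x.
Proof.
move=> Qq a0; have sq := gauge_seminorm Qq.
have [q1 Qq1 qq1] := semigroup_continuous a0 Qq.
have Q2 := gaugeD Qq1 Qq; have s2 := gauge_seminorm Q2.
have [q3 Qq3 qq3] := semigroup_continuous a0 Q2.
have [q4 Qq4 qq4] := integral_bound 1 (gaugeD Qq3 Q2).
exists q4 => // h x h0 h1; set y := S a x.
have k1 r : 0 <= r -> r <= h -> q1 (T r y - y) + q (T r y - y) <= h * q4 x.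
  move=> r0 rh; rewrite /y integral_shift //.
  apply: le_trans (seminormB s2 _ _) _ => /=.
  have := qq3 (S r x); have := qq4 r x r0 (le_trans rh h1).
  have := ler_wpM2r (gauge_ge0 x Qq4) rh; lra.
have k2 := integral_near Q2 (ltW h0) k1.
have -> : h^-1 *: (T h (S a y) - S a y) - (T a y - y) =
    T a (h^-1 *: (S h y - h *: y)) - h^-1 *: (S h y - h *: y).
  rewrite integral_shift // ?(ltW h0) // !semigroupZ !semigroupB semigroupZ.
  rewrite !scalerBr !scalerA mulVf ?lt0r_neq0 //; module_eq V.
apply: le_trans (seminormB sq _ _) _.
apply: le_trans (lerD (qq1 _) (lexx _)) _.
have := seminormZ s2 h^-1 (S h y - h *: y) => /= ->.
by rewrite gtr0_norm ?invr_gt0 // ler_pdivrMl.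
Qed.

(** With [M x = a^-1 *: S a x], the difference [M (M x) - x] is [M (M x - x) + (M x - x)]; the means
    [M] are equicontinuous for [a <= 1], so both terms are small once [M x] is close to [x]. *)
Lemma integral_regularization_limit x q e : Q q -> 0 < e ->
  \forall a \near 0^'+, q (a^-1 *: (a^-1 *: S a (S a x)) - x) <= e.
Proof.
move=> Qq e0; have sq := gauge_seminorm Qq; have e2 : 0 < e / 2 by lra.
have [q' Qq' qq'] := integral_bound 1 Qq; have sq' := gauge_seminorm Qq'.
have [d d0 dP] := semigroup_cont T_semi x (gaugeD Qq Qq') e2.
near=> a; have a0 : 0 < a by near: a; exact: nbhs_right_gt.
have a1 : a < 1 by near: a; exact: nbhs_right_lt.
have ad : a < d by near: a; exact: nbhs_right_lt.
have k : q (S a x - a *: x) + q' (S a x - a *: x) <= a * (e / 2).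
  apply: (integral_near (gaugeD Qq Qq') (ltW a0)) => r r0 ra; apply: dP => //; lra.
have -> : a^-1 *: (a^-1 *: S a (S a x)) - x =
  a^-1 *: (a^-1 *: S a (S a x - a *: x)) + a^-1 *: (S a x - a *: x).
  rewrite integralB ?(ltW a0) // integral_scale ?(ltW a0) //.
  by module_eq V; field; rewrite lt0r_neq0.
apply: le_trans (seminormD sq _ _) _; rewrite !(seminormZ sq) gtr0_norm ?invr_gt0 //.
have k2 := qq' a (S a x - a *: x) (ltW a0) (ltW a1).
have k3 : a^-1 * q (S a (S a x - a *: x)) <= q' (S a x - a *: x).
  by rewrite ler_pdivrMl.
rewrite -mulrDr ler_pdivrMl //; have := gauge_ge0 (S a x - a *: x) Qq'.
have : a * (e / 2) <= a * e by rewrite ler_pM2l //; lra.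
lra.
Unshelve. all: by end_near. Qed.

End SemigroupTheory.

(** * Real structure of a locally convex space *)

Section Scalars.
Context {R : realType} {k : scalar_kind}.
Local Notation K := (scalar_field R k).

Definition real_part : K -> R :=
  match k return scalar_field R k -> R with
  | RealScalars => id
  | ComplexScalars => @complex.Re R
  end.

Definition modulus (z : K) : R := real_part `|z|.

Lemma of_realD (a b : R) : of_real k (a + b) = of_real k a + of_real k b.
Proof. by rewrite /of_real; case: k => //; exact: rmorphD. Qed.

Lemma of_realM (a b : R) : of_real k (a * b) = of_real k a * of_real k b.
Proof. by rewrite /of_real; case: k => //; exact: rmorphM. Qed.

Lemma of_real1 : of_real k (1 : R) = 1.
Proof. by rewrite /of_real; case: k. Qed.

Lemma of_real0 : of_real k (0 : R) = 0.
Proof. by rewrite /of_real; case: k. Qed.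

Lemma of_realV (a : R) : of_real k a^-1 = (of_real k a)^-1.
Proof. by rewrite /of_real; case: k => //; exact: fmorphV. Qed.

Lemma real_partK (a : R) : real_part (of_real k a) = a.
Proof. by rewrite /real_part /of_real; case: k. Qed.

Lemma real_partD (z w : K) : real_part (z + w) = real_part z + real_part w.
Proof. by move: z w; rewrite /real_part; case: k => // -[? ?] [? ?]. Qed.

Lemma real_partZ (a : R) (z : K) : real_part (of_real k a * z) = a * real_part z.
Proof.
by move: z; rewrite /real_part /of_real; case: k => // -[x y] /=; rewrite mul0r subr0.
Qed.

Lemma le_of_real (a b : R) : (of_real k a <= of_real k b) = (a <= b).
Proof. by rewrite /of_real; case: k => //; exact: lecR. Qed.

Lemma lt_of_real (a b : R) : (of_real k a < of_real k b) = (a < b).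
Proof. by rewrite /of_real; case: k => //; exact: ltcR. Qed.

Lemma of_real_ge0 (z : K) : 0 <= z -> of_real k (real_part z) = z.
Proof.
move: z; rewrite /real_part /of_real; case: k => // -[x y] /=.
by rewrite lecE /= => /andP[/eqP -> _].
Qed.

Lemma modulusE (z : K) : of_real k (modulus z) = `|z|.
Proof. exact: of_real_ge0. Qed.

Lemma le_modulus (z : K) (a : R) : (`|z| <= of_real k a) = (modulus z <= a).
Proof. by rewrite -modulusE le_of_real. Qed.

Lemma modulus_ge0 (z : K) : 0 <= modulus z.
Proof. by rewrite -le_of_real modulusE of_real0. Qed.

Lemma modulusM (z w : K) : modulus (z * w) = modulus z * modulus w.
Proof.
by apply: (can_inj real_partK); rewrite of_realM !modulusE normrM.
Qed.

Lemma modulusD (z w : K) : modulus (z + w) <= modulus z + modulus w.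
Proof. by rewrite -le_of_real of_realD !modulusE ler_normD. Qed.

Lemma modulus_of_real (a : R) : modulus (of_real k a) = `|a|.
Proof.
apply: (can_inj real_partK); rewrite modulusE.
have [a0|a0] := leP 0 a.
  by rewrite !ger0_norm // -of_real0 le_of_real.
rewrite !ltr0_norm -?of_real0 ?lt_of_real //.
by apply/eqP; rewrite eq_sym -addr_eq0 -of_realD addNr of_real0.
Qed.

Lemma real_part_le (z : K) : `|real_part z| <= modulus z.
Proof.
rewrite -le_of_real modulusE; move: z; rewrite /real_part /of_real; case: k => //= z.
exact: normc_ge_Re.
Qed.

Lemma gt0_of_real (e : K) : 0 < e -> exists2 r : R, 0 < r & e = of_real k r.
Proof.
move=> e0; exists (real_part e); last by rewrite of_real_ge0 // ltW.
by rewrite -lt_of_real of_real0 of_real_ge0 // ltW.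
Qed.

End Scalars.

(** An alias, so that the module structures over the scalar field and over [R] coexist on
    convertible elements. *)
Definition realify (R : realType) (k : scalar_kind) (X : lmodType (scalar_field R k)) :
  Type := X.

Section Realify.
Context (R : realType) (k : scalar_kind) (X : lmodType (scalar_field R k)).

HB.instance Definition _ := GRing.Zmodule.copy (realify X) X.

Definition real_scale (a : R) (x : realify X) : realify X := of_real k a *: (x : X).

Lemma real_scaleA a b x : real_scale a (real_scale b x) = real_scale (a * b) x.
Proof. by rewrite /real_scale scalerA of_realM. Qed.
Lemma real_scale1 : left_id 1 real_scale.
Proof. by move=> x; rewrite /real_scale of_real1 scale1r. Qed.
Lemma real_scaleDr : right_distributive real_scale +%R.
Proof. by move=> a x y; exact: scalerDr. Qed.
Lemma real_scaleDl x : {morph real_scale^~ x : a b / a + b}.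
Proof. by move=> a b; rewrite /real_scale of_realD scalerDl. Qed.

HB.instance Definition _ := GRing.Zmodule_isLmodule.Build R (realify X)
  real_scaleA real_scale1 real_scaleDr real_scaleDl.

End Realify.

Section Gauges.
Context (R : realType) (k : scalar_kind).
Local Notation K := (scalar_field R k).
Context (X : tvsType K) (Omega : Type) (p : Omega -> X -> K).
Context (p_seminorm : forall al, is_seminorm (p al)) (p_topology : generate_topology p).
Local Notation V := (realify X).

Definition real_seminorm (al : Omega) (x : V) : R := real_part (p al x).
Local Notation pr := real_seminorm.

Lemma real_seminormE al x : of_real k (pr al x) = p al x.
Proof. by apply: of_real_ge0; have [] := p_seminorm al. Qed.

Lemma real_seminorm_scale al (c : K) (x : X) : pr al (c *: x) = modulus c * pr al x.
Proof.
apply: (can_inj (@real_partK R k)); rewrite of_realM modulusE !real_seminormE.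
by have [_ _] := p_seminorm al; apply.
Qed.

Lemma real_seminormP al : seminorm (pr al : V -> R).
Proof.
split=> [x y|a x]; last by rewrite -(@modulus_of_real R k); exact: real_seminorm_scale.
by rewrite -(@le_of_real R k) of_realD !real_seminormE; have [_ + _] := p_seminorm al; apply.
Qed.

Definition sum_seminorm (s : seq Omega) (x : V) : R := \sum_(al <- s) pr al x.

Lemma sum_seminormP s : seminorm (sum_seminorm s : V -> R).
Proof.
split=> [x y|a x].
  by rewrite /sum_seminorm -big_split; apply: ler_sum => al _; exact: (real_seminormP al).1.
rewrite /sum_seminorm mulr_sumr; apply: eq_bigr => al _; exact: (real_seminormP al).2.
Qed.

Lemma sum_seminorm_scale s (c : K) (x : X) :
  sum_seminorm s (c *: x) = modulus c * sum_seminorm s x.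
Proof.
by rewrite /sum_seminorm mulr_sumr; apply: eq_bigr => al _; exact: real_seminorm_scale.
Qed.

Definition continuous_seminorm (q : V -> R) := seminorm q /\
  exists s (c : R), 0 <= c /\ forall x, q x <= c * sum_seminorm s x.
Local Notation Q := continuous_seminorm.

Lemma sum_seminorm_continuous s : Q (sum_seminorm s).
Proof. by split; [exact: sum_seminormP|exists s, 1; split=> // x; rewrite mul1r]. Qed.

Lemma continuous_seminormD q1 q2 : Q q1 -> Q q2 -> Q (fun x => q1 x + q2 x).
Proof.
move=> [sq1 [s1 [c1 [c10 h1]]]] [sq2 [s2 [c2 [c20 h2]]]].
split; first exact: seminorm_add.
exists (s1 ++ s2), (c1 + c2); split; first exact: addr_ge0.
move=> x; rewrite /sum_seminorm big_cat /=.
have := h1 x; have := h2 x; have := seminorm_ge0 (sum_seminormP s1) x.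
have := seminorm_ge0 (sum_seminormP s2) x; rewrite /sum_seminorm.
by move: (\sum_(_ <- _) _) (\sum_(_ <- _) _) => a b a0 b0; nra.
Qed.

Lemma continuous_seminorm_le q c q' : seminorm q -> Q q' ->
  (forall x, q x <= c * q' x) -> Q q.
Proof.
move=> sq [sq' [s [c' [c'0 h]]]] le; split=> //.
exists s, (`|c| * c'); split; first by rewrite mulr_ge0.
move=> x; apply: le_trans (le x) _; rewrite -mulrA.
apply: (@le_trans _ _ (`|c| * q' x)).
  by rewrite ler_wpM2r ?(seminorm_ge0 sq') // ler_norm.
by rewrite ler_wpM2l.
Qed.

Lemma nbhs0_seminorm (A : set X) : nbhs 0 A <->
  exists s (e : R), 0 < e /\ forall x, sum_seminorm s x < e -> A x.
Proof.
rewrite p_topology; split=> [[n [a [e [e0 eA]]]]|[s [e [e0 eA]]]].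
  have [r r0 er] := gt0_of_real e0.
  exists [seq a i | i <- enum 'I_n], r; split=> // x xr; apply: eA => i.
  rewrite -real_seminormE er lt_of_real; apply: le_lt_trans xr.
  rewrite /sum_seminorm big_map big_enum /= (bigD1 i) //= lerDl.
  by apply: sumr_ge0 => j _; exact: seminorm_ge0 (real_seminormP _) _.
exists (size s), (tnth (in_tuple s)), (of_real k (e / ((size s)%:R + 1))).
have s1 : 0 < (size s)%:R + 1 :> R by have := ler0n R (size s); lra.
split; first by rewrite -(@of_real0 R k) lt_of_real divr_gt0.
move=> x xs; apply: eA; rewrite /sum_seminorm big_tnth.
apply: (@le_lt_trans _ _ (\sum_(i < size s) (e / ((size s)%:R + 1)))).
  apply: ler_sum => i _; apply/ltW; rewrite -(@lt_of_real R k) real_seminormE.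
  exact: xs.
rewrite sumr_const card_ord -[X in X < _]mulr_natl mulrCA gtr_pMr //.
by rewrite ltr_pdivrMr; lra.
Qed.

Lemma continuous_seminorm_near (q : V -> R) : seminorm q ->
  nbhs 0 [set x : X | q x < 1] -> Q q.
Proof.
move=> sq /nbhs0_seminorm[s [e [e0 eq1]]]; split=> //.
exists s, e^-1; split=> [|x]; first by rewrite invr_ge0 ltW.
apply/ler_addgt0Pl => c c0.
have S0 := seminorm_ge0 (sum_seminormP s) x.
pose r := e^-1 * sum_seminorm s x + c.
have r0 : 0 < r by rewrite /r ltr_wpDl // mulr_ge0 // invr_ge0 ltW.
have : q (r^-1 *: x) < 1.
  apply: eq1; rewrite (seminormZ (sum_seminormP s)) gtr0_norm ?invr_gt0 //.
  rewrite ltr_pdivrMl // /r mulrDl mulrAC mulVf ?lt0r_neq0 // mul1r.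
  by rewrite ltrDl mulr_gt0.
rewrite (seminormZ sq) gtr0_norm ?invr_gt0 // ltr_pdivrMl // mulr1 => /ltW.
by rewrite /r addrC.
Qed.

Lemma continuous_seminorm_nbhs0 (q : V -> R) e : Q q -> 0 < e ->
  nbhs 0 [set x : X | q x < e].
Proof.
move=> [sq [s [c [c0 h]]]] e0; apply/nbhs0_seminorm.
have c1 : 0 < c + 1 by lra.
exists s, (e / (c + 1)); split; first by rewrite divr_gt0.
move=> x; rewrite ltr_pdivlMr // => xs /=; apply: le_lt_trans (h x) _.
by have := seminorm_ge0 (sum_seminormP s) x; nra.
Qed.

Lemma nbhs_seminorm (x : X) (A : set X) : nbhs x A <->
  exists s (e : R), 0 < e /\ forall y, sum_seminorm s (y - x) < e -> A y.
Proof.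
split=> [xA|[s [e [e0 eA]]]].
  have : nbhs 0 [set y : X | A (x + y)].
    have := nbhsB (- x) xA; rewrite addNr; apply: filterS => _ [z Az <-] /=.
    by rewrite addrA subrr add0r.
  move=> /nbhs0_seminorm[s [e [e0 eA]]]; exists s, e; split=> // y /eA /=.
  by rewrite addrC subrK.
have : nbhs 0 [set y : X | sum_seminorm s y < e].
  exact: continuous_seminorm_nbhs0 (sum_seminorm_continuous s) e0.
move=> /(nbhsT x); apply: filterS => _ [y ye <-]; apply: eA.
by rewrite addrC addKr.
Qed.

Lemma cvg_seminorm (I : Type) (F : set_system I) (FF : Filter F) (f : I -> X) (x : X) :
  f @ F --> x <-> forall q, Q q -> forall e, 0 < e -> \forall i \near F, q (f i - x) <= e.
Proof.
split=> [fx q Qq e e0|h A /nbhs_seminorm[s [e [e0 eA]]]].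
  have : nbhs x [set y | q (y - x) < e].
    have [sq [s [c [c0 hq]]]] := Qq; apply/nbhs_seminorm.
    have c1 : 0 < c + 1 by lra.
    exists s, (e / (c + 1)); split; first by rewrite divr_gt0.
    move=> y; rewrite ltr_pdivlMr // => ys /=; apply: le_lt_trans (hq _) _.
    by have := seminorm_ge0 (sum_seminormP s) (y - x); nra.
  move=> /fx; rewrite /= nbhs_simpl => fq.
  by refine (@filterS I F FF _ _ _ fq) => i /= /ltW.
have e2 : 0 < e / 2 by lra.
have := h _ (sum_seminorm_continuous s) _ e2; apply: filterS => i hi.
by apply: eA; apply: le_lt_trans hi _; lra.
Qed.

Context (X_hausdorff : hausdorff_space X) (X_complete : complete_tvs X).

Lemma continuous_seminorm_sep (x : V) : (forall q, Q q -> q x = 0) -> x = 0.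
Proof.
move=> x0; suff /X_hausdorff : cluster (nbhs (x : X)) (0 : X) by [].
move=> A B /nbhs_seminorm[s [e [e0 eA]]] B0.
exists 0; split; last exact: (nbhs_singleton B0).
apply: eA; rewrite sub0r.
have := seminormN (sum_seminormP s) x; rewrite (x0 _ (sum_seminorm_continuous s)).
by move=> E; rewrite [sum_seminorm _ _]E.
Qed.

Lemma continuous_seminorm_complete (u : nat -> V) : cauchy_for Q u ->
  exists x, limit_for Q u x.
Proof.
move=> uc; have [|x ux] := X_complete (_ : ProperFilter (u @ \oo)).
  move=> U /nbhs0_seminorm[s [e [e0 eU]]]; have e2 : 0 < e / 2 by lra.
  have [N NP] := uc _ (sum_seminorm_continuous s) _ e2.
  exists (u @` [set n | (N <= n)%N]).
    by exists N => // n /= Nn; exists n.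
  move=> _ _ [m Nm <-] [n Nn <-]; apply: eU; apply: le_lt_trans (NP m n Nm Nn) _; lra.
exists x => q Qq e e0.
by move: ux => /(cvg_seminorm _ (u : nat -> X)) h; exact: h.
Qed.

Definition space_gauges : gauges V := Gauges (fun q => @proj1 _ _)
  continuous_seminormD continuous_seminorm_le continuous_seminorm_sep
  continuous_seminorm_complete.

End Gauges.

(** For complex scalars [f x = rho x - i rho (i x)], the complex-linear map with real part [rho].
    The last bound, with [c = i], passes continuity from [rho] to [f]. *)
Lemma complexify_functional (R : realType) (k : scalar_kind)
    (X : lmodType (scalar_field R k)) (rho : {scalar (realify X)}) :
  exists (f : X -> (scalar_field R k)^o) (c : scalar_field R k),
    [/\ linear f, forall x, real_part (f x) = rho x &
        forall x, modulus (f x) <= `|rho x : R| + `|rho (c *: x) : R|].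
Proof.
case: k X rho => X rho.
  exists (fun x => rho x), 1; split=> // [a x y|x]; first exact: linearP.
  by rewrite scale1r lerDl.
pose f (x : X) : R[i] := (rho x +i* - rho ('i%C *: x))%C.
have rC (a : R) x : rho (a%:C%C *: x : X) = a * rho x :> R by exact: scalar_linearZ.
have dec (c : R[i]) (x : X) : c *: x =
    (complex.Re c)%:C%C *: x + (complex.Im c)%:C%C *: ('i%C *: x).
  rewrite scalerA -scalerDl; congr (_ *: _); case: c => a b; simpc => //=.
have ii (x : X) : 'i%C *: ('i%C *: x) = - x.
  by rewrite scalerA -expr2 sqr_i scaleN1r.
exists f, 'i%C; split=> // [c x y|x].
  have E1 : rho (c *: x + y) = complex.Re c * rho x + complex.Im c * rho ('i%C *: x) + rho y :> R.
    by rewrite [c *: x]dec !raddfD /= !rC.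
  have E2 : rho ('i%C *: (c *: x + y)) =
      complex.Re c * rho ('i%C *: x) - complex.Im c * rho x + rho ('i%C *: y) :> R.
    rewrite scalerDr scalerA mulrC -scalerA [c *: _]dec ii !raddfD /= !rC.
    by rewrite raddfN /= mulrN.
  rewrite /f E1 E2 /GRing.scale /=; case: (c) => a b /=; simpc.
  by congr (_ +i* _)%C; ring.
rewrite -(@le_of_real R ComplexScalars) modulusE of_realD -!(@modulus_of_real R ComplexScalars) !modulusE.
have -> : f x = of_real ComplexScalars (rho x) + 'i%C * of_real ComplexScalars (- rho ('i%C *: x)).
  by rewrite /f /of_real /=; simpc.
have i1 : `|'i%C| = 1 :> R[i].
  by rewrite normc_def /= expr0n /= expr1n add0r sqrtr1.
apply: le_trans (ler_normD _ _) _; rewrite lerD2l normrM i1 mul1r.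
by rewrite -!modulusE !modulus_of_real normrN.
Qed.

(** * Functionals, operators and closures in terms of real seminorms *)

Section Space.
Context (R : realType) (k : scalar_kind).
Local Notation K := (scalar_field R k).
Context (X : tvsType K) (Omega : Type) (p : Omega -> X -> K).
Context (p_seminorm : forall al, is_seminorm (p al)) (p_topology : generate_topology p).
Context (X_hausdorff : hausdorff_space X) (X_complete : complete_tvs X).
Local Notation V := (realify X).
Local Notation Q := (space_gauges p_seminorm p_topology X_hausdorff X_complete).

Lemma gauge_near (q : V -> R) : seminorm q -> nbhs 0 [set x : X | q x < 1] -> Q q.
Proof. exact: continuous_seminorm_near. Qed.

Lemma gauge_sum (s : seq Omega) : Q (sum_seminorm p s).
Proof. exact: sum_seminorm_continuous. Qed.

Lemma gauge_nbhs0 (q : V -> R) e : Q q -> 0 < e -> nbhs 0 [set x : X | q x < e].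
Proof. exact: (continuous_seminorm_nbhs0 p_seminorm p_topology). Qed.

Lemma gauge_nbhs (q : V -> R) x e : Q q -> 0 < e -> nbhs x [set y : X | q (y - x) < e].
Proof.
move=> Qq e0; have := nbhsT x (gauge_nbhs0 Qq e0).
by apply: filterS => _ [y ye <-] /=; rewrite addrC addKr.
Qed.

Lemma cvg_gauge (I : Type) (F : set_system I) (FF : Filter F) (f : I -> X) (x : X) :
  f @ F --> x <-> forall q, Q q -> forall e, 0 < e -> \forall i \near F, q (f i - x) <= e.
Proof. exact: cvg_seminorm. Qed.

Lemma linear_zero (W : lmodType K) (f : X -> W) : linear f -> f 0 = 0.
Proof.
by move=> lf; have := lf 1 0 0; rewrite !scale1r addr0 -[LHS]addr0 => /addrI.
Qed.

Lemma gauge_modulus (phi : dual X) : Q (fun x => modulus (phi x)).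
Proof.
have lp := lc_linear phi; have p0 := linear_zero lp.
apply: gauge_near.
  split=> [x y|a x].
    by have := lp 1 x y; rewrite !scale1r => ->; exact: modulusD.
  have := lp (of_real k a) x 0; rewrite p0 !addr0 => /= E.
  by rewrite -[a *: x]/(of_real k a *: (x : X)) E modulusM modulus_of_real.
have := @lc_continuous K X K^o phi (0 : X); rewrite /continuous_at p0 => /cvgr0Pnorm_lt/(_ 1 ltr01).
by apply: filterS => x /=; rewrite -modulusE -(@of_real1 R k) lt_of_real.
Qed.

Definition real_functional (phi : dual X) (x : V) : R^o := real_part (phi x).

Lemma real_functional_linear phi : linear (real_functional phi).
Proof.
move=> a x y; rewrite /real_functional -[a *: x]/(of_real k a *: (x : X)).
by rewrite (lc_linear phi) real_partD real_partZ.
Qed.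

HB.instance Definition _ phi := GRing.isLinear.Build R V R^o *%R
  (real_functional phi) (real_functional_linear phi).

Lemma real_functional_bounded phi : bounded_functional Q (real_functional phi).
Proof.
apply: (gauge_le (c := 1) _ (gauge_modulus phi)) => [|x].
  exact: seminorm_functional (real_functional phi : {scalar V}).
by rewrite mul1r; exact: real_part_le.
Qed.

Lemma dual_exists (f : X -> K^o) q : linear f -> Q q ->
  (forall x, modulus (f x) <= q x) -> exists phi : dual X, forall x, phi x = f x.
Proof.
move=> lf Qq fq; have fP : f \in @lc_pred K X K^o.
  apply/asboolP; split=> // x; apply/cvgrPdist_le => e /gt0_of_real[r r0 ->].
  have := gauge_nbhs x Qq r0; apply: filterS => y /= yr.
  have -> : f x - f y = f (x - y).
    by have := lf (-1) y x; rewrite !scaleN1r addrC => <-; rewrite addrC.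
  rewrite le_modulus; apply: le_trans (fq _) _.
  by rewrite (seminormC (gauge_seminorm Qq)) ltW.
by exists (LCFun fP).
Qed.

Lemma real_functional_exists (rho : {scalar V}) : bounded_functional Q rho ->
  exists phi : dual X, forall x, real_functional phi x = rho x.
Proof.
move=> [_ [s [c [c0 rs]]]]; have [f [b [lf fr fb]]] := complexify_functional rho.
have Qs := gauge_sum s.
have cb : 0 <= c + c * modulus b by rewrite addr_ge0 // mulr_ge0 // modulus_ge0.
have [|phi phif] := dual_exists lf (gaugeZ Qs cb).
  move=> x; apply: le_trans (fb x) _; rewrite mulrDl; apply: lerD; first exact: rs.
  by apply: le_trans (rs _) _; rewrite sum_seminorm_scale // mulrA.
by exists phi => x; rewrite /real_functional phif fr.
Qed.

Definition real_operator (G : 'L(X)) (x : V) : V := G x.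

Lemma real_operator_linear G : linear (real_operator G).
Proof. by move=> a x y; rewrite /real_operator -[a *: x]/(of_real k a *: (x : X)) (lc_linear G). Qed.

HB.instance Definition _ G := GRing.isLinear.Build R V V *:%R
  (real_operator G) (real_operator_linear G).

Lemma power_real_operator G m x : power (real_operator G) m x = lc_pow G m x.
Proof. by rewrite /power /lc_pow; elim: m => //= m ->. Qed.

Lemma lcfun_exists (f : X -> X) : linear f ->
  (forall q, Q q -> exists2 q', Q q' & forall x, q (f x) <= q' x) ->
  exists G : 'L(X), forall x, G x = f x.
Proof.
move=> lf fq; have fP : f \in @lc_pred K X X.
  apply/asboolP; split=> // x; apply/cvg_gauge => q Qq e e0.
  have [q' Qq' qq'] := fq q Qq; have := gauge_nbhs x Qq' e0.
  apply: filterS => y /= ye.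
  have -> : f y - f x = f (y - x).
    by have := lf (-1) x y; rewrite !scaleN1r addrC => <-; rewrite addrC.
  by apply: le_trans (qq' _) (ltW ye).
by exists (LCFun fP).
Qed.

Lemma dense_gauge (S : set X) : dense S -> forall x q e, Q q -> 0 < e ->
  exists y, S y /\ q (x - y) <= e.
Proof.
move=> dS x q e Qq e0.
have xA : (interior [set y : X | q (y - x) < e]) x by exact: gauge_nbhs.
have [y [yA Sy]] := dS _ (ex_intro _ x xA) (@open_interior _ _).
have /= ye := interior_subset yA.
by exists y; split=> //; rewrite (seminormC (gauge_seminorm Qq)) ltW.
Qed.

Lemma closure_gauge (Z : set (X * X)) x y : closure Z (x, y) <->
  forall q e, Q q -> 0 < e -> exists x' y', [/\ Z (x', y'), q (x - x') <= e & q (y - y') <= e].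
Proof.
split=> [cZ q e Qq e0|h B [[A1 A2] /= [A1x A2y] AB]].
  have sq := gauge_seminorm Qq.
  have [] := cZ ([set x' | q (x' - x) < e] `*` [set y' | q (y' - y) < e]).
    by exists ([set x' | q (x' - x) < e], [set y' | q (y' - y) < e]) => //=; split;
      exact: gauge_nbhs.
  move=> [x' y'] [Zxy [/= xe ye]]; exists x', y'.
  by rewrite (seminormC sq x) (seminormC sq y) !ltW.
move: A1x A2y => /(nbhs_seminorm p_seminorm p_topology)[s1 [e1 [e10 eA1]]].
move=> /(nbhs_seminorm p_seminorm p_topology)[s2 [e2 [e20 eA2]]].
have Q12 := gaugeD (gauge_sum s1) (gauge_sum s2).
pose e := Num.min e1 e2 / 2.
have m0 : 0 < Num.min e1 e2 by rewrite lt_min e10.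
have e0 : 0 < e by rewrite divr_gt0.
have [me1 me2] : Num.min e1 e2 <= e1 /\ Num.min e1 e2 <= e2 by rewrite !ge_min !lexx orbT.
have [x' [y' [Zxy xe ye]]] := h _ e Q12 e0.
have p1 := gauge_ge0 (x - x' : V) (gauge_sum s2); have p2 := gauge_ge0 (y - y' : V) (gauge_sum s1).
exists (x', y'); split=> //; apply: AB; split=> /=.
  apply: eA1; rewrite (seminormC (gauge_seminorm (gauge_sum s1))).
  by apply: (@le_lt_trans _ _ e); rewrite /e in xe *; lra.
apply: eA2; rewrite (seminormC (gauge_seminorm (gauge_sum s2))).
by apply: (@le_lt_trans _ _ e); rewrite /e in ye *; lra.
Qed.

Lemma weak_cvg_limit u x : weak_cvg u x -> weak_limit Q u x.
Proof.
move=> ux rho rb e e0; have [phi phir] := real_functional_exists rb.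
have e0' : 0 < of_real k e by rewrite -(@of_real0 R k) lt_of_real.
have := ux phi => /cvgrPdist_le/(_ _ e0'); apply: filterS => n /=.
rewrite le_modulus => h; rewrite -phir raddfB /= -normrN opprB -raddfB.
apply: le_trans h; apply: le_trans (real_part_le _) _.
apply: ler_of_eq; congr modulus.
by have := lc_linear phi (-1) (u n) x; rewrite !scaleN1r [- u n + x]addrC [- _ + phi x]addrC.
Qed.

Lemma subseq_weak_cvg_subsequential u : subseq_weak_cvg u -> weakly_subsequential Q u.
Proof.
by move=> us d di; have [l [x [li ux]]] := us d di; exists l, x; split=> //; exact: weak_cvg_limit.
Qed.

End Space.

Lemma real_partN (R : realType) (k : scalar_kind) (z : scalar_field R k) :
  real_part (- z) = - real_part z.
Proof.
by apply/eqP; rewrite -addr_eq0 -real_partD addNr -(@of_real0 R k) real_partK.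
Qed.

(** * The classes of functions and derivatives in terms of real seminorms *)

Section Conversion.
Context (R : realType) (k : scalar_kind).
Local Notation K := (scalar_field R k).
Context (X : tvsType K) (Omega : Type) (p : Omega -> X -> K).
Context (p_seminorm : forall al, is_seminorm (p al)) (p_topology : generate_topology p).
Context (X_hausdorff : hausdorff_space X) (X_complete : complete_tvs X).
Local Notation V := (realify X).
Local Notation Q := (space_gauges p_seminorm p_topology X_hausdorff X_complete).
Local Notation pr := (real_seminorm p).
Implicit Types (F T : R -> 'L(X)) (x y : X).

Local Notation operators F := (fun h => real_operator (F h) : {linear V -> V}).

Lemma equicontinuous_setP (B : set 'L(X)) : equicontinuous_set p B <->
  forall q, Q q -> exists2 q', Q q' & forall G, B G -> forall x, q (G x) <= q' x.
Proof.
split=> [eB q [sq [s [c [c0 qs]]]]|h al].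
  suff [q' Qq' sq'] : exists2 q', Q q' & forall G, B G -> forall x, sum_seminorm p s (G x) <= q' x.
    exists (fun x => c * q' x); first exact: gaugeZ.
    by move=> G BG x; apply: le_trans (qs _) _; rewrite ler_wpM2l // sq'.
  elim: s {qs} => [|al s [q' Qq' IH]].
    exists (sum_seminorm p [::]); first exact: gauge_sum.
    by move=> G _ x; rewrite /sum_seminorm !big_nil.
  have [n [a [b [b0 bP]]]] := eB al.
  pose c' := \sum_(i < n) modulus (b i).
  have c'0 : 0 <= c' by apply: sumr_ge0 => i _; exact: modulus_ge0.
  pose s' := [seq a i | i <- enum 'I_n].
  exists (fun x => c' * sum_seminorm p s' x + q' x).
    apply: gaugeD Qq'; exact: (gaugeZ (gauge_sum p_seminorm p_topology X_hausdorff X_complete s') c'0).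
  move=> G BG x; rewrite {1}/sum_seminorm big_cons; apply: lerD; last exact: IH.
  have /= := bP G BG x; rewrite -(real_seminormE p_seminorm).
  have -> : \sum_(i < n) b i * p (a i) x = of_real k (\sum_(i < n) modulus (b i) * pr (a i) x).
    elim/big_rec2: _ => [|i y z _ ->]; first by rewrite of_real0.
    rewrite of_realD of_realM real_seminormE // modulusE ger0_norm //; exact/ltW/b0.
  rewrite le_of_real => /le_trans; apply.
  rewrite mulr_suml; apply: ler_sum => i _; rewrite ler_wpM2l ?modulus_ge0 //.
  rewrite /sum_seminorm big_map big_enum /= (bigD1 i) //= lerDl.
  by apply: sumr_ge0 => j _; exact: (seminorm_ge0 (real_seminormP p_seminorm _)).
have Qal : Q (pr al).
  have := gauge_sum p_seminorm p_topology X_hausdorff X_complete [:: al].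
  by congr (gauge _ _); apply/funext => x; rewrite /sum_seminorm big_seq1.
have [q' [sq' [s [c [c0 qs]]]] h'] := h _ Qal.
exists (size s), (tnth (in_tuple s)), (fun=> of_real k (c + 1)).
split=> [i|G BG x]; first by rewrite -(@of_real0 R k) lt_of_real; lra.
have -> : \sum_(i < size s) of_real k (c + 1) * p (tnth (in_tuple s) i) x =
    of_real k ((c + 1) * sum_seminorm p s x).
  have -> : sum_seminorm p s x = \sum_(i < size s) pr (tnth (in_tuple s) i) x.
    by rewrite /sum_seminorm big_tnth.
  rewrite mulr_sumr.
  elim/big_rec2: _ => [|i y z _ ->]; first by rewrite of_real0.
  by rewrite [RHS]of_realD [in RHS]of_realM real_seminormE.
rewrite -(real_seminormE p_seminorm) le_of_real; apply: le_trans (h' G BG x) _.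
apply: le_trans (qs x) _; rewrite ler_wpM2r ?lerDl //.
exact: (seminorm_ge0 (sum_seminormP p_seminorm s)).
Qed.

Lemma E_class_equicontinuous F : E_class p F -> locally_equicontinuous Q (operators F).
Proof.
move=> [F0 FE] q S Qq; have [q' Qq' qq'] := (equicontinuous_setP _).1 (FE `|S| (normr_ge0 S)) q Qq.
(* [power_set] contains positive exponents only, so the summand [q x] accounts for the exponent 0;
   the step [h] is written as [h / 1]. *)
exists (fun x => q x + q' x); first exact: gaugeD.
move=> h [|j] x h0 jS; first by rewrite power0 lerDl; exact: (gauge_ge0 x Qq').
apply: (@le_trans _ _ (q' x)); last by rewrite lerDr; exact: (gauge_ge0 x Qq).
rewrite power_real_operator; apply: qq'; exists h, 1%N, j.+1; split=> //.
  by rewrite divr1; apply: le_trans jS (ler_norm S).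
by rewrite divr1.
Qed.

Lemma lcfunB (G H : 'L(X)) x : (G - H) x = G x - H x.
Proof. by []. Qed.

Lemma real_scaleE (h : R) (x : X) : (of_real k h)^-1 *: x = h^-1 *: (x : V).
Proof. by rewrite -of_realV. Qed.

Lemma mef_approx F x y : F 0 = lc_id X -> mef_derivative F (x, y) ->
  approx_derivative Q (operators F) x y.
Proof.
move=> F0 [u [/= ux uy]] q Qq e e0.
move: ux => /(cvg_gauge p_seminorm p_topology X_hausdorff X_complete)/(_ q Qq e e0) ux.
move: uy => /(cvg_gauge p_seminorm p_topology X_hausdorff X_complete)/(_ q Qq e e0) uy.
near=> h; exists (u h); split; first by near: h.
have : q ((of_real k h)^-1 *: (F h - F 0) (u h) - y) <= e by near: h.
by rewrite lcfunB F0 real_scaleE.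
Unshelve. all: by end_near. Qed.

Lemma strong_derivative_generates T x y : T 0 = lc_id X ->
  strong_derivative (E := X) T (x, y) <-> generates Q (fun h (x : V) => T h x) x y.
Proof.
move=> T0; rewrite /strong_derivative /= (cvg_gauge p_seminorm p_topology X_hausdorff X_complete).
split=> h q.
  move=> e Qq e0; have := h q Qq e e0; apply: filterS => s.
  by rewrite T0 real_scaleE.
move=> Qq e e0; have := h q e Qq e0; apply: filterS => s.
by rewrite T0 real_scaleE.
Qed.

Lemma bounded_subsetP (A : set X) : bounded_subset A <-> gauge_bounded Q A.
Proof.
split=> [bA q Qq|bA U].
  have [r /gt0_of_real[s s0 ->] sA] := bA _ (gauge_nbhs0 Qq ltr01); exists s => x Ax.
  have := sA (of_real k s); rewrite ger0_norm; last by rewrite -(@of_real0 R k) le_of_real ltW.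
  move=> /(_ (lexx _) x Ax) [z /= z1 <-].
  rewrite -[of_real k s *: z]/(s *: (z : V)) (seminormZ (gauge_seminorm Qq)) gtr0_norm //.
  by rewrite -[leRHS]mulr1 ler_pM2l // ltW.
move=> /(nbhs0_seminorm p_seminorm p_topology)[s [e [e0 eU]]].
have [c cA] := bA _ (gauge_sum p_seminorm p_topology X_hausdorff X_complete s).
pose r := (`|c| + 1) / e.
have c1 : 0 < `|c| + 1 by have := normr_ge0 c; lra.
have r0 : 0 < r by rewrite divr_gt0.
exists (of_real k r); first by rewrite -(@of_real0 R k) lt_of_real.
move=> b; rewrite -modulusE le_of_real => rb x Ax.
have b0 : 0 < modulus b by exact: lt_le_trans rb.
have bn : b != 0.
  by apply: contraTneq b0 => ->; rewrite -(@of_real0 R k) modulus_of_real normr0 ltxx.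
exists (b^-1 *: x); last by rewrite scalerA divff // scale1r.
apply: eU; rewrite (sum_seminorm_scale p_seminorm).
have -> : modulus b^-1 = (modulus b)^-1.
  apply: (mulfI (lt0r_neq0 b0)); rewrite -modulusM !divff ?(lt0r_neq0 b0) //.
  by rewrite -(@of_real1 R k) modulus_of_real normr1.
rewrite ltr_pdivrMl //; apply: le_lt_trans (cA x Ax) _.
apply: le_lt_trans (ler_norm c) _.
have : r * e <= modulus b * e by rewrite ler_pM2r.
by rewrite /r divfK ?lt0r_neq0 //; lra.
Qed.

(** The dual carries the initial topology of [dual_fun], so convergence transfers to the space of
    uniform convergence on bounded sets, where each bounded set is treated separately. *)
Lemma strong_cvgP (I : Type) (G : set_system I) (FG : Filter G) (g : I -> dual X) (eta : dual X) :
  g @ G --> eta <-> forall A, bounded_subset A -> forall e : R, 0 < e ->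
    \forall i \near G, forall x, A x -> modulus (g i x - eta x) <= e.
Proof.
have -> : (g @ G --> eta) <->
    ((@dual_fun K X \o g) @ G --> (dual_fun eta : {family @bounded_subset K X, X -> K^o})).
  split=> h.
    apply: (cvg_comp g (@dual_fun K X) h).
    exact: (@initial_continuous _ _ (@dual_fun K X) eta).
  move=> A /= [_ [[B oB <-] Be sBA]].
  apply: (@filterS _ G FG (g @^-1` ((@dual_fun K X) @^-1` B))); first by move=> i; exact: sBA.
  exact: (h B (open_nbhs_nbhs (conj oB Be))).
rewrite fam_cvgP; split=> [h A bA e e0|h A bA P /uniform_nbhs[E [eE EP]]].
  have e0' : 0 < of_real k e by rewrite -(@of_real0 R k) lt_of_real.
  pose P : set {uniform` A -> K^o} :=
    [set f | forall y, A y -> ball (eta y : K^o) (of_real k e) (f y)].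
  have PP : nbhs (dual_fun eta : {uniform` A -> K^o}) P.
    apply/uniform_nbhs; exists [set xy : K^o * K^o | ball xy.1 (of_real k e) xy.2].
    by split=> //; exact: (entourage_ball _ (PosNum e0')).
  have hP := h A bA P PP.
  refine (@filterS _ G FG _ _ _ hP) => i hi x Ax.
  have := hi x Ax; rewrite -ball_normE /= => /ltW.
  by rewrite distrC le_modulus.
have [e /= e0 eP] : exists2 e : K, 0 < e & [set xy : K^o * K^o | ball xy.1 e xy.2] `<=` E.
  by move: eE; rewrite -entourage_ballE => -[e e0 eE]; exists e.
have [r r0 er] := gt0_of_real e0; have r2 : 0 < r / 2 by lra.
refine (@filterS _ G FG _ _ _ (h A bA _ r2)) => i hi; apply: EP => x Ax; apply: eP => /=.
rewrite -ball_normE /= distrC; apply: (@le_lt_trans _ _ (of_real k (r / 2))).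
  by rewrite le_modulus; exact: hi.
by rewrite er lt_of_real; lra.
Qed.

Lemma adjoint_strong_derivative F (psi eta : dual X) : F 0 = lc_id X ->
  strong_derivative (E := dual X : preTopologicalLmodType K) (adjoint_family F) (psi, eta) <->
  forall A, gauge_bounded Q A -> forall e : R, 0 < e ->
    \forall h \near 0^'+, forall x, A x ->
      modulus ((of_real k h)^-1 * (psi (F h x) - psi x) - eta x) <= e.
Proof.
move=> F0; rewrite /strong_derivative /= strong_cvgP; split=> h A bA e e0.
  have := h A ((bounded_subsetP A).2 bA) e e0; apply: filterS => s hs x Ax.
  by have := hs x Ax; rewrite /adjoint_family F0.
have := h A ((bounded_subsetP A).1 bA) e e0; apply: filterS => s hs x Ax.
by have := hs x Ax; rewrite /adjoint_family F0.
Qed.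

Lemma strong_adjoint_derivative F (psi eta : dual X) : F 0 = lc_id X ->
  strong_derivative (E := dual X : preTopologicalLmodType K) (adjoint_family F) (psi, eta) ->
  adjoint_derivative Q (operators F) (real_functional psi) (real_functional eta).
Proof.
move=> F0 /(adjoint_strong_derivative _ _ F0) h.
split; [exact: real_functional_bounded|exact: real_functional_bounded|].
move=> A bA e e0; have := h A bA e e0; apply: filterS => s hs x Ax.
apply: le_trans (hs x Ax); apply: le_trans (real_part_le _); apply: ler_of_eq; congr `|_|.
by rewrite -of_realV real_partD real_partN real_partZ real_partD real_partN.
Qed.

Lemma semigroup_lC0 T : lC0_semigroup p T ->
  equicontinuous_semigroup Q (fun a (x : V) => T a x).
Proof.
move=> [Tc T0 TD [_ TE]]; split.
- by move=> a; exact: (real_operator_linear (T a)).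
- by move=> x; rewrite T0.
- by move=> a b x a0 b0; rewrite TD.
- move=> q S Qq; have [q' Qq' qq'] := (equicontinuous_setP _).1 (TE `|S| (normr_ge0 S)) q Qq.
  exists q' => // a x a0 aS; apply: qq'; exists a, 1%N, 1%N; split=> //.
    by rewrite divr1 mul1r; apply: le_trans aS (ler_norm S).
  by rewrite divr1 /lc_pow /=; apply: val_inj; apply: funext.
- move=> x q e Qq e0.
  have z0 : (`[0, +oo[%classic : set R) 0 by rewrite /= in_itv /= lexx.
  have := (subspace_continuousP _ _).1 Tc 0 z0.
  move=> /pointwise_cvgP/(_ x)/(cvg_gauge p_seminorm p_topology X_hausdorff X_complete).
  move=> /(_ q Qq e e0) /nbhs_ballP[d /= d0 dP].
  exists (d / 2) => [|s s0 sd]; first by lra.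
  have : q (T s x - T 0 x) <= e; last by rewrite T0.
  apply: dP; last by rewrite /= in_itv /= s0.
  by rewrite /ball /= sub0r normrN ger0_norm //; lra.
Qed.

Lemma lC0_of_semigroup (S : R -> V -> V) T : equicontinuous_semigroup Q S ->
  (forall a x, 0 <= a -> T a x = S a x) -> lC0_semigroup p T.
Proof.
move=> SS TS.
have Text (G H : 'L(X)) : (forall x, G x = H x) -> G = H.
  by move=> GH; apply: val_inj; apply: funext.
have T0 : T 0 = lc_id X by apply: Text => x; rewrite TS // (semigroup0 SS).
have TD l m : 0 <= l -> 0 <= m -> T (l + m) = lc_comp (T l) (T m).
  by move=> l0 m0; apply: Text => x; rewrite /= !TS ?addr_ge0 // (semigroupD SS).
split=> //.
- apply/subspace_continuousP => r /=; rewrite in_itv /= andbT => r0.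
  apply/pointwise_cvgP => x; apply/(cvg_gauge p_seminorm p_topology X_hausdorff X_complete).
  move=> q Qq e e0; have [d d0 dP] := semigroup_uniform SS x Qq (r + 1) e0.
  have m0 : 0 < Num.min d 1 by rewrite lt_min d0 ltr01.
  have : \forall s \near r, `|r - s| <= Num.min d 1.
    have /cvgrPdist_le := @cvg_id _ (nbhs r); exact.
  apply: filterS => s; rewrite le_min => /andP[sd s1] /=; rewrite in_itv /= andbT => s0.
  suff : q (S s x - S r x) <= e by rewrite -!TS.
  apply: dP => //; [|lra|by rewrite distrC].
  by move: s1; rewrite ler_norml => /andP[]; lra.
- split=> // s s0; apply/equicontinuous_setP => q Qq.
  have [q' Qq' qq'] := semigroup_bound SS s Qq; exists q' => //.
  move=> _ [d [n [m [d0 n0 m0 ms ->]]]] x.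
  have dn : 0 <= d / n%:R by rewrite divr_ge0.
  (* Powers of a semigroup are its values at the total time, so the bound on [[0, s]] covers all of
     [power_set]. *)
  have -> : lc_pow (T (d / n%:R)) m x = S (m%:R * (d / n%:R)) x.
    elim: (m) => [|j IH]; first by rewrite mul0r (semigroup0 SS).
    rewrite [LHS]/= IH TS // -(semigroupD SS) ?mulr_ge0 //; congr (S _ _).
    by rewrite -natr1; ring.
  by apply: qq'; rewrite ?mulr_ge0 // mulrA.
Qed.

End Conversion.

(** * Necessity and sufficiency of the conditions *)

Lemma rescaled_quotient (R : realType) (W : lmodType R) (b h : R) (u v w : W) :
  h^-1 *: (b^-1 *: (b^-1 *: u) - b^-1 *: (b^-1 *: v)) - b^-1 *: (b^-1 *: w) =
  (b * b)^-1 *: (h^-1 *: (u - v) - w).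
Proof.
have sq x : b^-1 *: (b^-1 *: x) = (b * b)^-1 *: x by rewrite scalerA -invfM.
by rewrite !sq -scalerBr scalerA mulrC -scalerA -scalerBr.
Qed.

Section MainResult.
Context (R : realType) (k : scalar_kind).
Local Notation K := (scalar_field R k).
Context (X : tvsType K) (Omega : Type) (p : Omega -> X -> K).
Context (p_seminorm : forall al, is_seminorm (p al)) (p_topology : generate_topology p).
Context (X_hausdorff : hausdorff_space X) (X_complete : complete_tvs X).
Local Notation V := (realify X).
Local Notation Q := (space_gauges p_seminorm p_topology X_hausdorff X_complete).
Local Notation operators F := (fun h => real_operator (F h) : {linear V -> V}).
Implicit Types (F T : R -> 'L(X)) (Z : set (X * X)).

Lemma gauge_scale (c : K) q : Q q -> exists2 q', Q q' & forall x : X, q (c *: x) <= q' x.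
Proof.
move=> [_ [s [b [b0 qs]]]]; exists (fun x => b * modulus c * sum_seminorm p s x).
  by apply: gaugeZ; [exact: gauge_sum|rewrite mulr_ge0 // modulus_ge0].
move=> x; apply: le_trans (qs _) _.
by rewrite (sum_seminorm_scale p_seminorm) mulrA.
Qed.

Lemma scalar_endomorphism (c : K) : exists g : {linear V -> V}, forall x : X, g x = c *: x.
Proof.
apply: linear_endomorphism => a x y.
rewrite -[a *: x]/(of_real k a *: (x : X)) scalerDr scalerA mulrC -scalerA //.
Qed.

Lemma linear_sub_scale (f : X -> X) : (forall x y, f (x - y) = f x - f y) ->
  (forall c x, f (c *: x) = c *: f x) -> linear f.
Proof.
move=> fB fZ c x y; rewrite -[y in LHS]opprK fB fZ -[- y]sub0r fB.
have -> : f 0 = 0 by have := fB 0 0; rewrite !subrr.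
by rewrite sub0r opprK.
Qed.

(** * The closure of [Z] as a linear relation *)

Section Closure.
Context (Z : set (X * X)) (Z_operator : linear_operator Z).

Lemma closure_subspace : is_subspace (closure Z).
Proof.
have [[Z0 ZL] _] := Z_operator; split; first exact: subset_closure.
move=> a [x y] [x' y'] /(closure_gauge p_seminorm p_topology X_hausdorff X_complete) c1.
move=> /(closure_gauge p_seminorm p_topology X_hausdorff X_complete) c2.
apply/(closure_gauge p_seminorm p_topology X_hausdorff X_complete) => q e Qq e0.
have sq := gauge_seminorm Qq; have e2 : 0 < e / 2 by lra.
have [q' Qq' qq'] := gauge_scale a Qq.
have [u [v [Zuv xu yv]]] := c1 q' _ Qq' e2.
have [u' [v' [Zuv' xu' yv']]] := c2 q _ Qq e2.
exists (a *: u + u'), (a *: v + v'); split; first exact: (ZL a _ _ Zuv Zuv').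
  rewrite opprD addrACA -scalerBr; apply: le_trans (seminormD sq _ _) _.
  by have := qq' (x - u); lra.
rewrite opprD addrACA -scalerBr; apply: le_trans (seminormD sq _ _) _.
by have := qq' (y - v); lra.
Qed.

Lemma closure_linear_relation : linear_relation (fun x y : V => closure Z (x, y)).
Proof.
have [Z0 ZL] := closure_subspace; split=> // a x y x' y' Zxy Zxy'.
exact: (ZL (of_real k a) _ _ Zxy Zxy').
Qed.

Lemma closure_closed_relation : closed_relation Q (fun x y : V => closure Z (x, y)).
Proof.
move=> x y h; apply/(closure_gauge p_seminorm p_topology X_hausdorff X_complete) => q e Qq e0.
have sq := gauge_seminorm Qq; have e2 : 0 < e / 2 by lra.
have [u [v [Zuv xu yv]]] := h q _ Qq e2.
move: Zuv => /(closure_gauge p_seminorm p_topology X_hausdorff X_complete)/(_ q _ Qq e2).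
move=> [u' [v' [Zuv' uu' vv']]]; exists u', v'; split=> //.
  by apply: le_trans (seminorm_dist sq u _ _) _; lra.
by apply: le_trans (seminorm_dist sq v _ _) _; lra.
Qed.

Lemma closure_approx F : (forall x y, Z (x, y) -> approx_derivative Q (operators F) x y) ->
  forall x y, closure Z (x, y) -> approx_derivative Q (operators F) x y.
Proof.
move=> Zapp x y cZ q Qq e e0; have sq := gauge_seminorm Qq; have e2 : 0 < e / 2 by lra.
move: cZ => /(closure_gauge p_seminorm p_topology X_hausdorff X_complete)/(_ q _ Qq e2).
move=> [u [v [Zuv xu yv]]]; near=> h.
have [x' [x1 x2]] : exists x', q (x' - u) <= e / 2 /\
    q (h^-1 *: (real_operator (F h) x' - x') - v) <= e / 2.
  by near: h; exact: (Zapp _ _ Zuv q Qq _ e2).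
exists x'; split.
  by have := seminorm_dist sq u x' x; rewrite (seminormC sq u x); lra.
have := seminorm_dist sq v (h^-1 *: (real_operator (F h) x' - x')) y.
by rewrite (seminormC sq v y); lra.
Unshelve. all: by end_near. Qed.

End Closure.

(** * Sufficiency of the conditions and convergence of the powers *)

Section Conditions.
Context (Z : set (X * X)) (Z_operator : linear_operator Z) (t : R) (t0 : 0 < t).
Context (F : R -> 'L(X)) (F_class : F_class p F) (F_ef : extends_to_ef Z F)
  (F_dual : dual_condition F) (F_approx : approximation_condition Z t F).
Local Notation Zc := (fun x y : V => closure Z (x, y)).

Lemma condition_eq : locally_equicontinuous Q (operators F).
Proof. exact: E_class_equicontinuous F_class.1. Qed.

Lemma condition_mef x y : mef_derivative F (x, y) -> approx_derivative Q (operators F) x y.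
Proof. by apply: mef_approx; have [[]] := F_class. Qed.

Lemma condition_dense : densely_differentiable Q (operators F).
Proof.
move=> x q e Qq e0; have [_ dF] := F_class.
have [x' [[y' xy'] xx']] := dense_gauge dF x Qq e0.
by exists x', y'; split=> //; exact: condition_mef.
Qed.

Lemma condition_Z x y : closure Z (x, y) -> approx_derivative Q (operators F) x y.
Proof.
apply: closure_approx => {x y} x y Zxy; have [dZ Zef] := F_ef.
have [w xw] : domain (ef_derivative F) x by apply: dZ; exists y.
by rewrite -(Zef x y w Zxy xw); exact: condition_mef.
Qed.

(** Approximate derivatives persist under limits of graph points and are single-valued, so a
    vertical vector cannot appear in the closure. *)
Lemma condition_closure : linear_operator (closure Z).
Proof.
split; first exact: closure_subspace.
move=> x y y' /condition_Z xy /condition_Z xy'.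
exact: (approx_derivative_uniq condition_eq condition_dense xy xy').
Qed.

Lemma condition_adjoint (rho : {scalar V}) : bounded_functional Q rho ->
  exists psi eta : nat -> {scalar V},
    (forall j, adjoint_derivative Q (operators F) (psi j) (eta j)) /\
    forall x, (fun j => psi j x : R) @ \oo --> (rho x : R).
Proof.
move=> rb; have [phi phir] := real_functional_exists rb.
have [psi psiD psic] := F_dual phi.
have /choice[eta etaP] := psiD.
exists (fun j => real_functional (psi j)), (fun j => real_functional (eta j)); split.
  by move=> j; apply: strong_adjoint_derivative (etaP j); have [[]] := F_class.
move=> x; rewrite -phir; apply/cvgrPdist_le => e e0.
have e0' : 0 < of_real k e by rewrite -(@of_real0 R k) lt_of_real.
have /cvgrPdist_le/(_ _ e0') := psic x; apply: filterS => j; rewrite le_modulus => h.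
apply: le_trans h; apply: le_trans (real_part_le _); apply: ler_of_eq; congr `|_|.
by rewrite real_partD real_partN.
Qed.

Lemma evolveE n s x : evolve (operators F) (t / n%:R) s x =
  lc_pow (F (t / n%:R)) (Num.truncn (n%:R * s / t)) x.
Proof.
rewrite /evolve power_real_operator; congr (lc_pow _ (Num.truncn _) x).
by rewrite invf_div mulrCA mulrA.
Qed.

Lemma condition_solution : exists2 A : set X, dense A &
  forall f, A f -> exists u v, integrated_solution Q Zc f u v.
Proof.
have [A [_ AZ dA Aapp]] := F_approx; exists A => // f Af.
have [z Zfz] := AZ f Af.
have [|s s0|u [v uv]] := @integrated_trajectory R V Q (operators F) condition_eq
  condition_dense t t0 Zc (closure_linear_relation Z_operator)
  (closure_closed_relation (Z := Z)) condition_Z condition_adjoint f z; last by exists u, v.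
  exact: subset_closure.
have [u [v [Zuv uw vs us]]] := Aapp f s Af s0.
exists u, v; split=> //; last 2 first.
- exact: subseq_weak_cvg_subsequential.
- exact: subseq_weak_cvg_subsequential.
under [X in weak_limit _ X]eq_fun do rewrite evolveE.
exact: weak_cvg_limit.
Qed.

Lemma condition_generates : exists T, lC0_semigroup p T /\ generator T = closure Z.
Proof.
have [A dA AS] := condition_solution.
have dAg (x : V) q e : Q q -> 0 < e -> exists f, A f /\ q (x - f) <= e.
  exact: dense_gauge dA x q e.
have [S SE] := evolution_limit condition_eq condition_dense (closure_linear_relation Z_operator)
  condition_Z dAg AS.
have SS := limit_semigroup condition_eq condition_dense SE.
(* [S] was obtained as a real-linear map; multiplication by [c] commutes with every [F h], hence
   with the limit. *)
have SZ a c (x : X) : S a (c *: x) = c *: S a x.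
  have [g gE] := scalar_endomorphism c.
  rewrite -!gE; apply: (evolves_to_uniq (SE a (g x))).
  apply: evolves_to_map (SE a x).
    by move=> h y; rewrite !gE /real_operator; have := lc_linear (F h) c y 0;
      rewrite (linear_zero (lc_linear (F h))) !addr0.
  by move=> q Qq; have [q' Qq' qq'] := gauge_scale c Qq; exists q' => // y; rewrite gE.
(* At negative times the identity serves as a default value. *)
have /choice[T TS] : forall a, exists G : 'L(X), 0 <= a -> forall x, G x = S a x.
  move=> a; have [a0|a0] := leP 0 a; last by exists (lc_id X) => a0'; lra.
  have Slin : linear (S a : X -> X).
    by apply: linear_sub_scale => [x y|c x]; [exact: (semigroupB SS)|exact: SZ].
  have [G GS] := lcfun_exists Slin (semigroup_continuous SS a0).
  by exists G.
have TS' a x : 0 <= a -> T a x = S a x by move=> a0; exact: TS.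
have lT := lC0_of_semigroup SS TS'.
exists T; split=> //; have [_ T0 _ _] := lT.
apply/seteqP; split=> -[x y].
  move=> /(strong_derivative_generates p_seminorm p_topology X_hausdorff X_complete _ _ T0) gxy.
  apply/(limit_generates condition_eq condition_dense (closure_linear_relation Z_operator)
    (closure_closed_relation (Z := Z)) condition_Z dAg AS SE) => q e Qq e0.
  have := gxy q e Qq e0 => gh; near=> h.
  have h0 : 0 < h by near: h; exact: nbhs_right_gt.
  by rewrite -TS' ?(ltW h0) //; near: h.
move=> /(limit_generates condition_eq condition_dense (closure_linear_relation Z_operator)
    (closure_closed_relation (Z := Z)) condition_Z dAg AS SE) gxy.
apply/(strong_derivative_generates p_seminorm p_topology X_hausdorff X_complete _ _ T0) => q e Qq e0.
have := gxy q e Qq e0 => gh; near=> h.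
have h0 : 0 < h by near: h; exact: nbhs_right_gt.
by rewrite TS' ?(ltW h0) //; near: h.
Unshelve. all: by end_near. Qed.

(** [T] is any semigroup with this generator, not just the one constructed: its own orbits are the
    classical solutions with which the powers are compared. *)
Lemma condition_limit T f : lC0_semigroup p T -> generator T = closure Z ->
  dense (domain Z) ->
  lc_pow (F (t / n%:R)) n f @[n --> \oo] --> T t f.
Proof.
move=> lT gT dZ; have [_ T0 _ _] := lT.
have SS := semigroup_lC0 p_seminorm p_topology X_hausdorff X_complete lT.
have gen (x y : X) : generates Q (fun a (x : V) => T a x) x y <-> closure Z (x, y).
  by rewrite -gT; apply: iff_sym; exact: strong_derivative_generates.
have app (x y : V) : generates Q (fun a (x : V) => T a x) x y ->
    approx_derivative Q (operators F) x y.
  by move=> /gen/condition_Z.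
have dT (x : V) q e : Q q -> 0 < e -> exists f g,
    generates Q (fun a (x : V) => T a x) f g /\ q (x - f) <= e.
  move=> Qq e0; have [y [[z yz] xy]] := dense_gauge dZ x Qq e0.
  by exists y, z; split=> //; apply/gen; exact: subset_closure.
have ev := evolves_to_semigroup SS condition_eq condition_dense app dT f (ltW t0).
apply/(cvg_gauge p_seminorm p_topology X_hausdorff X_complete) => q Qq e e0.
have := near_step t0 (ev q e Qq e0) => step; near=> n.
have n0 : (0 < n)%N by near: n; exact: nbhs_infty_gt.
have : q (evolve (operators F) (t / n%:R) t f - T t f) <= e by near: n.
(* At the time [t] the number of steps is [[n * t / t]], which is exactly [n]. *)
rewrite evolveE mulfK ?lt0r_neq0 // natrK //.
Unshelve. all: by end_near. Qed.

End Conditions.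

(** * Necessity of the conditions *)

Section Necessity.
Context (Z : set (X * X)) (Z_operator : linear_operator Z) (Z_dense : dense (domain Z)).
Context (t : R) (t0 : 0 < t).
Context (T : R -> 'L(X)) (T_lC0 : lC0_semigroup p T) (T_gen : generator T = closure Z).
Local Notation S0 := (fun a (x : V) => T a x : V).

Lemma lC0_equicontinuous : equicontinuous_semigroup Q S0.
Proof. exact: semigroup_lC0. Qed.

Lemma lC0_zero : T 0 = lc_id X.
Proof. by have [] := T_lC0. Qed.

Lemma generates_closure x y : generates Q S0 x y <-> closure Z (x, y).
Proof. by rewrite -T_gen; apply: iff_sym; apply: strong_derivative_generates lC0_zero. Qed.

Lemma generates_mef x y : closure Z (x, y) -> mef_derivative T (x, y).
Proof.
rewrite -T_gen => xy; exists (fun=> x); split; first exact: cvg_cst.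
exact: xy.
Qed.

Lemma lC0_F_class : F_class p T.
Proof.
split; first by have [] := T_lC0.
move=> O O0 oO; have [x [Ox [y Zxy]]] := Z_dense O0 oO; exists x; split=> //.
by exists y; apply: generates_mef; exact: subset_closure.
Qed.

Lemma lC0_extends_to_ef : extends_to_ef Z T.
Proof.
split=> [x [y Zxy]|x y w Zxy xw].
  by exists y; apply: generates_mef; exact: subset_closure.
have T_eq : locally_equicontinuous Q (operators T).
  by apply: E_class_equicontinuous; have [] := lC0_F_class.
have mefT x' y' : mef_derivative T (x', y') -> approx_derivative Q (operators T) x' y'.
  by apply: mef_approx; exact: lC0_zero.
have T_dense : densely_differentiable Q (operators T).
  move=> x' q e Qq e0; have [_ dT] := lC0_F_class.
  have [x2 [[y2 xy2] xx2]] := dense_gauge dT x' Qq e0.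
  by exists x2, y2; split=> //; exact: mefT.
apply: (approx_derivative_uniq T_eq T_dense (mefT _ _ xw)).
by apply/mefT/generates_mef; exact: subset_closure.
Qed.

Lemma lc_pow_semigroup h m x : 0 <= h -> lc_pow (T h) m x = T (m%:R * h) x.
Proof.
move=> h0; elim: m => [|m IH]; first by rewrite mul0r lC0_zero.
rewrite [LHS]/= IH -(semigroupD lC0_equicontinuous) ?mulr_ge0 //; congr (T _ _).
by rewrite -natr1; ring.
Qed.

Lemma evolution_cvg s z : 0 <= s ->
  lc_pow (T (t / n%:R)) (Num.truncn (n%:R * s / t)) z @[n --> \oo] --> T s z.
Proof.
move=> s0; apply/(cvg_gauge p_seminorm p_topology X_hausdorff X_complete) => q Qq e e0.
have [d d0 dP] := semigroup_uniform lC0_equicontinuous z Qq s e0.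
near=> n; have n0 : (0 < n)%N by near: n; exact: nbhs_infty_gt.
have nR : 0 < n%:R :> R by rewrite ltr0n.
have h0 : 0 < t / n%:R by rewrite divr_gt0.
have hd : t / n%:R < d.
  near: n; apply: (near_step t0 (P := fun h => h < d)); exact: nbhs_right_lt.
have [m1 m2] := truncn_divP h0 s0.
have -> : n%:R * s / t = s / (t / n%:R) by rewrite invf_div mulrCA mulrA.
rewrite lc_pow_semigroup ?(ltW h0) //.
move: (Num.truncn _) m1 m2 => m m1 m2.
apply: dP => //; first by rewrite mulr_ge0 // ltW.
by rewrite distrC ger0_norm; lra.
Unshelve. all: by end_near. Qed.

Lemma cvg_weak_cvg (u : nat -> X) x : u @ \oo --> x -> weak_cvg u x.
Proof.
by move=> ux phi; apply: (cvg_comp u phi ux); exact: (@lc_continuous K X K^o phi).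
Qed.

(** For the semigroup itself the powers are values at rounded times, which preserve the domain of
    the generator and commute with it. The powers at [f] can therefore serve as [f_n^s], with the
    powers at [z] as their images; the difference in (a) is 0, and both sequences even converge
    strongly. *)
Lemma lC0_approximation_condition : approximation_condition Z t T.
Proof.
have [[Z0 ZL] _] := Z_operator.
exists (domain Z); split=> //.
  split; first by exists 0.
  by move=> a x y [x' Zx] [y' Zy]; exists (a *: x' + y'); exact: (ZL a _ _ Zx Zy).
move=> f s [z Zfz] s0.
pose P x n := lc_pow (T (t / n%:R)) (Num.truncn (n%:R * s / t)) x.
have sub x : subseq_weak_cvg (P x).
  move=> j jh; exists id, (T s x); split=> // phi.
  have w : weak_cvg (P x) (T s x) by apply: cvg_weak_cvg; exact: (@evolution_cvg s x s0).
  have /cvgrPdist_le h := w phi.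
  apply/cvgrPdist_le => e e0; exact: (near_increasing_index jh (h e e0)).
exists (P f), (P z); split=> //.
  move=> n n0; apply/generates_closure.
  have h0 : 0 <= t / n%:R by rewrite divr_ge0 // ltW.
  rewrite /P !lc_pow_semigroup //; apply: (generates_orbit lC0_equicontinuous).
    by apply/generates_closure; exact: subset_closure.
  by rewrite mulr_ge0.
move=> phi; under eq_fun do rewrite subrr.
exact: cvg_cst.
Qed.

(* The functionals [phi \o E a], with [E a] the square of the mean of [T] over
   [0, a], are in the domain: as [E a] has two factors, the difference quotients
   of [T h \o E a] converge uniformly on bounded sets, as the strong topology
   requires. *)
Lemma lC0_dual_condition : dual_condition T.
Proof.
have [S S_int] := semigroup_integral lC0_equicontinuous.
have SZ a (c : K) (x : X) : 0 <= a -> S a (c *: x) = c *: S a x.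
  move=> a0; have [g gE] := scalar_endomorphism c.
  rewrite -!gE; apply/esym; apply: (@integral_map R V Q S0 S S_int g a x a0).
    move=> r y r0; rewrite !gE.
    by have := lc_linear (T r) c y 0; rewrite (linear_zero (lc_linear (T r))) !addr0.
  by move=> q Qq; have [q' Qq' qq'] := gauge_scale c Qq; exists q' => // y; rewrite gE.
have TZ r (c : K) (x : X) : T r (c *: x) = c *: T r x.
  by have := lc_linear (T r) c x 0; rewrite (linear_zero (lc_linear (T r))) !addr0.
have SB a (x y : V) : 0 <= a -> S a (x - y) = S a x - S a y.
  exact: (integralB lC0_equicontinuous S_int).
have TB a (x y : V) : T a (x - y) = T a x - T a y by exact: (semigroupB lC0_equicontinuous).
pose E a (x : V) : V := a^-1 *: (a^-1 *: S a (S a x)).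
(* [D a] is the generator applied to [E a]: the derivative of the outer integral produces [T a - 1]
   at [S a x]. *)
pose D a (x : V) : V := a^-1 *: (a^-1 *: (T a (S a x) - S a x : V)).
have scaleC (a : R) (c : K) (x : X) : a *: (c *: x : V) = c *: (a *: (x : V)) :> X.
  by rewrite -[LHS]/(of_real k a *: (c *: x)) scalerA mulrC -scalerA.
have Elin a : 0 <= a -> linear (E a : X -> X).
  move=> a0; apply: linear_sub_scale => [x y|c x].
    by rewrite /E !SB // !scalerBr.
  by rewrite /E !SZ // [X in _ *: X]scaleC; exact: scaleC.
have Dlin a : 0 <= a -> linear (D a : X -> X).
  move=> a0; apply: linear_sub_scale => [x y|c x].
    rewrite /D !SB // TB -!scalerBr; congr (_ *: (_ *: _)).
    by rewrite opprD addrACA -opprD.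
  have -> : D a (c *: x) = a^-1 *: (a^-1 *: (c *: (T a (S a x) - S a x) : V)).
    by rewrite /D SZ // TZ; congr (_ *: (_ *: _)); exact: (esym (@scalerBr K X c (T a (S a x)) (S a x))).
  by rewrite [X in _ *: X]scaleC; exact: scaleC.
have Scont a q : 0 <= a -> Q q -> exists2 q', Q q' & forall x, q (S a x) <= q' x.
  move=> a0 Qq; have [q' Qq' qq'] := integral_bound lC0_equicontinuous S_int a Qq.
  by exists (fun x => a * q' x); [exact: gaugeZ|move=> x; exact: qq'].
have Zcont (b : R) q : Q q -> exists2 q', Q q' & forall x : V, q (b *: x) <= q' x.
  move=> Qq; exists (fun x => `|b| * q x); first exact: gaugeZ.
  by move=> x; rewrite (seminormZ (gauge_seminorm Qq)).
have Econt a q : 0 <= a -> Q q -> exists2 q', Q q' & forall x, q (E a x) <= q' x.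
  move=> a0 Qq; have [q1 Qq1 k1] := Zcont a^-1 q Qq; have [q2 Qq2 k2] := Zcont a^-1 q1 Qq1.
  have [q3 Qq3 k3] := Scont a q2 a0 Qq2; have [q4 Qq4 k4] := Scont a q3 a0 Qq3.
  exists q4 => // x; apply: le_trans (k1 _) _; apply: le_trans (k2 _) _.
  exact: le_trans (k3 _) (k4 _).
have Dcont a q : 0 <= a -> Q q -> exists2 q', Q q' & forall x, q (D a x) <= q' x.
  move=> a0 Qq; have [q1 Qq1 k1] := Zcont a^-1 q Qq; have [q2 Qq2 k2] := Zcont a^-1 q1 Qq1.
  have [q3 Qq3 k3] := semigroup_continuous lC0_equicontinuous a0 Qq2.
  have [q4 Qq4 k4] := Scont a _ a0 (gaugeD Qq3 Qq2).
  exists q4 => // x; apply: le_trans (k1 _) _; apply: le_trans (k2 _) _.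
  apply: le_trans (seminormB (gauge_seminorm Qq2) _ _) _.
  by apply: le_trans (k4 x); rewrite lerD2r.
move=> phi; pose a (n : nat) : R := 1 / n.+1%:R.
have a0 n : 0 < a n by rewrite divr_gt0.
have /choice[G GE] : forall n, exists G : 'L(X), forall x, G x = E (a n) x.
  move=> n; apply: (@lcfun_exists _ _ _ _ _ p_seminorm p_topology X_hausdorff X_complete).
    exact: (Elin _ (ltW (a0 n))).
  by move=> q Qq; exact: (Econt _ _ (ltW (a0 n)) Qq).
have /choice[H HD] : forall n, exists G : 'L(X), forall x, G x = D (a n) x.
  move=> n; apply: (@lcfun_exists _ _ _ _ _ p_seminorm p_topology X_hausdorff X_complete).
    exact: (Dlin _ (ltW (a0 n))).
  by move=> q Qq; exact: (Dcont _ _ (ltW (a0 n)) Qq).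
have Qphi := gauge_modulus p_seminorm p_topology X_hausdorff X_complete phi.
have phiB (x y : X) : phi (x - y) = phi x - phi y.
  by rewrite [x - y]addrC -[- y]scaleN1r lc_linear scaleN1r addrC.
have phiZ (b : R) (x : V) : phi (b *: x) = of_real k b * phi x.
  have := lc_linear phi (of_real k b) x 0; rewrite (linear_zero (lc_linear phi)) !addr0.
  exact.
exists (fun n => lc_comp phi (G n) : dual X) => [n|x].
  exists (lc_comp phi (H n) : dual X).
  apply/(adjoint_strong_derivative p_seminorm p_topology X_hausdorff X_complete _ _ lC0_zero).
  move=> A bA e e0; set b := a n; have b0 : 0 < b by exact: a0.
  have [q' Qq' qq'] := integral_regularizes lC0_equicontinuous S_int Qphi (ltW b0).
  have [c cA] := bA q' Qq'.
  have c1 : 0 < `|c| + 1 by have := normr_ge0 c; lra.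
  have bb : 0 < b * b by rewrite mulr_gt0.
  near=> h; have h0 : 0 < h by near: h; exact: nbhs_right_gt.
  have h1 : h < 1 by near: h; exact: nbhs_right_lt.
  have he : h < e * (b * b) / (`|c| + 1).
    by near: h; apply: nbhs_right_lt; rewrite divr_gt0 // mulr_gt0.
  move=> x Ax; rewrite /= GE HD GE.
  (* The adjoint acts by composition on the right; as [T h] commutes with the integrals, it can be
     moved to the outside, where [integral_regularizes] applies. *)
  have -> : E b (T h x) = b^-1 *: (b^-1 *: (T h (S b (S b x)) : V)).
    by rewrite /E !(integral_comm lC0_equicontinuous S_int) ?(ltW h0) ?(ltW b0).
  have -> : (of_real k h)^-1 * (phi (b^-1 *: (b^-1 *: (T h (S b (S b x)) : V))) - phi (E b x))
      - phi (D b x) = phi ((b * b)^-1 *: (h^-1 *: ((T h (S b (S b x)) : V) - S b (S b x))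
        - ((T b (S b x) : V) - S b x)) : V).
    rewrite -phiB -of_realV -phiZ -phiB /E /D; congr (phi _).
    exact: (@rescaled_quotient R V b h (T h (S b (S b x))) (S b (S b x)) (T b (S b x) - S b x)).
  rewrite phiZ modulusM modulus_of_real gtr0_norm ?invr_gt0 // ler_pdivrMl //.
  apply: le_trans (qq' h x h0 (ltW h1)) _.
  have := cA x Ax; have := ler_norm c; move: he; rewrite ltr_pdivlMr // [b * b * e]mulrC.
  have := gauge_ge0 (x : V) Qq'; nra.
apply/cvgrPdist_le => e /gt0_of_real[r r0 ->].
have lim := integral_regularization_limit lC0_equicontinuous S_int x Qphi r0.
have succ_inc : increasing_index succn by [].
have := near_increasing_index succ_inc (near_step ltr01 lim); apply: filterS => n.
rewrite -/(a n) -[_ *: _]/(E (a n) x) => h.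
rewrite le_modulus /= GE -phiB.
by have := seminormC (gauge_seminorm Qphi) (x : V) (E (a n) x) => /= ->.
Unshelve. all: by end_near. Qed.

End Necessity.
End MainResult.

Theorem theorem8p3 (R : realType) (k : scalar_kind) (X : tvsType (scalar_field R k))
    (Omega : Type) (p : Omega -> X -> scalar_field R k)
    (p_seminorm : forall al, is_seminorm (p al))
    (p_topology : generate_topology p)
    (X_hausdorff : hausdorff_space X) (X_complete : complete_tvs X)
    (Z : set (X * X)) (Z_operator : linear_operator Z)
    (Z_dense : dense (domain Z)) (t : R) (t_gt0 : 0 < t) :
  ((linear_operator (closure Z) /\
    exists T : R -> 'L(X), lC0_semigroup p T /\ generator T = closure Z)
   <->
   exists F : R -> 'L(X),
     [/\ F_class p F, extends_to_ef Z F, dual_condition F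
       & approximation_condition Z t F]) /\
  (forall F : R -> 'L(X),
     [/\ F_class p F, extends_to_ef Z F, dual_condition F
       & approximation_condition Z t F] ->
   forall T : R -> 'L(X), lC0_semigroup p T -> generator T = closure Z ->
   forall f : X, lc_pow (F (t / n%:R)) n f @[n --> \oo] --> T t f).
Proof.
split; first split.
- move=> [_ [T [lT gT]]]; exists T; split.
  + exact: (lC0_F_class Z_dense lT gT).
  + exact: (lC0_extends_to_ef p_seminorm p_topology X_hausdorff X_complete Z_dense lT gT).
  + exact: (lC0_dual_condition p_seminorm p_topology X_hausdorff X_complete lT).
  + exact: (lC0_approximation_condition p_seminorm p_topology X_hausdorff X_complete
      Z_operator Z_dense t_gt0 lT gT).
- move=> [F [Fc Fe Fd Fa]]; split.
    exact: (condition_closure p_seminorm p_topology X_hausdorff X_complete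
      Z_operator Fc Fe).
  exact: (condition_generates p_seminorm p_topology X_hausdorff X_complete
    Z_operator t_gt0 Fc Fe Fd Fa).
- move=> F [Fc Fe Fd Fa] T lT gT f.
  exact: (condition_limit p_seminorm p_topology X_hausdorff X_complete t_gt0 Fc Fe
    lT gT Z_dense).
Qed.
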